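(* Let $S$ be a positive trace class operator on $L^2(\mathbb{R}^d)$ with $\mathrm{tr}(S)=1$. Then $S$ defines a covariant positive operator valued measure $F$ on $\mathbb{R}^{2d}$ by $$F(\Omega)=\chi_\Omega\star S$$ for any measurable $\Omega\subset\mathbb{R}^{2d}$.
   Context: For $z=(x,\omega)\in\mathbb{R}^{2d}$, $\pi(z)\psi(t)=e^{2\pi i\omega\cdot t}\psi(t-x)$ on $L^2(\mathbb{R}^d)$, $\alpha_z(A)=\pi(z)A\pi(z)^*$. For $f\in L^\infty(\mathbb{R}^{2d})$ and $S$ trace class, $f\star S$ is the bounded operator determined weakly by $\langle(f\star S)\psi,\phi\rangle=\iint_{\mathbb{R}^{2d}}f(z)\langle\alpha_z(S)\psi,\phi\rangle\,dz$ for $\psi,\phi\in L^2(\mathbb{R}^d)$. A positive operator valued measure (POVM) on $\mathbb{R}^{2d}$ is a map $F$ from the Borel sets $\mathcal{B}(\mathbb{R}^{2d})$ to $B(L^2(\mathbb{R}^d))$ such that (1) $F(M)$ is a positive operator for every $M$; (2) $F(\mathbb{R}^{2d})$ is the identity; (3) $F(\bigcup_i M_i)=\sum_iF(M_i)$ for every countable collection of pairwise disjoint measurable sets, with convergence in the weak operator topology. It is covariant if $\alpha_z(F(M))=F(M+z)$ for all $z\in\mathbb{R}^{2d}$, $M\in\mathcal{B}(\mathbb{R}^{2d})$, where $M+z=\{m+z:m\in M\}$. *)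

(* Defs.v *)
From HB Require Import structures.
From mathcomp Require Import all_boot all_order all_algebra.
From mathcomp Require Import generic_quotient ring_quotient.
From mathcomp Require Import complex lra.
From mathcomp Require Import all_classical all_reals all_analysis.
From mathcomp Require Import measurable_realfun.

Set Implicit Arguments.
Unset Strict Implicit.
Unset Printing Implicit Defensive.
Import Order.TTheory GRing.Theory Num.Theory.
Import numFieldNormedType.Exports.

Local Open Scope classical_set_scope.
Local Open Scope ring_scope.
Local Open Scope complex_scope.

Local Notation Re := (@complex.Re _).
Local Notation Im := (@complex.Im _).
Local Notation normc := Normc.normc.

Section countable_dense.
Context {R : realType} (T : pseudoMetricType R) (I : countType) (q : I -> T).
Hypothesis q_dense : forall (x : T) (e : R), 0 < e -> exists i, ball (q i) e x.

Lemma open_bigcup_ball (U : set T) : open U ->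
  U = \bigcup_(p in [set p : I * nat | ball (q p.1) (p.2.+1%:R^-1 : R) `<=` U])
        ball (q p.1) (p.2.+1%:R^-1 : R).
Proof.
move=> oU; apply/seteqP; split => [x Ux|x [p /= pU]]; last exact: pU.
have [e /= e0 eU] : exists2 e : R, 0 < e & ball x e `<=` U.
  by have := open_nbhs_nbhs (conj oU Ux); move/nbhs_ballP.
have e20 : 0 < e / 2 by rewrite divr_gt0.
have [k _ /(_ k (leqnn k)) /= ke] := near_infty_natSinv_lt (PosNum e20).
have k0 : 0 < (k.+1%:R^-1 : R) by rewrite invr_gt0.
have [i qi] := q_dense x k0.
exists (i, k) => //= y qy; apply: eU.
rewrite (splitr e); apply: (@ball_triangle _ _ (q i)).
  by apply: ball_sym; exact: le_ball (ltW ke) _ qi.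
exact: le_ball (ltW ke) _ qy.
Qed.

Lemma open_sigma_algebra (S : set (set T)) :
    sigma_algebra setT S -> (forall x (e : R), 0 < e -> S (ball x e)) ->
  @open T `<=` S.
Proof.
move=> [S0 SC SU] Sball U oU; rewrite (open_bigcup_ball oU).
pose D := [set p : I * nat | ball (q p.1) (p.2.+1%:R^-1 : R) `<=` U].
pose F n := if unpickle n is Some p then
  (if `[< D p >] then ball (q p.1) (p.2.+1%:R^-1 : R) else set0) else set0.
rewrite (_ : \bigcup_(p in _) _ = \bigcup_n F n).
  apply: SU => n; rewrite /F; case: (unpickle n) => // p.
  by case: ifPn => // _; apply: Sball; rewrite invr_gt0.
apply/seteqP; split => [x [p Dp px]|x [n _]].
  by exists (pickle p) => //; rewrite /F pickleK ifT//; exact/asboolP.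
rewrite /F; case: (unpickle n) => // p; case: ifPn => // /asboolP Dp px.
by exists p.
Qed.

End countable_dense.

Section borel_rV.
Context {R : realType} (n : nat).
Implicit Types (v : 'rV[R]_n).

Definition rV_display : measure_display. Proof. by constructor. Qed.

HB.instance Definition _ := @isMeasurable.Build rV_display 'rV[R]_n
  <<s @open 'rV[R]_n >> (@sigma_algebra0 _ setT _)
  (@sigma_algebraC _ _) (@sigma_algebra_bigcup _ setT _).

Lemma measurable_coord_rV (i : 'I_n) :
  measurable_fun [set: 'rV[R]_n] (fun v => v ord0 i).
Proof.
apply: (measurability _ (RGenOpens.measurableE R)) => _ [_ [a [b ->]] <-].
rewrite setTI; apply: sub_sigma_algebra.
apply: open_comp; last exact: interval_open.
by move=> v _; exact: coord_continuous.
Qed.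

Lemma ball_rVE v (e : R) : 0 < e ->
  ball v e = [set w | forall i, ball (v ord0 i) e (w ord0 i)].
Proof.
move=> e0; apply/seteqP; split => [w [_ vw] i|w vw]; first exact: vw.
by split => // i j; rewrite ord1; exact: vw.
Qed.

Lemma rat_dense_rV v (e : R) : 0 < e ->
  exists q : 'rV[rat]_n, ball (map_mx ratr q : 'rV[R]_n) e v.
Proof.
move=> e0.
have /choice[q qP] : forall i, exists q : rat, ball (ratr q : R) e (v ord0 i).
  move=> i; have [x [vx [r _ rx]]] : ball (v ord0 i) e `&` range ratr !=set0.
    by apply: (@dense_rat R); [exists (v ord0 i); exact: ballxx|exact: ball_open].
  by exists r; rewrite rx; exact: ball_sym.
by exists (\row_i q i); rewrite ball_rVE// => i; rewrite !mxE.
Qed.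

Lemma measurable_fun_rV d (T : measurableType d) (f : T -> 'rV[R]_n) :
  (forall i, measurable_fun setT (fun x => f x ord0 i)) -> measurable_fun setT f.
Proof.
move=> mf; apply: (@measurability _ _ _ _ _ _ (@open 'rV[R]_n)) => [//|].
move=> _ [U oU <-]; rewrite setTI.
suff: @open 'rV[R]_n `<=` [set B | measurable (f @^-1` B)] by exact.
apply: (open_sigma_algebra rat_dense_rV).
- split => [|A mA|F mF] /=.
  + by rewrite preimage_set0.
  + by rewrite setTD preimage_setC; exact: measurableC.
  + by rewrite preimage_bigcup; exact: bigcupT_measurable.
- move=> v e e0 /=; rewrite ball_rVE//.
  rewrite (_ : _ @^-1` _ =
    \bigcap_(i in [set: 'I_n]) (fun x => f x ord0 i) @^-1` ball (v ord0 i) e).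
    apply: fin_bigcap_measurable => // i _; rewrite -[X in measurable X]setTI.
    by apply: mf => //; exact: measurable_ball.
  by apply/seteqP; split => [x fx i _|x fx i]; [exact: fx|exact: fx].
Qed.

End borel_rV.

Section borel_prod.
Context {R : realType} (m n : nat).
Local Notation E := ('rV[R]_m * 'rV[R]_n)%type.

(* The library equips E with the product sigma-algebra, which is Borel here. *)
Lemma measurable_prod_rVE : @measurable _ E = <<s @open E >>.
Proof.
apply/seteqP; split.
- apply: smallest_sub; first exact: smallest_sigma_algebra.
  have sub k (f : E -> 'rV[R]_k) : continuous f ->
      preimage_set_system setT f (@measurable _ 'rV[R]_k) `<=` <<s @open E >>.
    move=> cf; rewrite -g_sigma_preimageE.
    apply: smallest_sub; first exact: smallest_sigma_algebra.
    move=> _ [U oU <-]; rewrite setTI; apply: sub_sigma_algebra.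
    by apply: open_comp => // p _; exact: cf.
  move=> A [fA|fA]; first by apply: sub fA => p; exact: cvg_fst.
  by apply: sub fA => p; exact: cvg_snd.
- apply: smallest_sub; first exact: sigma_algebra_measurable.
  have := @open_sigma_algebra R E _ (fun q : 'rV[rat]_m * 'rV[rat]_n =>
    (map_mx ratr q.1, map_mx ratr q.2)).
  apply.
  + move=> [x y] e e0; have [p px] := rat_dense_rV x e0.
    by have [q qy] := rat_dense_rV y e0; exists (p, q).
  + exact: sigma_algebra_measurable.
  + move=> [x y] e e0; rewrite (_ : ball _ _ = ball x e `*` ball y e)//.
    by apply: measurableX; apply: sub_sigma_algebra; exact: ball_open.
Qed.

End borel_prod.

Section lebesgue_rV.
Context {R : realType}.

Definition rV_cons n (p : measurableTypeR R * 'rV[R]_n) : 'rV[R]_(1 + n) :=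
  row_mx p.1%:M p.2.

Definition rV_uncons n (v : 'rV[R]_(1 + n)) : measurableTypeR R * 'rV[R]_n :=
  (lsubmx v ord0 ord0, rsubmx v).

Lemma rV_consK n : cancel (@rV_cons n) (@rV_uncons n).
Proof.
by move=> [x v]; rewrite /rV_uncons /rV_cons row_mxKl row_mxKr mxE eqxx mulr1n.
Qed.

Lemma measurable_rV_cons n : measurable_fun setT (@rV_cons n).
Proof.
apply: measurable_fun_rV => i; case: (split_ordP i) => j ->.
  under eq_fun do rewrite row_mxEl mxE !ord1 eqxx mulr1n.
  exact: measurable_fst.
under eq_fun do rewrite row_mxEr.
apply: (measurableT_comp (measurable_coord_rV j)); exact: measurable_snd.
Qed.

Lemma measurable_rV_uncons n : measurable_fun setT (@rV_uncons n).
Proof.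
apply: measurable_fun_pair => /=.
  by under eq_fun do rewrite mxE; exact: measurable_coord_rV.
apply: measurable_fun_rV => i.
by under eq_fun do rewrite mxE; exact: measurable_coord_rV.
Qed.

Section lebesgue_rV_succ.
Context n (mu : {sigma_finite_measure set 'rV[R]_n -> \bar R}).

Definition lebesgue_rV_succ : set 'rV[R]_n.+1 -> \bar R :=
  pushforward (@lebesgue_measure R \x mu)%E (@rV_cons n).

Let m : {measure set 'rV[R]_n.+1 -> \bar R} :=
  measure_function_pushforward__canonical__measure_function_Measure
    (@lebesgue_measure R \x mu)%E (@measurable_rV_cons n).

HB.instance Definition _ := isMeasure.Build _ _ _ lebesgue_rV_succ
  (measure0 m) (measure_ge0 m) (@measure_semi_sigma_additive _ _ _ m).

Let sigma_finite_succ : sigma_finite setT lebesgue_rV_succ.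
Proof.
have /sigma_finiteP[F [TF ndF Foo]] := sigma_finiteT (@lebesgue_measure R).
have /sigma_finiteP[G [TG ndG Goo]] := sigma_finiteT mu.
exists (fun k => @rV_uncons n @^-1` (F k `*` G k)) => [|k].
  rewrite -preimage_bigcup (_ : \bigcup_k _ = setT) ?preimage_setT//.
  rewrite -subTset => -[x y] _.
  have [i _ Fix] : (\bigcup_i F i) x by rewrite -TF.
  have [j _ Gjy] : (\bigcup_j G j) y by rewrite -TG.
  exists (maxn i j) => //; split.
    by move: x Fix; exact/subsetPset/ndF/leq_maxl.
  by move: y Gjy; exact/subsetPset/ndG/leq_maxr.
have [mF Fk] := Foo k; have [mG Gk] := Goo k; split.
  rewrite -[X in measurable X]setTI; apply: measurable_rV_uncons => //.
  exact: measurableX.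
rewrite /lebesgue_rV_succ /pushforward -comp_preimage.
rewrite (_ : _ \o _ = id); last by apply/funext => p /=; exact: rV_consK.
by rewrite preimage_id product_measure1E// lte_mul_pinfty// ge0_fin_numE.
Qed.

HB.instance Definition _ := Measure_isSigmaFinite.Build _ _ _ lebesgue_rV_succ
  sigma_finite_succ.

End lebesgue_rV_succ.

Fixpoint lebesgue_rV n : {sigma_finite_measure set 'rV[R]_n -> \bar R} :=
  if n is n'.+1 then lebesgue_rV_succ (lebesgue_rV n')
  else dirac (0 : 'rV[R]_0).

End lebesgue_rV.

Section complex_integral.
Context d (T : measurableType d) (R : realType).
Variable mu : {measure set T -> \bar R}.
Implicit Types f : T -> R[i].

Definition measurable_funC f :=
  measurable_fun setT (Re \o f) /\ measurable_fun setT (Im \o f).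

Definition integrableC f :=
  mu.-integrable setT (EFin \o (Re \o f)) /\
  mu.-integrable setT (EFin \o (Im \o f)).

Definition integralC f : R[i] :=
  (\int[mu]_x Re (f x)) +i* (\int[mu]_x Im (f x)).

End complex_integral.

Section L2.
Context d (T : measurableType d) (R : realType).
Variable mu : {measure set T -> \bar R}.
Implicit Types f g : T -> R[i].

Definition sqint : {pred T -> R[i]} := mem [set f |
  measurable_funC f /\ (\int[mu]_x (normc (f x) ^+ 2)%:E < +oo)%E].

Lemma sqr_normcE (z : R[i]) :
  normc z ^+ 2 = Re z ^+ 2 + Im z ^+ 2.
Proof. by case: z => a b /=; rewrite sqr_sqrtr// addr_ge0// sqr_ge0. Qed.

Lemma sqr_normc_le (a z w : R[i]) : normc (a * z + w) ^+ 2 <=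
  2 * normc a ^+ 2 * normc z ^+ 2 + 2 * normc w ^+ 2.
Proof.
rewrite -mulrA -exprMn -Normc.normcM; move: (a * z) => {}z.
rewrite !sqr_normcE; case: z w => [p q] [r s] /=.
have := sqr_ge0 (p - r); have := sqr_ge0 (q - s).
rewrite !sqrrB !sqrrD; lra.
Qed.

Lemma measurable_funC_lin (a : R[i]) f g :
  measurable_funC f -> measurable_funC g -> measurable_funC (a *: f + g).
Proof.
move=> [mf1 mf2] [mg1 mg2]; split.
- rewrite (_ : _ \o _ = fun x => Re a * Re (f x) -
     Im a * Im (f x) + Re (g x)).
    apply: measurable_funD => //; apply: measurable_funB; exact: measurable_funM.
  by apply/funext => x /=; rewrite !fctE /GRing.scale/=; case: a (f x) (g x) => ? ? [? ?] [? ?].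
- rewrite (_ : _ \o _ = fun x => Re a * Im (f x) +
     Im a * Re (f x) + Im (g x)).
    apply: measurable_funD => //; apply: measurable_funD; exact: measurable_funM.
  by apply/funext => x /=; rewrite !fctE /GRing.scale/=; case: a (f x) (g x) => ? ? [? ?] [? ?].
Qed.

Lemma measurable_sqr_normc f : measurable_funC f ->
  measurable_fun setT (fun x => normc (f x) ^+ 2).
Proof.
move=> [mf1 mf2]; under eq_fun do rewrite sqr_normcE.
by apply: measurable_funD; apply: measurable_funX.
Qed.

Lemma sqint_submod_closed : submod_closed sqint.
Proof.
split.
  rewrite inE; split; first by split; exact: measurable_cst.
  by under eq_integral do rewrite Normc.normc0 expr0n; rewrite integral0.
move=> a f g; rewrite !inE => -[mf foo] [mg goo].
have mh := measurable_funC_lin a mf mg; split => //.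
have mF (k : R) (h : T -> R[i]) : measurable_funC h ->
    measurable_fun setT (fun x => (k * normc (h x) ^+ 2)%:E).
  move=> hm; apply/measurable_EFinP; apply: measurable_funM => //.
  exact: measurable_sqr_normc.
have intF (k : R) (h : T -> R[i]) : 0 <= k -> measurable_funC h ->
    (\int[mu]_x (normc (h x) ^+ 2)%:E < +oo ->
     \int[mu]_x (k * normc (h x) ^+ 2)%:E < +oo)%E.
  move=> k0 hm hoo; under eq_integral do rewrite EFinM.
  rewrite ge0_integralZl_EFin//; first exact: lte_mul_pinfty.
  - by move=> x _; rewrite lee_fin sqr_ge0.
  - by apply/measurable_EFinP; exact: measurable_sqr_normc.
have c0 : 0 <= 2 * normc a ^+ 2 by rewrite mulr_ge0 ?sqr_ge0.
apply: (@le_lt_trans _ _ (\int[mu]_x (2 * normc a ^+ 2 * normc (f x) ^+ 2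
  + 2 * normc (g x) ^+ 2)%:E)%E).
  apply: ge0_le_integral => //.
  - by move=> x _; rewrite lee_fin sqr_ge0.
  - by apply/measurable_EFinP; exact: measurable_sqr_normc.
  - apply/measurable_EFinP; apply: measurable_funD; apply/measurable_EFinP; exact: mF.
  - by move=> x _; rewrite lee_fin; exact: sqr_normc_le.
under eq_integral do rewrite EFinD.
rewrite ge0_integralD//.
- by apply: lte_add_pinfty; apply: intF.
- by move=> x _; rewrite lee_fin mulr_ge0 ?sqr_ge0.
- exact: mF.
- by move=> x _; rewrite lee_fin mulr_ge0 ?sqr_ge0.
- exact: mF.
Qed.

HB.instance Definition _ :=
  GRing.isSubmodClosed.Build R[i] (T -> R[i]) sqint sqint_submod_closed.

Record sqint_fun := SqintFun { sqint_val :> T -> R[i]; _ : sqint_val \in sqint }.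

HB.instance Definition _ := [isSub for sqint_val].
HB.instance Definition _ := [Choice of sqint_fun by <:].
HB.instance Definition _ := [SubChoice_isSubLmodule of sqint_fun by <:].

Definition null_fun : {pred sqint_fun} :=
  mem [set f : sqint_fun | (f : T -> R[i]) = cst 0 %[ae mu]].

Lemma null_funP (f : sqint_fun) :
  reflect ((f : T -> R[i]) = cst 0 %[ae mu]) (f \in null_fun).
Proof. by apply: (iffP idP); rewrite inE. Qed.

Lemma null_fun_zmod_closed : zmod_closed null_fun.
Proof.
split; first by apply/null_funP; apply: aeW => x.
move=> f g /null_funP f0 /null_funP g0; apply/null_funP.
by apply: filterS2 f0 g0 => x /= fx gx Tx; rewrite -[LHS]/(f x - g x) fx// gx// subrr.
Qed.

HB.instance Definition _ :=
  GRing.isZmodClosed.Build sqint_fun null_fun null_fun_zmod_closed.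

(* L^2(mu) with complex scalars: square-integrable functions modulo equality
   almost everywhere. *)
Definition L2 : Type := Quotient.quot null_fun.

HB.instance Definition _ := EqQuotient.on L2.
HB.instance Definition _ := GRing.Zmodule.on L2.

Local Open Scope quotient_scope.

Definition L2_scale (a : R[i]) : L2 -> L2 := lift_op1 L2 ( *:%R a).

Lemma pi_L2_scale a : {morph \pi_L2 : f / a *: f >-> L2_scale a f}.
Proof.
move=> f; unlock L2_scale; apply/eqmodP => /=.
rewrite /Quotient.equiv -scalerBr; apply/null_funP.
have /null_funP : f - repr (\pi_L2 f) \in null_fun.
  by rewrite Quotient.idealrBE reprK.
apply: filterS => x /= fx Tx.
by apply: etrans (mulr0 a); congr (_ * _); exact: fx.
Qed.

Lemma pi_L2D : {morph \pi_L2 : f g / f + g >-> f + g}.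
Proof. exact: (Quotient.pi_add _). Qed.

Lemma L2_scaleA a b u : L2_scale a (L2_scale b u) = L2_scale (a * b) u.
Proof. by elim/quotW: u => f; rewrite -!pi_L2_scale scalerA. Qed.

Lemma L2_scale1 : left_id 1 L2_scale.
Proof. by elim/quotW => f; rewrite -pi_L2_scale scale1r. Qed.

Lemma L2_scaleDr : right_distributive L2_scale +%R.
Proof.
move=> a; elim/quotW => f; elim/quotW => g.
by rewrite -pi_L2D -!pi_L2_scale -pi_L2D scalerDr.
Qed.

Lemma L2_scaleDl u : {morph L2_scale^~ u : a b / a + b}.
Proof.
by move=> a b; elim/quotW: u => f; rewrite -!pi_L2_scale -pi_L2D scalerDl.
Qed.

HB.instance Definition _ := GRing.Zmodule_isLmodule.Build R[i] L2
  L2_scaleA L2_scale1 L2_scaleDr L2_scaleDl.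

(* The class of f when f is square-integrable, and 0 otherwise. *)
Definition L2_class (f : T -> R[i]) : L2 := \pi_L2 (insubd (0 : sqint_fun) f).

Definition L2_repr (u : L2) : T -> R[i] := repr u.

Lemma L2_reprK : cancel L2_repr L2_class.
Proof. by move=> u; rewrite /L2_class /L2_repr valKd reprK. Qed.

Lemma L2_classK f : f \in sqint -> L2_repr (L2_class f) = f %[ae mu].
Proof.
move=> fL2; have fE : f = insubd (0 : sqint_fun) f :> (T -> R[i]).
  by rewrite insubdK.
have /null_funP : repr (L2_class f) - insubd (0 : sqint_fun) f \in null_fun.
  by rewrite Quotient.idealrBE reprK.
apply: filterS => x /= rx Tx; apply/eqP; rewrite -subr_eq0 {2}fE; apply/eqP.
exact: rx.
Qed.

Definition dotL2 (u v : L2) : R[i] :=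
  integralC mu (fun x => L2_repr u x * conjc (L2_repr v x)).

End L2.

Section operators.
Context d (T : measurableType d) (R : realType).
Variable mu : {measure set T -> \bar R}.
Local Notation H := (L2 mu).
Implicit Types (A P S : H -> H) (e : nat -> H).

Definition normL2 (u : H) : R := Num.sqrt (Re (dotL2 u u)).

Definition bounded_operator A : Prop :=
  linear A /\ exists M : R, forall u, normL2 (A u) <= M * normL2 u.

Definition is_adjoint A B : Prop := forall u v, dotL2 (A u) v = dotL2 u (B v).

(* dotL2 is nondegenerate, so A has at most one adjoint; every bounded A has one. *)
Definition adjoint A : H -> H := xget (fun=> 0) (is_adjoint A).

(* In the order of R[i], 0 <= z means that z is real and nonnegative. *)
Definition positive_operator A : Prop := forall u, 0 <= dotL2 (A u) u.

Definition orthonormal_basis e : Prop :=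
  (forall m n, dotL2 (e m) (e n) = (m == n)%:R) /\
  (forall u, (forall n, dotL2 u (e n) = 0) -> u = 0).

Definition is_absolute_value S P : Prop :=
  [/\ bounded_operator P, positive_operator P & P \o P = adjoint S \o S].

Definition trace_class S : Prop :=
  bounded_operator S /\ exists P e,
    [/\ is_absolute_value S P, orthonormal_basis e &
        (\sum_(0 <= n <oo) (Re (dotL2 (P (e n)) (e n)))%:E < +oo)%E].

Definition is_trace S (t : R[i]) : Prop := forall e, orthonormal_basis e ->
  (series (fun n => dotL2 (S (e n)) (e n)) : nat -> R[i]^o) @ \oo --> (t : R[i]^o).

(* For trace class S the sum does not depend on the basis. *)
Definition trace S : R[i] := xget 0 (is_trace S).

End operators.

Section phase_space.
Context (R : realType) (d : nat).

Local Notation L2Rd := (L2 (@lebesgue_rV R d)).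

(* z : phase stands for the point (x, omega) of R^(2d): x = z.1, omega = z.2. *)
Definition phase : Type := ('rV[R]_d * 'rV[R]_d)%type.
Definition phase_measure : {measure set phase -> \bar R} :=
  (lebesgue_rV d \x lebesgue_rV d)%E.

(* The argument of L2_class is square-integrable, so its default value is never
   used, and its class does not depend on the representative of psi. *)
Definition time_frequency_shift (z : phase) (psi : L2Rd) : L2Rd :=
  L2_class (lebesgue_rV d) (fun t : 'rV[R]_d =>
    let s := 2 * pi * \sum_i z.2 ord0 i * t ord0 i in
    (cos s +i* sin s) * L2_repr psi (t - z.1)).

Definition shift_operator (z : phase) (A : L2Rd -> L2Rd) : L2Rd -> L2Rd :=
  time_frequency_shift z \o A \o adjoint (time_frequency_shift z).

(* A is the operator f * S, weakly determined by its matrix elements. *)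
Definition is_convolution (f : phase -> R[i]) (S A : L2Rd -> L2Rd) : Prop :=
  bounded_operator A /\ forall psi phi : L2Rd,
    let h z := f z * dotL2 (shift_operator z S psi) phi in
    integrableC phase_measure h /\ dotL2 (A psi) phi = integralC phase_measure h.

Definition chi (M : set phase) (z : phase) : R[i] := (\1_M z)%:C.

Definition translate (M : set phase) (z : phase) : set phase :=
  [set m + z | m in M].

Definition is_povm (F : set phase -> L2Rd -> L2Rd) : Prop :=
  [/\ forall M, measurable M ->
        bounded_operator (F M) /\ positive_operator (F M),
      F setT = id &
      forall M : nat -> set phase, (forall i, measurable (M i)) ->
        trivIset setT M -> forall psi phi : L2Rd,
        (series (fun i => dotL2 (F (M i) psi) phi) : nat -> R[i]^o) @ \oo -->
        (dotL2 (F (\bigcup_i M i) psi) phi : R[i]^o)].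

Definition covariant (F : set phase -> L2Rd -> L2Rd) : Prop :=
  forall z M, measurable M -> shift_operator z (F M) = F (translate M z).

End phase_space.

(* Main.v *)
From HB Require Import structures.
Require Import Defs.
From mathcomp Require Import all_boot all_order all_algebra.
From mathcomp Require Import complex ring lra.
From mathcomp Require Import all_classical all_reals all_analysis.
From mathcomp Require Import measurable_realfun.
Import Order.TTheory GRing.Theory Num.Theory.
Import numFieldNormedType.Exports.
Local Open Scope classical_set_scope.
Local Open Scope ring_scope.

Set Implicit Arguments.
Unset Strict Implicit.
Unset Printing Implicit Defensive.

Local Notation Re := (@complex.Re _).
Local Notation Im := (@complex.Im _).
Local Notation normc := Normc.normc.
Local Open Scope complex_scope.

(* For a positive bounded S with trace one, everything follows from the formula
   [int <alpha_z(S) psi, psi> dz = tr(S) |psi|^2].  Expanding S along an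
   orthonormal basis (e_n), it reduces to the Moyal identity
   [int |<psi, pi(z) phi>|^2 dz = |psi|^2 |phi|^2], which is Plancherel's theorem
   in omega, for fixed x, applied to [t |-> psi(t) conj(phi(t - x))], followed by
   Tonelli.  For M measurable, the positive form
   [(psi, phi) |-> int_M <alpha_z(S) psi, phi> dz] is thus bounded by the inner
   product, with equality for M the whole phase space, and F(M) is the operator it
   represents.  Countable additivity is dominated convergence, and covariance is
   the translation invariance of dz: [pi(z)^* pi(w)] is [pi(w - z)] up to a phase. *)

(** * Complex-valued integrals *)

(** Plancherel's theorem is needed for functions that are merely integrable: for a given [x], the
    product [psi(t) conj(g(t - x))] of two L2 functions is in L1, and its L2 norm may be infinite.
    Density and inversion are avoided by comparing two kernels. Weighting frequencies by a Fejer
    kernel and summing over a window of radius [r] give the same quadratic form in [h], because both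
    kernels have the same Gram kernel, a triangle function. As [r] tends to 0, the normalised
    weights tend to 1 and the averages tend to [h]; each inequality in Plancherel is then one use of
    Fatou's lemma, valid in [[0, +oo]]. The basis is the one supplied by the trace class hypothesis
    and need not diagonalise [S]. The off-diagonal entries of [S] disappear because the Moyal
    identity, polarised, makes the functions [z |-> <psi, pi(z) e_n>] orthogonal. Only finite
    sections of the expansion are integrated term by term; the tail is controlled by Fatou and
    positivity, with an error proportional to the missing part of the trace. The operator that
    represents a bounded form is built from its coordinates in the same basis, whence the
    completeness of L2. *)

Section complex_numbers.
Context {R : realType}.
Implicit Types z w : R[i].

Lemma ReM z w : Re (z * w) = Re z * Re w - Im z * Im w.
Proof. by case: z w => [a b] [c d]. Qed.

Lemma ImM z w : Im (z * w) = Re z * Im w + Im z * Re w.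
Proof. by case: z w => [a b] [c d]. Qed.

Lemma ReD z w : Re (z + w) = Re z + Re w.
Proof. by case: z w => [a b] [c d]. Qed.

Lemma ImD z w : Im (z + w) = Im z + Im w.
Proof. by case: z w => [a b] [c d]. Qed.

Lemma ReN z : Re (- z) = - Re z. Proof. by case: z. Qed.
Lemma ImN z : Im (- z) = - Im z. Proof. by case: z. Qed.
Lemma Re_conjc z : Re (conjc z) = Re z. Proof. by case: z. Qed.
Lemma Im_conjc z : Im (conjc z) = - Im z. Proof. by case: z. Qed.
Definition RIE := (ReM, ImM, ReD, ImD, ReN, ImN, Re_conjc, Im_conjc).

Lemma complex_eq z w : Re z = Re w -> Im z = Im w -> z = w.
Proof. by case: z w => [a b] [c d] /= -> ->. Qed.

Lemma mulr_conjc z : z * conjc z = (normc z ^+ 2)%:C.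
Proof. by apply: complex_eq; rewrite sqr_normcE !RIE/=; ring. Qed.

Lemma normc_ge0 z : 0 <= normc z. Proof. by case: z => a b; exact: sqrtr_ge0. Qed.

Lemma normr_Re_le z : `|Re z| <= normc z.
Proof.
rewrite -(@ler_pXn2r _ 2) ?nnegrE ?normc_ge0// sqr_normcE real_normK ?num_real//.
by rewrite lerDl sqr_ge0.
Qed.

Lemma normr_Im_le z : `|Im z| <= normc z.
Proof.
rewrite -(@ler_pXn2r _ 2) ?nnegrE ?normc_ge0// sqr_normcE real_normK ?num_real//.
by rewrite lerDr sqr_ge0.
Qed.

Lemma normc_le_ReIm z : normc z <= `|Re z| + `|Im z|.
Proof.
rewrite -(@ler_pXn2r _ 2) ?nnegrE ?normc_ge0 ?addr_ge0// sqr_normcE.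
rewrite sqrrD !real_normK ?num_real// addrAC lerDl.
by rewrite mulrn_wge0 ?mulr_ge0.
Qed.

Lemma normc_conj z : normc (conjc z) = normc z.
Proof. by case: z => a b /=; rewrite sqrrN. Qed.

Lemma normc_eq0 z : normc z = 0 -> z = 0.
Proof. exact: Normc.eq0_normc. Qed.

Lemma normcR (a : R) : normc a%:C = `|a|.
Proof. by rewrite /= expr0n addr0 sqrtr_sqr. Qed.

Lemma ge0C z : (0 <= z) = (0 <= Re z) && (Im z == 0).
Proof. by rewrite lecE /= andbC. Qed.

(* Twisting by the phase of [z] turns a bound on [Re] into a bound on [normc]. *)
Lemma phaseP z : exists2 c : R[i], normc c = 1 & c * z = (normc z)%:C.
Proof.
have [->|z0] := eqVneq z 0.
  by exists 1; rewrite ?Normc.normc1// mulr0 Normc.normc0.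
have n0 : normc z != 0 by apply: contra z0 => /eqP/normc_eq0->.
exists (conjc z * ((normc z)^-1)%:C).
  by rewrite Normc.normcM normc_conj normcR ger0_norm ?invr_ge0 ?normc_ge0// divff.
rewrite mulrAC [conjc z * z]mulrC mulr_conjc -rmorphM expr2 -mulrA divff// mulr1//.
Qed.

End complex_numbers.

Section real_integral.
Context d (T : measurableType d) (R : realType).
Variable mu : {measure set T -> \bar R}.
Implicit Types f g : T -> R.

Lemma ae_eq_Rintegral f g : measurable_fun setT f -> measurable_fun setT g ->
  {ae mu, forall x, f x = g x} -> \int[mu]_x f x = \int[mu]_x g x.
Proof.
move=> mf mg fg; rewrite /Rintegral; congr fine; apply: ae_eq_integral => //.
- exact/measurable_EFinP.
- exact/measurable_EFinP.
- by apply: filterS fg => x fgx _ /=; rewrite fgx.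
Qed.

End real_integral.

Section real_fubini.
Context d1 d2 (T1 : measurableType d1) (T2 : measurableType d2) (R : realType).
Variable m1 : {sigma_finite_measure set T1 -> \bar R}.
Variable m2 : {sigma_finite_measure set T2 -> \bar R}.
Variable g : T1 * T2 -> R.

(** Tonelli applies to the positive and negative parts separately and [fine] is measurable, so the
    slices whose integral diverges, where [fine] returns a default value, are harmless. *)
Lemma measurable_Rintegral_param : measurable_fun setT g ->
  measurable_fun setT (fun x => \int[m2]_y g (x, y)).
Proof.
move=> /measurable_EFinP mg.
apply: (measurableT_comp (fine_measurable measurableT)).
under eq_fun do rewrite integralE.
apply: emeasurable_funB.
  have := measurable_fun_fubini_tonelli_F (m2 := m2) _
    (measurable_funepos mg) (fun z => funepos_ge0 _ z).
  congr (measurable_fun _ _); apply/funext => x; apply: eq_integral => y _.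
  by rewrite !funeposE.
have := measurable_fun_fubini_tonelli_F (m2 := m2) _
  (measurable_funeneg mg) (fun z => funeneg_ge0 _ z).
congr (measurable_fun _ _); apply/funext => x; apply: eq_integral => y _.
by rewrite !funenegE.
Qed.

Hypothesis ig : (m1 \x m2)%E.-integrable setT (EFin \o g).

(** Fubini makes the slices integrable only almost everywhere; where they are not, [fine] may change
    the value, but only on a null set. *)
Let fin_F : {ae m1, forall x, (\int[m2]_y (g (x, y))%:E)%E =
  (\int[m2]_y g (x, y))%:E}.
Proof.
have /(integrable_ae measurableT) := integrable_fubini_F ig.
by apply: filterS => x /= /(_ I) fx; rewrite /Rintegral fineK.
Qed.

Lemma integrable_Rintegral1 :
  m1.-integrable setT (EFin \o (fun x => \int[m2]_y g (x, y))).
Proof.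
have mg : measurable_fun setT g by apply/measurable_EFinP; exact: measurable_int ig.
have := integrable_fubini_F ig => /integrableP[mF iF]; apply/integrableP; split.
  apply/measurable_EFinP; exact: measurable_Rintegral_param.
move: iF; congr (_ < _)%E; apply: ae_eq_integral => //.
- exact: measurableT_comp.
- apply: measurableT_comp => //; apply/measurable_EFinP.
  exact: measurable_Rintegral_param.
- by apply: filterS fin_F => x fx _; congr (`|_|)%E; exact: fx.
Qed.

Lemma Rintegral_prod1 :
  \int[m1]_x (\int[m2]_y g (x, y)) = \int[(m1 \x m2)%E]_z g z.
Proof.
have mg : measurable_fun setT g by apply/measurable_EFinP; exact: measurable_int ig.
rewrite /Rintegral -(integral12_prod_meas1 ig); congr fine.
apply: ae_eq_integral => //.
- apply/measurable_EFinP; exact: measurable_Rintegral_param.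
- exact: (measurable_fubini_F ig).
- by apply: filterS fin_F => x fx _; exact: (esym fx).
Qed.

Lemma Rintegral_prod2 :
  \int[m2]_y (\int[m1]_x g (x, y)) = \int[(m1 \x m2)%E]_z g z.
Proof.
have mg : measurable_fun setT g by apply/measurable_EFinP; exact: measurable_int ig.
rewrite /Rintegral -(integral21_prod_meas1 ig); congr fine.
have fG : {ae m2, forall y, (\int[m1]_x (g (x, y))%:E)%E =
  (\int[m1]_x g (x, y))%:E}.
  apply: filterS (ae_integrable2 ig) => y iy.
  by rewrite /Rintegral fineK//; exact: integrable_fin_num iy.
apply: ae_eq_integral => //.
- apply/measurable_EFinP; apply: (measurableT_comp (fine_measurable measurableT)).
  exact: (measurable_fubini_G ig).
- exact: (measurable_fubini_G ig).
- by apply: filterS fG => y fy _; exact: (esym fy).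
Qed.

End real_fubini.

Section measurable_complex.
Context d (T : measurableType d) (R : realType).
Implicit Types f g : T -> R[i].

Lemma mfunCP f : measurable_fun setT (fun x => Re (f x)) ->
  measurable_fun setT (fun x => Im (f x)) -> measurable_funC f.
Proof. by []. Qed.

Lemma mfunC_cst (c : R[i]) : measurable_funC (fun _ : T => c).
Proof. by split; exact: measurable_cst. Qed.

Lemma mfunC_real (r : T -> R) : measurable_fun setT r ->
  measurable_funC (fun x => (r x)%:C).
Proof. by split => //; exact: measurable_cst. Qed.

Lemma mfunCD f g : measurable_funC f -> measurable_funC g ->
  measurable_funC (fun x => f x + g x).
Proof.
move=> [mf1 mf2] [mg1 mg2]; apply: mfunCP.
  by under eq_fun do rewrite ReD; exact: measurable_funD.
by under eq_fun do rewrite ImD; exact: measurable_funD.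
Qed.

Lemma mfunCM f g : measurable_funC f -> measurable_funC g ->
  measurable_funC (fun x => f x * g x).
Proof.
move=> [mf1 mf2] [mg1 mg2]; apply: mfunCP.
  under eq_fun do rewrite ReM.
  by apply: measurable_funB; exact: measurable_funM.
under eq_fun do rewrite ImM.
by apply: measurable_funD; exact: measurable_funM.
Qed.

Lemma mfunCZ (c : R[i]) f : measurable_funC f -> measurable_funC (fun x => c * f x).
Proof. by move=> mf; exact: mfunCM (mfunC_cst c) mf. Qed.

Lemma mfunC_conj f : measurable_funC f -> measurable_funC (fun x => conjc (f x)).
Proof.
move=> [mf1 mf2]; apply: mfunCP; first by under eq_fun do rewrite Re_conjc.
by under eq_fun do rewrite Im_conjc; exact: measurable_funN.
Qed.

Lemma mfunC_normc f : measurable_funC f -> measurable_fun setT (fun x => normc (f x)).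
Proof.
move=> mf; rewrite (_ : (fun _ => _) = (fun x => Num.sqrt (normc (f x) ^+ 2))).
  apply: (@measurableT_comp _ _ _ _ _ _ (@Num.sqrt R)).
    by apply: continuous_measurable_fun; exact: sqrt_continuous.
  exact: measurable_sqr_normc.
by apply/funext => x; rewrite sqrtr_sqr ger0_norm// normc_ge0.
Qed.

Lemma mfunC_comp d' (T' : measurableType d') (phi : T' -> T) f :
  measurable_fun setT phi -> measurable_funC f -> measurable_funC (f \o phi).
Proof. by move=> mphi [mf1 mf2]; split; [exact: (measurableT_comp mf1 mphi)|exact: (measurableT_comp mf2 mphi)]. Qed.

End measurable_complex.

Section complex_integral.
Context d (T : measurableType d) (R : realType).
Variable mu : {measure set T -> \bar R}.
Implicit Types f g : T -> R[i].

Lemma integrableC_mfunC f : integrableC mu f -> measurable_funC f.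
Proof. by move=> [f1 f2]; split; apply/measurable_EFinP; [exact: measurable_int f1|exact: measurable_int f2]. Qed.

Lemma integrableC_le f (g : T -> R) : measurable_funC f ->
  mu.-integrable setT (EFin \o g) -> (forall x, normc (f x) <= g x) ->
  integrableC mu f.
Proof.
move=> [mf1 mf2] ig fg; split; apply: (le_integrable _ _ _ ig) => //.
- exact/measurable_EFinP.
- move=> x _ /=; rewrite lee_fin (le_trans (normr_Re_le _))//.
  by rewrite (le_trans (fg x))// ler_norm.
- exact/measurable_EFinP.
- move=> x _ /=; rewrite lee_fin (le_trans (normr_Im_le _))//.
  by rewrite (le_trans (fg x))// ler_norm.
Qed.

Lemma integrableC_normc f : integrableC mu f ->
  mu.-integrable setT (EFin \o (fun x => normc (f x))).
Proof.
move=> cf; have [f1 f2] := cf.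
have i12 := integrableD measurableT (integrable_norm f1) (integrable_norm f2).
apply: (le_integrable _ _ _ i12) => //.
  by apply/measurable_EFinP/mfunC_normc/integrableC_mfunC.
move=> x _ /=; rewrite lee_fin ger0_norm ?normc_ge0// ger0_norm ?addr_ge0//.
exact: normc_le_ReIm.
Qed.

Lemma integrableCP f : measurable_funC f ->
  (\int[mu]_x (normc (f x))%:E < +oo)%E -> integrableC mu f.
Proof.
move=> mf fy; apply: (@integrableC_le _ (fun x => normc (f x))) => //.
apply/integrableP; split; first by apply/measurable_EFinP; exact: mfunC_normc.
by move: fy; under eq_integral do rewrite -[normc _]ger0_norm ?normc_ge0//.
Qed.

Lemma integrableC_lty f : integrableC mu f -> (\int[mu]_x (normc (f x))%:E < +oo)%E.
Proof.
move=> /integrableC_normc/integrableP[_].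
by under eq_integral do rewrite /= ger0_norm ?normc_ge0//.
Qed.

Lemma integrableCD f g : integrableC mu f -> integrableC mu g ->
  integrableC mu (fun x => f x + g x).
Proof.
move=> [f1 f2] [g1 g2]; split.
  have := integrableD measurableT f1 g1.
  by apply: eq_integrable => // x _ /=; rewrite ReD.
have := integrableD measurableT f2 g2.
by apply: eq_integrable => // x _ /=; rewrite ImD.
Qed.

Lemma integrableCZ (c : R[i]) f : integrableC mu f -> integrableC mu (fun x => c * f x).
Proof.
move=> cf; apply: (@integrableC_le _ (fun x => normc c * normc (f x))).
- by apply: mfunCZ; exact: integrableC_mfunC.
- have := integrableZl measurableT (normc c) (integrableC_normc cf).
  by apply: eq_integrable => // x _.
- by move=> x; rewrite Normc.normcM.
Qed.

Lemma integrableC_conj f : integrableC mu f -> integrableC mu (fun x => conjc (f x)).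
Proof.
move=> cf; apply: (@integrableC_le _ (fun x => normc (f x))).
- by apply: mfunC_conj; exact: integrableC_mfunC.
- exact: integrableC_normc.
- by move=> x; rewrite normc_conj.
Qed.

Lemma integrableC_real (r : T -> R) : mu.-integrable setT (EFin \o r) ->
  integrableC mu (fun x => (r x)%:C).
Proof. by split => //; exact: integrable0. Qed.

Lemma integralC_real (r : T -> R) : integralC mu (fun x => (r x)%:C) = (\int[mu]_x r x)%:C.
Proof. by apply: complex_eq => //=; rewrite /Rintegral integral0. Qed.

Lemma eq_integralC f g : f =1 g -> integralC mu f = integralC mu g.
Proof. by move=> /funext->. Qed.

Lemma integralCD f g : integrableC mu f -> integrableC mu g ->
  integralC mu (fun x => f x + g x) = integralC mu f + integralC mu g.
Proof.
move=> [f1 f2] [g1 g2]; apply: complex_eq; rewrite !RIE /=.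
  by rewrite -RintegralD//; apply: eq_Rintegral => x _; rewrite ReD.
by rewrite -RintegralD//; apply: eq_Rintegral => x _; rewrite ImD.
Qed.

Lemma integralCZ (c : R[i]) f : integrableC mu f ->
  integralC mu (fun x => c * f x) = c * integralC mu f.
Proof.
move=> [f1 f2]; have iZ (r : R) (h : T -> R) : mu.-integrable setT (EFin \o h) ->
    mu.-integrable setT (EFin \o (fun x => r * h x)).
  by move=> /(integrableZl measurableT r); apply: eq_integrable.
apply: complex_eq; rewrite !RIE /=.
  rewrite -!RintegralZl// -RintegralB//; try exact: iZ.
  by apply: eq_Rintegral => x _; rewrite ReM.
rewrite -!RintegralZl// -RintegralD//; try exact: iZ.
by apply: eq_Rintegral => x _; rewrite ImM.
Qed.

Lemma integralC_sum I (s : seq I) (F : I -> T -> R[i]) :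
  (forall i, integrableC mu (F i)) ->
  integrableC mu (fun x => \sum_(i <- s) F i x) /\
  integralC mu (fun x => \sum_(i <- s) F i x) = \sum_(i <- s) integralC mu (F i).
Proof.
move=> iF; elim: s => [|i s [ih1 ih2]].
  under eq_fun do rewrite big_nil.
  rewrite big_nil; split; first by split; exact: integrable0.
  by apply: complex_eq; rewrite /= /Rintegral integral0.
under eq_fun do rewrite big_cons; rewrite big_cons; split.
  exact: integrableCD.
by rewrite integralCD// ih2.
Qed.

Lemma integralC_conj f : integrableC mu f ->
  integralC mu (fun x => conjc (f x)) = conjc (integralC mu f).
Proof.
move=> [f1 f2]; apply: complex_eq; rewrite !RIE /=.
  by apply: eq_Rintegral => x _; rewrite Re_conjc.
rewrite -mulN1r -RintegralZl//; apply: eq_Rintegral => x _.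
by rewrite Im_conjc mulN1r.
Qed.

Lemma normc_integralC f : integrableC mu f ->
  normc (integralC mu f) <= \int[mu]_x normc (f x).
Proof.
move=> cf; have [c c1 cE] := phaseP (integralC mu f).
rewrite -[leLHS]/(Re ((normc (integralC mu f))%:C)) -cE -integralCZ//=.
have [icf _] := integrableCZ c cf.
apply: le_Rintegral => //; first exact: integrableC_normc.
move=> x _; rewrite (le_trans (ler_norm _))// (le_trans (normr_Re_le _))//.
by rewrite Normc.normcM c1 mul1r.
Qed.

Lemma ae_eq_integralC f g : measurable_funC f -> measurable_funC g ->
  {ae mu, forall x, f x = g x} -> integralC mu f = integralC mu g.
Proof.
move=> [f1 f2] [g1 g2] fg.
by apply: complex_eq => /=; apply: ae_eq_Rintegral => //; apply: filterS fg => x /= ->.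
Qed.

Lemma ge0_integralC f : (forall x, 0 <= f x) -> 0 <= integralC mu f.
Proof.
move=> f0; rewrite ge0C /=; apply/andP; split.
  by apply: Rintegral_ge0 => x _; have := f0 x; rewrite ge0C => /andP[].
rewrite (_ : (fun x => Im (f x)) = cst 0); first by rewrite /Rintegral integral0.
by apply/funext => x; have := f0 x; rewrite ge0C => /andP[_ /eqP].
Qed.

End complex_integral.

Section complex_fubini.
Context d1 d2 (T1 : measurableType d1) (T2 : measurableType d2) (R : realType).
Variable m1 : {sigma_finite_measure set T1 -> \bar R}.
Variable m2 : {sigma_finite_measure set T2 -> \bar R}.
Variable f : T1 * T2 -> R[i].

Lemma mfunC_integralC_param : measurable_funC f ->
  measurable_funC (fun x => integralC m2 (fun y => f (x, y))).
Proof.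
by move=> [f1 f2]; split; [exact: (measurable_Rintegral_param m2 f1)|exact: (measurable_Rintegral_param m2 f2)].
Qed.

Hypothesis cf : integrableC (m1 \x m2)%E f.

Lemma integrableC_prod1 : integrableC m1 (fun x => integralC m2 (fun y => f (x, y))).
Proof.
by case: cf => f1 f2; split; [exact: (integrable_Rintegral1 f1)|exact: (integrable_Rintegral1 f2)].
Qed.

Lemma integralC_prod1 :
  integralC m1 (fun x => integralC m2 (fun y => f (x, y))) = integralC (m1 \x m2)%E f.
Proof.
by case: cf => f1 f2; apply: complex_eq; [exact: (Rintegral_prod1 f1)|exact: (Rintegral_prod1 f2)].
Qed.

Lemma integralC_prod2 :
  integralC m2 (fun y => integralC m1 (fun x => f (x, y))) = integralC (m1 \x m2)%E f.
Proof.
by case: cf => f1 f2; apply: complex_eq; [exact: (Rintegral_prod2 f1)|exact: (Rintegral_prod2 f2)].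
Qed.

Lemma ae_integrableC_prod1 : {ae m1, forall x, integrableC m2 (fun y => f (x, y))}.
Proof.
case: cf => f1 f2; apply: filterS2 (ae_integrable1 f1) (ae_integrable1 f2).
by move=> x i1 i2; split.
Qed.

End complex_fubini.

(** * Positive forms and the Hilbert space L2 *)

Section positive_forms.
Context (R : realType) (V : lmodType R[i]).
Local Notation j := (0 +i* 1 : R[i]).
Implicit Types (B : V -> V -> R[i]) (u v w : V).

Definition sesquilinear B : Prop :=
  (forall a u v w, B (a *: u + v) w = a * B u w + B v w) /\
  (forall a u v w, B u (a *: v + w) = conjc a * B u v + B u w).

Definition positive_form B : Prop := sesquilinear B /\ forall u, 0 <= B u u.

Section sesquilinear.
Variable B : V -> V -> R[i].
Hypothesis sB : sesquilinear B.

Lemma sesqDl u v w : B (u + v) w = B u w + B v w.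
Proof. by have := sB.1 1 u v w; rewrite scale1r mul1r. Qed.

Lemma sesqDr u v w : B u (v + w) = B u v + B u w.
Proof. by have := sB.2 1 u v w; rewrite scale1r rmorph1 mul1r. Qed.

Lemma sesq0l w : B 0 w = 0.
Proof. by have := sesqDl 0 0 w; rewrite addr0 => /eqP; rewrite -subr_eq0 opprD addrA subrr sub0r oppr_eq0 => /eqP. Qed.

Lemma sesq0r w : B w 0 = 0.
Proof. by have := sesqDr w 0 0; rewrite addr0 => /eqP; rewrite -subr_eq0 opprD addrA subrr sub0r oppr_eq0 => /eqP. Qed.

Lemma sesqZl a u w : B (a *: u) w = a * B u w.
Proof. by have := sB.1 a u 0 w; rewrite addr0 sesq0l addr0. Qed.

Lemma sesqZr a u w : B u (a *: w) = conjc a * B u w.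
Proof. by have := sB.2 a u w 0; rewrite addr0 sesq0r addr0. Qed.

Lemma sesqNl u w : B (- u) w = - B u w.
Proof. by rewrite -scaleN1r sesqZl mulN1r. Qed.

Lemma sesqNr u w : B u (- w) = - B u w.
Proof. by rewrite -scaleN1r sesqZr rmorphN rmorph1 mulN1r. Qed.

Lemma sesqBl u v w : B (u - v) w = B u w - B v w.
Proof. by rewrite sesqDl sesqNl. Qed.

Lemma sesqBr u v w : B u (v - w) = B u v - B u w.
Proof. by rewrite sesqDr sesqNr. Qed.

Lemma sesq_suml I (s : seq I) (F : I -> V) w :
  B (\sum_(i <- s) F i) w = \sum_(i <- s) B (F i) w.
Proof.
by elim: s => [|i s ih]; rewrite ?big_nil ?sesq0l// !big_cons sesqDl ih.
Qed.

Lemma sesq_sumr I (s : seq I) (F : I -> V) w :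
  B w (\sum_(i <- s) F i) = \sum_(i <- s) B w (F i).
Proof.
by elim: s => [|i s ih]; rewrite ?big_nil ?sesq0r// !big_cons sesqDr ih.
Qed.

(** With [j] the imaginary unit, a sesquilinear form is determined by its diagonal. Identities such
    as [moyal_cross] and [chi_formT] are proved for equal arguments and transferred by this
    formula. *)
Lemma polarization u v : B u v = (4%:R)^-1 *
  (B (u + v) (u + v) - B (u - v) (u - v) +
   j * (B (u + j *: v) (u + j *: v) - B (u - j *: v) (u - j *: v))).
Proof.
rewrite !(sesqDl, sesqDr, sesqNl, sesqNr, sesqZl, sesqZr).
have -> : conjc j = - j by apply: complex_eq; rewrite /= ?oppr0.
have i2 : j * j = -1 :> R[i] by apply: (@complex_eq R (j * j)); rewrite !RIE /=; ring.
have n4 : (4%:R : R[i]) != 0 by rewrite pnatr_eq0.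
apply: (mulfI n4); rewrite mulrA divff// mul1r.
move: j i2 => i i2; ring: i2.
Qed.

End sesquilinear.

Section positive.
Variable B : V -> V -> R[i].
Hypothesis pB : positive_form B.
Let sB : sesquilinear B := pB.1.

Definition qf u : R := Re (B u u).

Lemma qf_ge0 u : 0 <= qf u.
Proof. by have := pB.2 u; rewrite ge0C => /andP[]. Qed.

Lemma qfE u : B u u = (qf u)%:C.
Proof. by have := pB.2 u; rewrite ge0C => /andP[_ /eqP h]; apply: complex_eq. Qed.

(** Symmetry comes from the reality of the diagonal: the imaginary parts of [B] at [u + v] and at
    [u + j *: v] vanish, which gives the two real equations. *)
Lemma herm u v : B v u = conjc (B u v).
Proof.
have h1 : Im (B (u + v) (u + v)) = 0 by rewrite qfE.
have h2 : Im (B (u + j *: v) (u + j *: v)) = 0 by rewrite qfE.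
have hu : Im (B u u) = 0 by rewrite qfE.
have hv : Im (B v v) = 0 by rewrite qfE.
move: h1 h2; rewrite !(sesqDl, sesqDr, sesqZl, sesqZr)// !RIE /= hu hv => h1 h2.
by apply: complex_eq; rewrite !RIE; lra.
Qed.

Lemma qfD u v : qf (u + v) = qf u + 2 * Re (B u v) + qf v.
Proof. by rewrite /qf !(sesqDl sB, sesqDr sB) (herm u v) !RIE; ring. Qed.

Lemma qfB u v : qf (u - v) = qf u - 2 * Re (B u v) + qf v.
Proof. by rewrite qfD /qf (sesqNl sB) !(sesqNr sB) opprK !RIE; ring. Qed.

Lemma qfZ a u : qf (a *: u) = normc a ^+ 2 * qf u.
Proof. by rewrite /qf (sesqZl sB) (sesqZr sB) mulrA mulr_conjc !RIE /= mul0r subr0. Qed.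

Lemma qfN u : qf (- u) = qf u.
Proof. by rewrite /qf (sesqNl sB) (sesqNr sB) opprK. Qed.

Lemma qf_sym u v : qf (u - v) = qf (v - u).
Proof. by rewrite -qfN opprB. Qed.

(** The quadratic polynomial [t |-> qf (u - t v)] is nonnegative on the real line. *)
Let csRe u v : Re (B u v) ^+ 2 <= qf u * qf v.
Proof.
have h (t : R) : 0 <= qf u - 2 * t * Re (B u v) + t ^+ 2 * qf v.
  have := qf_ge0 (u - t%:C *: v); rewrite qfB qfZ normcR real_normK ?num_real//.
  by rewrite (sesqZr sB) !RIE /= oppr0 mul0r subr0 mulrA.
have v0 := qf_ge0 v; have [qv|qv] := eqVneq (qf v) 0.
  have [->|r0] := eqVneq (Re (B u v)) 0; first by rewrite expr0n mulr_ge0 ?qf_ge0.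
  (* When [qf v = 0] the polynomial is affine with nonzero slope, and at this [t] it would equal
     -1. *)
  have := h ((qf u + 1) / (2 * Re (B u v))); rewrite qv.
  rewrite mulr0 addr0.
  have -> : 2 * ((qf u + 1) / (2 * Re (B u v))) * Re (B u v) = qf u + 1 by field.
  lra.
have qv0 : 0 < qf v by rewrite lt_def qv.
(* The minimiser of the polynomial. *)
have := h (Re (B u v) / qf v).
have -> : qf u - 2 * (Re (B u v) / qf v) * Re (B u v) +
   (Re (B u v) / qf v) ^+ 2 * qf v = qf u - Re (B u v) ^+ 2 / qf v by field.
by rewrite subr_ge0 ler_pdivrMr.
Qed.

Lemma cauchy_schwarz u v : normc (B u v) ^+ 2 <= qf u * qf v.
Proof.
have [c c1 cE] := phaseP (B u v).
have := csRe (c *: u) v; rewrite (sesqZl sB) cE /= => /le_trans; apply.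
by rewrite qfZ c1 expr1n mul1r.
Qed.

(** Expansion of [qf (e u - v) >= 0], divided by [e]. A small [e] leaves [u] with a weight close to
    1 at the price of a large factor on [v]; the trace formula uses it with a tail in place of
    [v]. *)
Lemma qfD_le (e : R) u v : 0 < e ->
  qf (u + v) <= (1 + e) * qf u + (1 + e^-1) * qf v.
Proof.
move=> e0; have := qf_ge0 (e%:C *: u - v).
rewrite qfB qfZ normcR real_normK ?num_real// (sesqZl sB) !RIE /= mul0r subr0.
rewrite qfD => h.
suff : 0 <= e^-1 * (e ^+ 2 * qf u - 2 * (e * Re (B u v)) + qf v).
  have -> : e^-1 * (e ^+ 2 * qf u - 2 * (e * Re (B u v)) + qf v) =
    e * qf u - 2 * Re (B u v) + e^-1 * qf v by field; rewrite gt_eqF.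
  lra.
by rewrite mulr_ge0// invr_ge0 ltW.
Qed.

End positive.

End positive_forms.

Section fatou.
Context d (T : measurableType d) (R : realType).
Variable mu : {measure set T -> \bar R}.

(** Fatou's lemma for a limit that exists almost everywhere, under one bound [c], possibly infinite,
    common to all the integrals. The lower limit equals [g] off a null set. *)
Lemma fatou_cst (f : nat -> T -> R) (g : T -> R) (c : \bar R) :
  (forall n, measurable_fun setT (f n)) -> measurable_fun setT g ->
  (forall n x, 0 <= f n x) -> {ae mu, forall x, f^~ x @ \oo --> g x} ->
  (forall n, (\int[mu]_x (f n x)%:E <= c)%E) -> (\int[mu]_x (g x)%:E <= c)%E.
Proof.
move=> mf mg f0 fg fc.
have mf' n : measurable_fun setT (EFin \o f n) by exact/measurable_EFinP.
have f0' n x : setT x -> (0 <= (EFin \o f n) x)%E by rewrite /= lee_fin.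
have lim x : f^~ x @ \oo --> g x -> limn_einf (fun n => (f n x)%:E) = (g x)%:E.
  move=> fgx; have h : (fun n => (f n x)%:E) @ \oo --> (g x)%:E.
    by apply: cvg_EFin; [exact: nearW|exact: fgx].
  exact: (cvg_limn_einf_sup h).1.
have mlim : measurable_fun setT (fun x => limn_einf (fun n => (f n x)%:E)).
  under eq_fun do rewrite /limn_einf.
  apply: (@measurableT_comp _ _ _ _ _ _ (-%E : \bar R -> \bar R)) => //.
  apply: (measurable_fun_limn_esup (f := fun n x => - (f n x)%:E)%E) => n.
  exact: (measurableT_comp (@oppe_measurable _ setT) (mf' n)).
apply: (@le_trans _ _ (\int[mu]_x limn_einf (fun n => (f n x)%:E))%E).
  rewrite le_eqVlt; apply/orP; left; apply/eqP; apply: ae_eq_integral => //.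
  - exact/measurable_EFinP.
  - by apply: filterS fg => x /lim fgx _; exact: (esym fgx).
apply: (le_trans (fatou mu measurableT mf' f0')).
rewrite limn_einf_lim; apply: lime_le; first exact: is_cvg_einfs.
apply: nearW => n; apply: le_trans (fc n); rewrite /einfs /=.
by apply: ereal_inf_lbound; exists n => /=.
Qed.


End fatou.


Section L2_hilbert.
Context d (T : measurableType d) (R : realType).
Variable mu : {measure set T -> \bar R}.
Local Notation H := (L2 mu).
Implicit Types (u v w : H) (f g : T -> R[i]).
Local Open Scope quotient_scope.

Lemma sqintP f : reflect (measurable_funC f /\
  (\int[mu]_x (normc (f x) ^+ 2)%:E < +oo)%E) (f \in sqint mu).
Proof. by apply: (iffP idP); rewrite inE. Qed.

Lemma L2_repr_sqint u : L2_repr u \in sqint mu.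
Proof. exact: valP. Qed.

Lemma L2_repr_mfun u : measurable_funC (L2_repr u).
Proof. by have /sqintP[] := L2_repr_sqint u. Qed.
Hint Resolve L2_repr_mfun : core.

Lemma sqint_val_lin a (f g : sqint_fun mu) x :
  sqint_val (a *: f + g) x = a * sqint_val f x + sqint_val g x.
Proof. by []. Qed.

Lemma L2_class_val (f : sqint_fun mu) : L2_class mu (sqint_val f) = \pi_H f.
Proof. by rewrite /L2_class valKd. Qed.

Lemma L2_linE a u v : a *: u + v = L2_class mu (sqint_val (a *: repr u + repr v)).
Proof. by rewrite L2_class_val pi_L2D pi_L2_scale !reprK. Qed.

Lemma L2_repr_class (f : sqint_fun mu) :
  {ae mu, forall x, L2_repr (L2_class mu (sqint_val f)) x = sqint_val f x}.
Proof. by have := L2_classK (valP f); apply: filterS => x /(_ I). Qed.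

Lemma L2_repr_lin a u v :
  {ae mu, forall x, L2_repr (a *: u + v) x = a * L2_repr u x + L2_repr v x}.
Proof.
rewrite L2_linE; have := L2_repr_class (a *: repr u + repr v).
apply: filterS => x e; apply: (etrans e); exact: sqint_val_lin.
Qed.

Lemma L2_reprD u v :
  {ae mu, forall x, L2_repr (u + v) x = L2_repr u x + L2_repr v x}.
Proof.
have := L2_repr_lin 1 u v; rewrite scale1r.
by apply: filterS => x; rewrite mul1r.
Qed.

Lemma L2_repr0 : {ae mu, forall x, L2_repr (0 : H) x = 0}.
Proof.
have := L2_reprD 0 0; rewrite addr0.
by apply: filterS => x /eqP; rewrite -subr_eq0 opprD addrA subrr sub0r oppr_eq0 => /eqP.
Qed.

Lemma L2_reprN u : {ae mu, forall x, L2_repr (- u) x = - L2_repr u x}.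
Proof.
have := L2_repr_lin (-1) u 0; rewrite scaleN1r addr0.
by apply: filterS2 L2_repr0 => x -> ->; rewrite mulN1r addr0.
Qed.

Lemma L2_reprB u v :
  {ae mu, forall x, L2_repr (u - v) x = L2_repr u x - L2_repr v x}.
Proof. by apply: filterS2 (L2_reprD u (- v)) (L2_reprN v) => x -> ->. Qed.

Lemma L2_repr_inj u v : {ae mu, forall x, L2_repr u x = L2_repr v x} -> u = v.
Proof.
move=> uv; rewrite -(reprK u) -(reprK v); apply/eqmodP => /=.
rewrite /Quotient.equiv; apply/null_funP.
by apply: filterS uv => x uv _; apply/eqP; rewrite subr_eq0; apply/eqP.
Qed.

Lemma normcM_le (z w : R[i]) : normc z * normc w <= normc z ^+ 2 + normc w ^+ 2.
Proof.
have := sqr_ge0 (normc z - normc w); have := sqr_ge0 (normc z); have := sqr_ge0 (normc w).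
by rewrite sqrrB; lra.
Qed.

Lemma sqint_integrable f : f \in sqint mu ->
  mu.-integrable setT (EFin \o (fun x => normc (f x) ^+ 2)).
Proof.
move=> /sqintP[mf fy]; apply/integrableP; split.
  by apply/measurable_EFinP; exact: measurable_sqr_normc.
by under eq_integral do rewrite /= ger0_norm ?sqr_ge0//.
Qed.

Lemma sqint_mulr_conj f g : f \in sqint mu -> g \in sqint mu ->
  integrableC mu (fun x => f x * conjc (g x)).
Proof.
move=> f2 g2; have /sqintP[mf _] := f2; have /sqintP[mg _] := g2.
apply: (@integrableC_le _ _ _ _ _ (fun x => normc (f x) ^+ 2 + normc (g x) ^+ 2)).
- by apply: mfunCM => //; exact: mfunC_conj.
- by have := integrableD measurableT (sqint_integrable f2) (sqint_integrable g2).
- by move=> x; rewrite Normc.normcM normc_conj normcM_le.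
Qed.

Lemma dotL2_integrable u v : integrableC mu (fun x => L2_repr u x * conjc (L2_repr v x)).
Proof. by apply: sqint_mulr_conj; exact: L2_repr_sqint. Qed.
Hint Resolve dotL2_integrable : core.

Lemma dotL2_ae f g u v : measurable_funC f -> measurable_funC g ->
  {ae mu, forall x, L2_repr u x = f x} -> {ae mu, forall x, L2_repr v x = g x} ->
  dotL2 u v = integralC mu (fun x => f x * conjc (g x)).
Proof.
move=> mf mg uf vg; apply: ae_eq_integralC.
- by apply: mfunCM => //; exact: mfunC_conj.
- by apply: mfunCM => //; exact: mfunC_conj.
- by apply: filterS2 uf vg => x -> ->.
Qed.

Lemma L2_classE f : f \in sqint mu -> {ae mu, forall x, L2_repr (L2_class mu f) x = f x}.
Proof. by move=> /L2_classK; apply: filterS => x /(_ I). Qed.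

Lemma dotL2_linl a u v w : dotL2 (a *: u + v) w = a * dotL2 u w + dotL2 v w.
Proof.
rewrite /dotL2 -integralCZ// -integralCD//; last exact: integrableCZ.
apply: ae_eq_integralC.
- by apply: mfunCM => //; exact: mfunC_conj.
- by apply: mfunCD; [apply: mfunCZ|]; apply: mfunCM => //; exact: mfunC_conj.
- by apply: filterS (L2_repr_lin a u v) => x ->; rewrite mulrDl mulrA.
Qed.

Lemma dotL2_conj u v : dotL2 v u = conjc (dotL2 u v).
Proof.
rewrite /dotL2 -integralC_conj//; apply: eq_integralC => x.
by apply: complex_eq; rewrite !RIE; ring.
Qed.

Lemma dotL2_pos : positive_form (@dotL2 _ T R mu).
Proof.
split; [split => [a u v w|a u v w]|move=> u].
- exact: dotL2_linl.
- rewrite (dotL2_conj _ u) dotL2_linl (dotL2_conj v u) (dotL2_conj w u).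
  by apply: complex_eq; rewrite !RIE; ring.
- by apply: ge0_integralC => x; rewrite mulr_conjc ge0C /= eqxx andbT sqr_ge0.
Qed.

Definition sqn u : R := qf (@dotL2 _ T R mu) u.

Lemma integral_sqn u : (\int[mu]_x (normc (L2_repr u x) ^+ 2)%:E)%E = (sqn u)%:E.
Proof.
rewrite /sqn /qf /= /Rintegral fineK; last first.
  by have [/(integrable_fin_num measurableT) + _] := dotL2_integrable u u.
by apply: eq_integral => x _; rewrite mulr_conjc.
Qed.

Lemma sqn_ae f u : measurable_funC f -> {ae mu, forall x, L2_repr u x = f x} ->
  (\int[mu]_x (normc (f x) ^+ 2)%:E)%E = (sqn u)%:E.
Proof.
move=> mf uf; rewrite -integral_sqn; apply: ae_eq_integral => //.
- by apply/measurable_EFinP; exact: measurable_sqr_normc.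
- by apply/measurable_EFinP; exact: measurable_sqr_normc.
- by apply: filterS uf => x -> _.
Qed.

Lemma sqn_ge0 u : 0 <= sqn u. Proof. exact: qf_ge0 dotL2_pos u. Qed.

Lemma sqn_eq0 u : sqn u = 0 -> u = 0.
Proof.
move=> u0; have := integral_sqn u; rewrite u0 => i0.
have mf : measurable_fun setT (fun x => (normc (L2_repr u x) ^+ 2)%:E).
  by apply/measurable_EFinP; exact: measurable_sqr_normc.
have : (\int[mu]_x `|(normc (L2_repr u x) ^+ 2)%:E| = 0)%E.
  apply: etrans i0; apply: eq_integral => x _.
  by rewrite gee0_abs// lee_fin sqr_ge0.
move/(ae_eq_integral_abs mu measurableT mf) => ae0.
apply: L2_repr_inj; apply: filterS2 ae0 L2_repr0 => x /(_ I) [/eqP].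
by rewrite sqrf_eq0 => /eqP/normc_eq0 -> ->.
Qed.

Lemma dotL2_eq u v : (forall w, dotL2 u w = dotL2 v w) -> u = v.
Proof.
move=> uv; apply/eqP; rewrite -subr_eq0; apply/eqP/sqn_eq0.
by rewrite /sqn /qf (sesqBl dotL2_pos.1) uv subrr.
Qed.

Lemma normL2E u : normL2 u = Num.sqrt (sqn u). Proof. by []. Qed.

(** Later estimates use the squared norm [sqn], which avoids square roots; [C] corresponds to the
    square of the bound [M]. *)
Lemma bounded_operatorP (A : H -> H) : bounded_operator A <->
  linear A /\ exists2 C : R, 0 <= C & forall u, sqn (A u) <= C * sqn u.
Proof.
split=> [[lA [M AM]]|[lA [C C0 AC]]]; split => //.
  exists (M ^+ 2) => [|u]; first exact: sqr_ge0.
  rewrite -(sqr_sqrtr (sqn_ge0 (A u))) -[in leRHS](sqr_sqrtr (sqn_ge0 u)) -exprMn.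
  rewrite -!normL2E ler_pXn2r ?nnegrE ?sqrtr_ge0//.
  by apply: (le_trans _ (AM u)); exact: sqrtr_ge0.
exists (Num.sqrt C) => u; rewrite !normL2E -sqrtrM//.
by rewrite ler_wsqrtr.
Qed.

End L2_hilbert.
#[global] Hint Resolve L2_repr_mfun dotL2_integrable dotL2_pos : core.

(** * Completeness of L2 and representation of bounded forms *)

Section steps.
Context {R : realType}.

(** Bounded total variation makes the telescoping series of increments absolutely convergent. *)
Lemma cvg_bounded_steps (r : nat -> R) (M : R) :
  (forall n, \sum_(i < n) `|r i.+1 - r i| <= M) -> cvgn r.
Proof.
move=> rM; pose s i := r i.+1 - r i.
have cs : cvgn (series s).
  apply: normed_cvg; apply: nondecreasing_is_cvgn.
    by apply: nondecreasing_series => n _ _ /=.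
  by exists M => _ [n _ <-] /=; rewrite seriesEord; exact: rM.
have -> : r = (fun n => r 0%N + series s n).
  apply/funext => n; rewrite /series /= telescope_sumr//.
  by rewrite addrC subrK.
by apply: is_cvgD => //; exact: is_cvg_cst.
Qed.

Lemma sum_half_le n : \sum_(i < n) (2^-1 : R) ^+ i <= 2.
Proof.
suff -> : \sum_(i < n) (2^-1 : R) ^+ i = 2 - 2 * 2^-1 ^+ n.
  by rewrite gerBl mulr_ge0// exprn_ge0.
elim: n => [|n ih]; first by rewrite big_ord0 expr0; lra.
by rewrite big_ord_recr /= ih exprS; field.
Qed.

End steps.

Section completeness.
Context d (T : measurableType d) (R : realType).
Variable mu : {measure set T -> \bar R}.
Local Notation H := (L2 mu).
Implicit Types (u v w : H) (f g : T -> R[i]).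

(** The sum of the whole series has integral at most 2, hence is finite almost everywhere. *)
Lemma ae_bounded_sum (a : nat -> T -> R) : (forall n, measurable_fun setT (a n)) ->
  (forall n x, 0 <= a n x) ->
  (forall n, (\int[mu]_x (a n x)%:E <= (2^-1 ^+ n)%:E)%E) ->
  {ae mu, forall x, exists M : R, forall n, \sum_(i < n) a i x <= M}.
Proof.
move=> ma a0 ia.
have ma' n : measurable_fun setT (fun x => (a n x)%:E) by exact/measurable_EFinP.
have a0' n x : setT x -> (0 <= (a n x)%:E)%E by rewrite lee_fin.
have i2 : (\int[mu]_x (\sum_(0 <= n <oo) (a n x)%:E) <= 2%:E)%E.
  rewrite integral_nneseries//; apply: lime_le.
    by apply: is_cvg_nneseries => n _ _; apply: integral_ge0 => x _; exact: a0'.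
  apply: nearW => n; apply: (@le_trans _ _ (\sum_(0 <= i < n) (2^-1 ^+ i)%:E)%E).
    by apply: lee_sum => i _.
  by rewrite sumEFin lee_fin big_mkord; exact: sum_half_le.
have mS : measurable_fun setT (fun x => \sum_(0 <= n <oo) (a n x)%:E)%E.
  by apply: ge0_emeasurable_sum => // n x _ _; exact: a0'.
have S0 x : (0 <= \sum_(0 <= n <oo) (a n x)%:E)%E.
  by apply: nneseries_ge0 => n _ _; exact: a0'.
have iS : mu.-integrable setT (fun x => \sum_(0 <= n <oo) (a n x)%:E)%E.
  apply/integrableP; split => //.
  under eq_integral do rewrite gee0_abs//.
  by rewrite (le_lt_trans i2)// ltry.
apply: filterS (integrable_ae measurableT iS) => x /(_ I) fx.
exists (fine (\sum_(0 <= n <oo) (a n x)%:E)%E) => n.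
rewrite -lee_fin fineK// -sumEFin -(big_mkord xpredT (fun i => (a i x)%:E)).
by apply: nneseries_lim_ge => k _ _; exact: a0'.
Qed.

(** A subsequence with summable increments converges pointwise almost everywhere. Fatou then bounds
    the distance from every [u m], not only from the terms of the subsequence, to the pointwise
    limit. *)
Lemma L2_complete (u : nat -> H) :
  (forall e : R, 0 < e -> exists N, forall m n, (N <= m)%N -> (N <= n)%N ->
    sqn (u m - u n) <= e) ->
  exists v, forall e : R, 0 < e -> exists N, forall m, (N <= m)%N -> sqn (u m - v) <= e.
Proof.
move=> cu.
have p4 k : 0 < (4^-1 : R) ^+ k by rewrite exprn_gt0.
have [K KP] : exists K : nat -> nat, forall j m n, (K j <= m)%N -> (K j <= n)%N ->
    sqn (u m - u n) <= 4^-1 ^+ j.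
  have /choice[K KP] : forall j, exists N, forall m n, (N <= m)%N -> (N <= n)%N ->
    sqn (u m - u n) <= 4^-1 ^+ j by move=> j; exact: cu.
  by exists K => j m n; exact: KP.
(* The sum makes [k] nondecreasing and at least [K j]; the summand [j] makes it at least [j]. *)
pose k j := (j + \sum_(i < j.+1) K i)%N.
have Kk j : (K j <= k j)%N by rewrite /k big_ord_recr /= addnA leq_addl.
have kS j : (k j <= k j.+1)%N by rewrite /k [in leqRHS]big_ord_recr /= leq_add// leq_addr.
have kmono i j : (i <= j)%N -> (k i <= k j)%N by exact: (homo_leq leqnn leq_trans kS).
pose w j := L2_repr (u (k j)).
have wm j : measurable_funC (w j) by exact: L2_repr_mfun.
have mwB i j : measurable_funC (fun x => w i x - w j x).
  apply: mfunCD => //; have := mfunCZ (-1) (wm j).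
  by under [X in measurable_funC X]eq_fun do rewrite mulN1r.
have iwB i j : (\int[mu]_x (normc (w i x - w j x) ^+ 2)%:E = (sqn (u (k i) - u (k j)))%:E)%E.
  by apply: sqn_ae => //; exact: L2_reprB.
(* The squared increments have integral at most [4^-j], so the weight [2^j] leaves the summable
   bound [2^-j]. *)
pose a j x := 2 ^+ j * normc (w j.+1 x - w j x) ^+ 2.
have ma j : measurable_fun setT (a j).
  by apply: measurable_funM => //; exact: measurable_sqr_normc.
have a0 j x : 0 <= a j x by rewrite mulr_ge0 ?sqr_ge0.
have aM : {ae mu, forall x, exists M : R, forall n, \sum_(i < n) a i x <= M}.
  apply: ae_bounded_sum => // j; rewrite /a.
  under eq_integral do rewrite EFinM.
  rewrite ge0_integralZl_EFin//.
  - rewrite iwB -EFinM lee_fin.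
    apply: (@le_trans _ _ (2 ^+ j * 4^-1 ^+ j)).
      by rewrite ler_pM2l ?exprn_gt0// KP// (leq_trans (Kk j)).
    by rewrite -exprMn; have -> : 2 * 4^-1 = 2^-1 :> R by field.
  - by move=> x _; rewrite lee_fin sqr_ge0.
  - by apply/measurable_EFinP; exact: measurable_sqr_normc.
have bnd x : (exists M : R, forall n, \sum_(i < n) a i x <= M) ->
    exists M : R, forall n, \sum_(i < n) normc (w i.+1 x - w i x) <= M.
  move=> [M aMx]; exists (2 + M) => n.
  apply: (@le_trans _ _ (\sum_(i < n) (2^-1 ^+ i + a i x))).
    (* The pointwise bound [b <= 2^-i + 2^i b^2] follows from [(2^i b - 1)^2 >= 0]; it turns
       weighted summability of the squares into summability of the increments. *)
    apply: ler_sum => i _; rewrite /a; move: (normc _) => b.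
    have p2 : 0 < (2 : R) ^+ i by rewrite exprn_gt0.
    rewrite exprVn; move: (2 ^+ i) p2 => p p0.
    have : 0 <= p^-1 * (p * b - 1) ^+ 2 by rewrite mulr_ge0 ?sqr_ge0 ?invr_ge0 ?ltW.
    have -> : p^-1 * (p * b - 1) ^+ 2 = p * b ^+ 2 - 2 * b + p^-1.
      by field; rewrite gt_eqF.
    have : 0 <= p * b ^+ 2 by rewrite mulr_ge0 ?sqr_ge0 ?ltW.
    have : 0 < p^-1 by rewrite invr_gt0.
    lra.
  by rewrite big_split /=; apply: lerD; [exact: sum_half_le|exact: aMx].
(* The upper limit is measurable everywhere and equals the limit wherever the latter exists. *)
pose vR x := fine (limn_esup (fun j => (Re (w j x))%:E)).
pose vI x := fine (limn_esup (fun j => (Im (w j x))%:E)).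
pose v x : R[i] := vR x +i* vI x.
have mv : measurable_funC v.
  apply: mfunCP; apply: (measurableT_comp (fine_measurable measurableT)).
    apply: (measurable_fun_limn_esup (f := fun n x => (Re (w n x))%:E)) => n.
    by apply/measurable_EFinP; exact: (wm n).1.
  apply: (measurable_fun_limn_esup (f := fun n x => (Im (w n x))%:E)) => n.
  by apply/measurable_EFinP; exact: (wm n).2.
have esupE (r : nat -> R) : cvgn r -> r @ \oo --> fine (limn_esup (EFin \o r)).
  move=> /cvg_ex[l rl]; have h : (EFin \o r) @ \oo --> l%:E.
    by apply: cvg_EFin; [exact: nearW|exact: rl].
  by rewrite (cvg_limn_einf_sup h).2.
have wv : {ae mu, forall x, (fun j => Re (w j x)) @ \oo --> Re (v x) /\
                            (fun j => Im (w j x)) @ \oo --> Im (v x)}.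
  apply: filterS aM => x /bnd[M wM]; split; apply: esupE;
      apply: (@cvg_bounded_steps _ _ M) => n; apply: (le_trans _ (wM n)); apply: ler_sum => i _.
    by apply: le_trans (normr_Re_le _); rewrite !RIE.
  by apply: le_trans (normr_Im_le _); rewrite !RIE.
(* Fatou along the subsequence, shifted by [N] so that every index falls in the range of the
   hypothesis. *)
have key m (e : R) N : (forall i, (N <= i)%N -> sqn (u m - u (k i)) <= e) ->
    (\int[mu]_x (normc (L2_repr (u m) x - v x) ^+ 2)%:E <= e%:E)%E.
  move=> me; have mB (f : T -> R[i]) : measurable_funC f ->
      measurable_funC (fun x => L2_repr (u m) x - f x).
    move=> mf; apply: mfunCD; first exact: L2_repr_mfun.
    by have := mfunCZ (-1) mf; under [X in measurable_funC X]eq_fun do rewrite mulN1r.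
  apply: (@fatou_cst _ _ _ _ (fun i x => normc (L2_repr (u m) x - w (N + i)%N x) ^+ 2)).
  - by move=> n; apply: measurable_sqr_normc; exact: mB.
  - by apply: measurable_sqr_normc; exact: mB.
  - by move=> n x; rewrite sqr_ge0.
  - apply: filterS wv => x [wR wI].
    under eq_fun do rewrite sqr_normcE !RIE.
    rewrite sqr_normcE !RIE.
    have sh (r : nat -> R) (l : R) : r @ \oo --> l -> (fun i => r (N + i)%N) @ \oo --> l.
      by move=> rl; exact: (cvg_comp _ _ (cvg_addnl N) rl).
    have sq (b l : R) (r : nat -> R) : r @ \oo --> l ->
        (fun i => (b - r (N + i)%N) ^+ 2) @ \oo --> (b - l) ^+ 2.
      move=> /sh rl; have h : (fun i => b - r (N + i)%N) @ \oo --> b - l.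
        exact: cvgB (cvg_cst b) rl.
      exact: (cvgM h h).
    exact: cvgD (sq _ _ _ wR) (sq _ _ _ wI).
  - move=> i; rewrite (_ : \int[mu]_x _ = (sqn (u m - u (k (N + i)%N)))%:E)%E.
      by rewrite lee_fin me// leq_addr.
    by apply: sqn_ae; [exact: mB|exact: L2_reprB].
have v2 : v \in sqint mu.
  pose m := k 0%N.
  pose h x := L2_repr (u m) x - v x.
  have mh : measurable_funC h.
    apply: mfunCD; first exact: L2_repr_mfun.
    by have := mfunCZ (-1) mv; under [X in measurable_funC X]eq_fun do rewrite mulN1r.
  have h2 : h \in sqint mu.
    apply/sqintP; split => //.
    apply: (@le_lt_trans _ _ 1%:E); last exact: ltry.
    apply: (key m 1 0%N) => i _; rewrite -(expr0 (4^-1)).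
    by apply: KP; rewrite (leq_trans (Kk 0%N))// kmono.
  have -> : v = ((-1) *: h + L2_repr (u m) : T -> R[i]).
    apply/funext => x; rewrite /= -[RHS]/(-1 * h x + L2_repr (u m) x) /h; ring.
  exact: (sqint_submod_closed mu).2 h2 (L2_repr_sqint _).
exists (L2_class mu v) => e e0; have [N NP] := cu e e0; exists N => m Nm.
rewrite -lee_fin -(@sqn_ae _ _ _ _ (fun x => L2_repr (u m) x - v x)).
- apply: (key m e N) => i Ni; apply: NP => //; apply: (leq_trans Ni).
  exact: leq_addr.
- apply: mfunCD; first exact: L2_repr_mfun.
  by have := mfunCZ (-1) mv; under [X in measurable_funC X]eq_fun do rewrite mulN1r.
- by apply: filterS2 (L2_reprB (u m) (L2_class mu v)) (L2_classE v2) => x -> ->.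
Qed.

End completeness.

Section riesz.
Context d (T : measurableType d) (R : realType).
Variable mu : {measure set T -> \bar R}.
Local Notation H := (L2 mu).
Local Notation dot := (@dotL2 _ T R mu).
Implicit Types (u v w : H) (e : nat -> H) (c : nat -> R[i]).

Let dS : sesquilinear dot := (dotL2_pos mu).1.

Lemma le_eps_eq0 (x K : R) : 0 <= x -> 0 <= K ->
  (forall eps, 0 < eps -> x <= K * eps) -> x = 0.
Proof.
move=> x0 K0 xK; apply/eqP; rewrite eq_le x0 andbT leNgt; apply/negP => xp.
have K1 : 0 < K + 1 by lra.
(* [K + 1] keeps the denominator positive when [K = 0]. *)
have e0 : 0 < x / (2 * (K + 1)) by rewrite divr_gt0// mulr_gt0.
have := xK _ e0.
have -> : K * (x / (2 * (K + 1))) = x * (K / (2 * (K + 1))) by ring.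
have : K / (2 * (K + 1)) <= 2^-1.
  by rewrite ler_pdivrMr ?mulr_gt0//; lra.
move: (K / _) => q q2 xq.
have : x * q <= x * 2^-1 by rewrite ler_pM2l.
lra.
Qed.

Lemma dot_cs u v : normc (dot u v) ^+ 2 <= sqn u * sqn v.
Proof. exact: cauchy_schwarz. Qed.

Lemma sqn_sym u v : sqn (u - v) = sqn (v - u).
Proof. exact: (qf_sym (dotL2_pos mu)). Qed.

Section orthonormal.
Variable e : nat -> H.
Hypothesis eB : orthonormal_basis e.

Definition comb c m n : H := \sum_(m <= i < n) c i *: e i.

Lemma dot_comb_e c m n k : dot (comb c m n) (e k) = if (m <= k < n)%N then c k else 0.
Proof.
rewrite /comb (sesq_suml dS); under eq_bigr do rewrite (sesqZl dS) eB.1.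
case: ifPn => kmn.
  rewrite (bigD1_seq k) ?mem_index_iota ?iota_uniq//= eqxx mulr1 big1 ?addr0// => i ik.
  by rewrite (negbTE ik) mulr0.
rewrite big_nat big1// => i imn; have [ik|_] := eqVneq i k; last by rewrite mulr0.
by rewrite -ik imn in kmn.
Qed.

Lemma dot_comb c m n v : dot (comb c m n) v = \sum_(m <= i < n) c i * dot (e i) v.
Proof. by rewrite /comb (sesq_suml dS); apply: eq_bigr => i _; rewrite (sesqZl dS). Qed.

Lemma sqn_comb c m n : sqn (comb c m n) = \sum_(m <= i < n) normc (c i) ^+ 2.
Proof.
rewrite /sqn /qf dot_comb.
rewrite (eq_big_nat _ _ (F2 := fun i => (normc (c i) ^+ 2)%:C)); last first.
  move=> i imn; rewrite (dotL2_conj (comb c m n)) dot_comb_e imn.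
  by rewrite -mulr_conjc.
by elim/big_ind2 : _ => // x1 x2 y1 y2 <- <-; rewrite !RIE.
Qed.

Lemma combB c m n : (m <= n)%N -> comb c 0 n - comb c 0 m = comb c m n.
Proof. by move=> mn; rewrite /comb (@big_cat_nat _ _ _ m 0 n)//= addrAC subrr add0r. Qed.

(** The squared distance between two partial combinations is an increment of the bounded
    nondecreasing sequence [s], so the combinations form a Cauchy sequence. *)
Lemma riesz_fischer c (C : R) :
  (forall n, \sum_(0 <= i < n) normc (c i) ^+ 2 <= C) ->
  exists2 v, (forall k, dot v (e k) = c k) &
    forall eps : R, 0 < eps -> exists N, forall n, (N <= n)%N ->
      sqn (comb c 0 n - v) <= eps.
Proof.
move=> cC; pose s n := \sum_(0 <= i < n) normc (c i) ^+ 2.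
have snd : nondecreasing_seq s.
  apply/nondecreasing_seqP => n; rewrite /s big_nat_recr//= lerDl sqr_ge0//.
have cs : cvgn s.
  apply: nondecreasing_is_cvgn => //; exists C => _ [n _ <-]; exact: cC.
have sB m n : (m <= n)%N -> sqn (comb c 0 n - comb c 0 m) = s n - s m.
  move=> mn; rewrite combB// sqn_comb /s (@big_cat_nat _ _ _ m 0 n)//= addrAC subrr add0r//.
have [v vP] : exists v, forall eps : R, 0 < eps -> exists N, forall n, (N <= n)%N ->
      sqn (comb c 0 n - v) <= eps.
  apply: L2_complete => eps eps0.
  have sl n : s n <= limn s by exact: nondecreasing_cvgn_le.
  have /cvgrPdist_le/(_ _ eps0)[N _ NP] := cs.
  exists N.
  have h m n : (N <= m)%N -> (m <= n)%N -> sqn (comb c 0 n - comb c 0 m) <= eps.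
    move=> Nm mn; rewrite sB//.
    have := NP m Nm; rewrite /= => hm; have := le_trans (ler_norm _) hm.
    have := sl n; lra.
  move=> m n Nm Nn; have [mn|/ltnW nm] := leqP m n; last exact: h.
  by rewrite sqn_sym; exact: h.
exists v => // k; apply/eqP; rewrite -subr_eq0; apply/eqP/normc_eq0.
apply/eqP; rewrite -sqrf_eq0; apply/eqP.
apply: (@le_eps_eq0 _ 1) => // [|eps eps0]; first exact: sqr_ge0.
have [N NP] := vP eps eps0.
(* [k.+1] ensures that [e k] already occurs in the combination. *)
have := NP (maxn N k.+1) (leq_maxl _ _) => hN; rewrite mul1r.
apply: le_trans hN; set n := maxn N k.+1.
have -> : dot v (e k) - c k = - dot (comb c 0 n - v) (e k).
  rewrite (sesqBl dS) dot_comb_e /= leq_max ltnSn orbT; ring.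
have nN (z : R[i]) : normc (- z) = normc z by case: z => a b /=; rewrite !sqrrN.
rewrite nN (le_trans (dot_cs _ _))// /sqn [qf dot (e k)]/qf eB.1 eqxx mulr1//.
Qed.

Lemma bessel u n : \sum_(0 <= i < n) normc (dot u (e i)) ^+ 2 <= sqn u.
Proof.
pose c i := dot u (e i); have := sqn_ge0 (u - comb c 0 n).
rewrite /sqn qfB// -/(sqn (comb c 0 n)) sqn_comb (dotL2_conj (comb c 0 n)) Re_conjc.
rewrite dot_comb.
have -> : Re (\sum_(0 <= i < n) c i * dot (e i) u) = \sum_(0 <= i < n) normc (c i) ^+ 2.
  elim/big_ind2 : _ => // [x1 x2 y1 y2 <- <-|i _]; first by rewrite !RIE.
  by rewrite (dotL2_conj u) mulr_conjc.
rewrite -/(sqn u); lra.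
Qed.

Definition proj n u : H := comb (fun i => dot u (e i)) 0 n.

(** By Bessel and [riesz_fischer] the projections converge to some [v] with the same coordinates as
    [u]; totality of the basis forces [u = v]. *)
Lemma proj_cvg u (eps : R) : 0 < eps -> exists N, forall n, (N <= n)%N ->
  sqn (u - proj n u) <= eps.
Proof.
have [v vE vP] := riesz_fischer (bessel u).
have -> : u = v.
  apply/eqP; rewrite -subr_eq0; apply/eqP; apply: eB.2 => n.
  by rewrite (sesqBl dS) vE subrr.
move=> /vP[N NP]; exists N => n Nn; rewrite sqn_sym.
suff -> : proj n v = comb (fun i => dot u (e i)) 0 n by exact: NP.
by apply: eq_bigr => i _; rewrite vE.
Qed.

End orthonormal.

(** [A u] is the vector with coordinates [B u (e i)]. These are square summable: testing [B u] on
    their own partial combination gives [s^2 <= C * sqn u * s], where [s] is the partial sum of the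
    squares. *)
Lemma riesz_form e (B : H -> H -> R[i]) (C : R) : orthonormal_basis e ->
  sesquilinear B -> 0 <= C -> (forall u v, normc (B u v) ^+ 2 <= C * sqn u * sqn v) ->
  exists2 A : H -> H, bounded_operator A & forall u v, dot (A u) v = B u v.
Proof.
move=> eB sB C0 BC.
have /choice[A AP] : forall u, exists w, forall v, dot w v = B u v.
  move=> u; pose c i := B u (e i).
  have Cu0 : 0 <= C * sqn u by rewrite mulr_ge0 ?sqn_ge0.
  have cC n : \sum_(0 <= i < n) normc (c i) ^+ 2 <= C * sqn u.
    have := BC u (comb e c 0 n); rewrite sqn_comb//.
    have -> : B u (comb e c 0 n) = (\sum_(0 <= i < n) normc (c i) ^+ 2)%:C.
      rewrite /comb (sesq_sumr sB) rmorph_sum; apply: eq_bigr => i _.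
      by rewrite (sesqZr sB) mulrC mulr_conjc.
    have : 0 <= \sum_(0 <= i < n) normc (c i) ^+ 2.
      by apply: sumr_ge0 => i _; exact: sqr_ge0.
    move: (\sum_(_ <= _ < _) _) => s s0; rewrite normcR real_normK ?num_real//.
    move: s0; rewrite le_eqVlt => /predU1P[<- //|s0].
    by rewrite expr2 ler_pM2r.
  have [w wE _] := riesz_fischer eB cC.
  exists w => v; apply/eqP; rewrite -subr_eq0; apply/eqP/normc_eq0.
  apply/eqP; rewrite -sqrf_eq0; apply/eqP.
  apply: (@le_eps_eq0 _ (2 * (sqn w + C * sqn u))); first exact: sqr_ge0.
    by rewrite mulr_ge0// addr_ge0// sqn_ge0.
  move=> eps eps0; have [N /(_ N (leqnn N)) NP] := proj_cvg eB v eps0.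
  have Ew : dot w (proj e N v) = B u (proj e N v).
    rewrite /proj /comb (sesq_sumr dS) (sesq_sumr sB); apply: eq_bigr => i _.
    by rewrite (sesqZr dS) (sesqZr sB) wE.
  (* [dot w] and [B u] agree on [proj e N v], so only the remainder [v - proj e N v] contributes;
     the factor -1 gives the shape expected by [sqr_normc_le]. *)
  have -> : dot w v - B u v = (- 1) * B u (v - proj e N v) + dot w (v - proj e N v).
    rewrite (sesqBr dS) (sesqBr sB) Ew; ring.
  apply: (le_trans (sqr_normc_le _ _ _)).
  have -> : normc (-1 : R[i]) = 1.
    by rewrite /= oppr0 expr0n addr0 sqrrN expr1n sqrtr1.
  rewrite expr1n mulr1 -mulrDr -mulrA ler_pM2l//.
  have h1 := BC u (v - proj e N v); have h2 := dot_cs w (v - proj e N v).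
  apply: (@le_trans _ _ ((sqn w + C * sqn u) * sqn (v - proj e N v))); first lra.
  by apply: ler_wpM2l => //; rewrite addr_ge0// sqn_ge0.
exists A => //; apply/bounded_operatorP; split.
  move=> a u v; apply: dotL2_eq => w.
  by rewrite AP sB.1 dS.1 !AP.
exists C => // u; have := BC u (A u); rewrite -AP.
rewrite [dot (A u) (A u)](qfE (dotL2_pos mu)) normcR real_normK ?num_real//.
have := sqn_ge0 (A u); rewrite /sqn le_eqVlt => /predU1P[<- _|s0].
  by rewrite mulr_ge0// sqn_ge0.
by rewrite expr2 ler_pM2r.
Qed.

End riesz.

(** * Product measures and Gram kernels *)

Section sigma_finite_product.
Context d1 d2 (T1 : measurableType d1) (T2 : measurableType d2) (R : realType).
Variable m1 : {sigma_finite_measure set T1 -> \bar R}.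
Variable m2 : {sigma_finite_measure set T2 -> \bar R}.

(* The library proves that [m1 \x m2] is sigma-finite, but canonical inference
   does not find the instance. *)
Definition sigma_finite_prod : {sigma_finite_measure set (T1 * T2)%type -> \bar R} :=
  HB.pack_for {sigma_finite_measure set (T1 * T2)%type -> \bar R}
    (product_measure1 m1 m2)
    (lebesgue_integral_fubini.measure_function_Measure_isSigmaFinite__to__measure_function_isSFinite m1 m2)
    (lebesgue_integral_fubini.measure_function_Measure_isSigmaFinite__to__measure_function_isSigmaFinite m1 m2).

End sigma_finite_product.

Section product_integrals.
Context d1 d2 (T1 : measurableType d1) (T2 : measurableType d2) (R : realType).
Variable m1 : {sigma_finite_measure set T1 -> \bar R}.
Variable m2 : {sigma_finite_measure set T2 -> \bar R}.
Variables (f : T1 -> R[i]) (g : T2 -> R[i]).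
Hypotheses (cf : integrableC m1 f) (cg : integrableC m2 g).

Lemma integrableC_tensor : integrableC (m1 \x m2)%E (fun p => f p.1 * g p.2).
Proof.
have mf := integrableC_mfunC cf; have mg := integrableC_mfunC cg.
have mfg : measurable_funC (fun p : T1 * T2 => f p.1 * g p.2).
  by apply: mfunCM; [exact: (mfunC_comp measurable_fst mf)|exact: (mfunC_comp measurable_snd mg)].
have mn : measurable_fun setT (fun p : T1 * T2 => (normc (f p.1 * g p.2))%:E).
  by apply/measurable_EFinP; exact: mfunC_normc.
apply: integrableCP => //; rewrite fubini_tonelli1//; last first.
  by move=> p; rewrite lee_fin normc_ge0.
have n0 (S : Type) (k : S -> R[i]) x : (0 <= (normc (k x))%:E)%E by rewrite lee_fin normc_ge0.
rewrite /fubini_F /=; under eq_integral => x _.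
  under eq_integral do rewrite Normc.normcM EFinM.
  rewrite ge0_integralZl_EFin ?normc_ge0//; last by apply/measurable_EFinP; exact: mfunC_normc.
  over.
have gy := integrableC_lty cg.
have g0 : (0 <= \int[m2]_y (normc (g y))%:E)%E by apply: integral_ge0 => y _; exact: n0.
rewrite -(@fineK _ (\int[m2]_y (normc (g y))%:E)%E); last by rewrite ge0_fin_numE.
under eq_integral do rewrite muleC.
rewrite ge0_integralZl_EFin//.
- by apply: lte_mul_pinfty; rewrite ?lee_fin ?fine_ge0//; exact: integrableC_lty.
- by apply/measurable_EFinP; exact: mfunC_normc.
- exact: fine_ge0.
Qed.

Lemma integralC_tensor : integralC (m1 \x m2)%E (fun p => f p.1 * g p.2) =
  integralC m1 f * integralC m2 g.
Proof.
rewrite -(integralC_prod1 integrableC_tensor) /=.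
rewrite mulrC -integralCZ//; apply: eq_integralC => x.
by rewrite integralCZ// mulrC.
Qed.

End product_integrals.

Section gram.
Context d1 d2 (W : measurableType d1) (T : measurableType d2) (R : realType).
Variable m1 : {sigma_finite_measure set W -> \bar R}.
Variable m2 : {sigma_finite_measure set T -> \bar R}.
Variables (k : W * T -> R[i]) (h : T -> R[i]) (C D : R).
Hypotheses (mk : measurable_funC k) (ch : integrableC m2 h).
Hypothesis kC : forall t, (\int[m1]_w (normc (k (w, t)) ^+ 2)%:E <= C%:E)%E.
Hypothesis kD : forall p, normc (k p) <= D.
Hypothesis C0 : 0 <= C.

Let m22 : {sigma_finite_measure set (T * T)%type -> \bar R} := sigma_finite_prod m2 m2.

Definition gram_kernel t s : R[i] := integralC m1 (fun w => k (w, t) * conjc (k (w, s))).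

Let mh : measurable_funC h := integrableC_mfunC ch.

Let mkl w : measurable_funC (fun t => k (w, t)).
Proof. exact: (mfunC_comp (measurable_pair1 w) mk). Qed.

Let mkr t : measurable_funC (fun w => k (w, t)).
Proof. exact: (mfunC_comp (measurable_pair2 t) mk). Qed.

Let k2 t : (fun w => k (w, t)) \in sqint m1.
Proof. by apply/sqintP; split => //; rewrite (le_lt_trans (kC t))// ltry. Qed.

Let chk w : integrableC m2 (fun t => h t * k (w, t)).
Proof.
apply: (@integrableC_le _ _ _ _ _ (fun t => D * normc (h t))).
- by apply: mfunCM => //; exact: mfunC_comp.
- by have := integrableZl measurableT D (integrableC_normc ch); apply: eq_integrable.
- by move=> t; rewrite Normc.normcM mulrC ler_wpM2r ?normc_ge0.
Qed.

Let Phi (z : W * (T * T)) : R[i] :=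
  (h z.2.1 * k (z.1, z.2.1)) * conjc (h z.2.2 * k (z.1, z.2.2)).

Let mPhi : measurable_funC Phi.
Proof.
apply: mfunCM.
  apply: mfunCM.
    by apply: (mfunC_comp (phi := fun z : W * (T * T) => z.2.1) _ mh); exact: measurableT_comp.
  apply: (mfunC_comp (phi := fun z : W * (T * T) => (z.1, z.2.1)) _ mk).
  by apply: measurable_fun_pair => //; exact: measurableT_comp.
apply: mfunC_conj; apply: mfunCM.
  by apply: (mfunC_comp (phi := fun z : W * (T * T) => z.2.2) _ mh); exact: measurableT_comp.
apply: (mfunC_comp (phi := fun z : W * (T * T) => (z.1, z.2.2)) _ mk).
by apply: measurable_fun_pair => //; exact: measurableT_comp.
Qed.

Let iPhi : integrableC (m1 \x m22)%E Phi.
Proof.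
apply: integrableCP => //; rewrite fubini_tonelli2//; first last.
- by move=> p; rewrite lee_fin normc_ge0.
- by apply/measurable_EFinP; exact: mfunC_normc.
rewrite /fubini_G /=.
have mhh : measurable_fun setT (fun p : T * T => normc (h p.1 * h p.2)).
  apply: mfunC_normc; apply: mfunCM.
    exact: (mfunC_comp measurable_fst mh).
  exact: (mfunC_comp measurable_snd mh).
have mn : measurable_fun setT (fun z => (normc (Phi z))%:E).
  by apply/measurable_EFinP; exact: mfunC_normc.
(* The product of two values of [k] is at most the sum of their squares, whose integral in [w] is at
   most [2 * C] by [kC]; this domination is what permits Fubini. *)
apply: (@le_lt_trans _ _ (\int[m22]_p ((2 * C) * normc (h p.1 * h p.2))%:E)%E).
  apply: ge0_le_integral => //.
  - by move=> p _; apply: integral_ge0 => w _; rewrite lee_fin normc_ge0.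
  - apply: (measurable_fun_fubini_tonelli_G (m1 := m1) _ mn) => p.
    by rewrite lee_fin normc_ge0.
  - by apply/measurable_EFinP; exact: measurable_funM.
  - move=> [t s] _ /=.
    have mkt u : measurable_fun setT (fun w => (normc (k (w, u)) ^+ 2)%:E).
      by apply/measurable_EFinP; exact: measurable_sqr_normc.
    apply: (@le_trans _ _ (\int[m1]_w (normc (h t * h s) *
        (normc (k (w, t)) ^+ 2 + normc (k (w, s)) ^+ 2))%:E)%E).
      apply: ge0_le_integral => //.
      + by move=> w _; rewrite lee_fin normc_ge0.
      + apply/measurable_EFinP; apply: mfunC_normc.
        exact: (mfunC_comp (measurable_pair2 (t, s)) mPhi).
      + apply/measurable_EFinP; apply: measurable_funM => //.
        by apply: measurable_funD; apply/measurable_EFinP; exact: mkt.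
      + move=> w _; rewrite lee_fin /Phi /= !Normc.normcM normc_conj Normc.normcM.
        rewrite mulrACA ler_wpM2l ?mulr_ge0 ?normc_ge0//; exact: normcM_le.
    under eq_integral do rewrite EFinM EFinD.
    rewrite ge0_integralZl_EFin ?normc_ge0//; last 2 first.
      by move=> w _; rewrite adde_ge0// lee_fin sqr_ge0.
      by apply: emeasurable_funD; exact: mkt.
    rewrite ge0_integralD//; try by move=> w _; rewrite lee_fin sqr_ge0.
    have -> : ((2 * C) * normc (h t * h s))%:E =
        ((normc (h t * h s))%:E * (C%:E + C%:E))%E.
      by rewrite -EFinD -EFinM; congr EFin; ring.
    by apply: lee_wpmul2l; rewrite ?lee_fin ?normc_ge0// leeD.
under eq_integral do rewrite EFinM.
rewrite ge0_integralZl_EFin//; last 3 first.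
- by move=> p _; rewrite lee_fin normc_ge0.
- exact/measurable_EFinP.
- by rewrite mulr_ge0.
apply: lte_mul_pinfty => //; first by rewrite lee_fin mulr_ge0.
exact: integrableC_lty (integrableC_tensor ch ch).
Qed.

(** The square expands into a double integral in [t] and [s], and the integration in [w] is done
    first. The right-hand side sees [k] only through its Gram kernel, so two kernels with equal Gram
    kernels have equal left-hand sides; [smoothing_identity] rests on this. *)
Lemma gram_identity :
  (\int[m1]_w (normc (integralC m2 (fun t => h t * k (w, t))) ^+ 2)%:E)%E =
  (Re (integralC (m2 \x m2)%E
        (fun p => h p.1 * conjc (h p.2) * gram_kernel p.1 p.2)))%:E.
Proof.
have inner w : integralC m22 (fun p => Phi (w, p)) =
    (normc (integralC m2 (fun t => h t * k (w, t))) ^+ 2)%:C.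
  rewrite -mulr_conjc -integralC_conj//.
  rewrite -(integralC_tensor (chk w) (integrableC_conj (chk w))).
  by apply: eq_integralC => -[t s].
have -> : integralC (m2 \x m2)%E (fun p => h p.1 * conjc (h p.2) * gram_kernel p.1 p.2) =
   integralC (m1 \x m22)%E Phi.
  rewrite -(integralC_prod2 iPhi); apply: eq_integralC => -[t s] /=.
  rewrite -integralCZ; last exact: sqint_mulr_conj.
  by apply: eq_integralC => w; rewrite /Phi /=; apply: complex_eq; rewrite !RIE; ring.
rewrite -(integralC_prod1 iPhi) /= /Rintegral fineK.
  apply: eq_integral => w _.
  by rewrite -[RHS]/((Re (integralC m22 (fun p => Phi (w, p))))%:E) inner.
by have [/(integrable_fin_num measurableT) + _] := integrableC_prod1 iPhi.
Qed.

End gram.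

(** * The Fourier transform on the line *)

Section half_line_integrals.
Context {R : realType}.
Local Notation leb := (@lebesgue_measure R).

Lemma cvgy0_le_inv (F : R -> R) (c : R) :
  (forall s, 1 <= s -> `|F s| <= c / s) -> F s @[s --> +oo] --> (0 : R).
Proof.
move=> Fc; apply/cvgrPdist_le => e e0; near=> s.
have s1 : 1 <= s by near: s; exact: (nbhs_pinfty_ge (num_real _)).
rewrite sub0r normrN (le_trans (Fc s s1))// ler_pdivrMr; last lra.
by rewrite mulrC -ler_pdivrMr.
Unshelve. all: by end_near. Qed.

Lemma ge0_FTC2y (f F : R -> R) (l : R) : (forall x, 0 <= x -> 0 <= f x) ->
  continuous f -> (forall x : R, is_derive x 1 F (f x)) ->
  F x @[x --> +oo] --> l ->
  (\int[leb]_(x in `[0%R, +oo[) (f x)%:E = (l - F 0)%:E)%E.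
Proof.
move=> f0 cf dF Fl; rewrite (@ge0_continuous_FTC2y _ f F 0 l)//.
- by apply: continuous_subspaceT.
- apply: cvg_at_right_filter; apply: differentiable_continuous.
  by apply/derivable1_diffP; have [] := dF 0.
- by move=> x _; rewrite derive1E; apply: derive_val.
Qed.

Lemma expRN_le_inv (y : R) : 0 < y -> expR (- y) <= y^-1.
Proof.
move=> y0; rewrite expRN lef_pV2 ?posrE ?expR_gt0//.
by apply: le_trans (expR_ge1Dx y); rewrite lerDr.
Qed.

Lemma expRN_le_inv2 (y : R) : 0 < y -> expR (- y) <= 2 / y ^+ 2.
Proof.
move=> y0; rewrite expRN -[2 / _]invrK invfM invrK lef_pV2 ?posrE ?expR_gt0//.
  apply: le_trans (expR_ge1Dxn 1 (ltW y0)).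
  by rewrite (_ : 2`!%:R = 2)// [leRHS]addrC mulrC lerDl.
by rewrite mulr_gt0 ?invr_gt0// exprn_gt0.
Qed.

(** Writes [y ^- 2] as a Laplace transform, so that the division by [x ^+ 2] in
    [integral_one_sub_cos] becomes an exponential. *)
Lemma integral_mul_expRN (y : R) : 0 < y ->
  (\int[leb]_(s in `[0%R, +oo[) (s * expR (- (s * y)))%:E = (y ^- 2)%:E)%E.
Proof.
move=> y0; have yn : y != 0 by rewrite gt_eqF.
(* The antiderivative that vanishes at infinity. *)
pose F s := - ((s / y + y ^- 2) * expR (- (s * y))).
transitivity ((0 - F 0)%:E); last first.
- by rewrite /F !mul0r oppr0 expR0; congr EFin; ring.
apply: (@ge0_FTC2y _ F).
- by move=> s s0; rewrite mulr_ge0// expR_ge0.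
- move=> s; apply: differentiable_continuous; apply/derivable1_diffP; exact: ex_derive.
- move=> s; rewrite /F; apply: is_derive_eq.
  by rewrite /GRing.scale /=; field.
- apply: (@cvgy0_le_inv _ ((y^-1 + y ^- 2) * (2 / y ^+ 2))) => s s1.
  have s0 : 0 < s by lra.
  have sy0 : 0 < s * y by rewrite mulr_gt0.
  rewrite /F normrN normrM (ger0_norm (expR_ge0 _)) ger0_norm; last first.
    by rewrite addr_ge0 ?divr_ge0 ?invr_ge0 ?exprn_ge0// ltW.
  apply: (@le_trans _ _ ((s * y^-1 + s * y ^- 2) * (2 / (s * y) ^+ 2))).
    apply: ler_pM; rewrite ?expR_ge0 ?expRN_le_inv2//.
      by rewrite addr_ge0 ?divr_ge0 ?invr_ge0 ?exprn_ge0// ltW.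
    by rewrite lerD2l ler_peMl// invr_ge0 exprn_ge0// ltW.
  by rewrite le_eqVlt; apply/orP; left; apply/eqP; field; rewrite yn gt_eqF.
Qed.

Lemma integral_damped_cos (a s : R) : 0 < s ->
  (\int[leb]_(x in `[0%R, +oo[) ((1 - cos (a * x)) * (s * expR (- (s * x))))%:E =
   (a ^+ 2 / (s ^+ 2 + a ^+ 2))%:E)%E.
Proof.
move=> s0; have sn : s != 0 by rewrite gt_eqF.
have d0 : 0 < s ^+ 2 + a ^+ 2 by rewrite ltr_pwDl ?exprn_gt0 ?sqr_ge0.
have dn : s ^+ 2 + a ^+ 2 != 0 by rewrite gt_eqF.
(* The antiderivative that vanishes at infinity, found by integrating
   [cos (a * x) * expR (- (s * x))] by parts twice. *)
pose F x := (- 1 + s / (s ^+ 2 + a ^+ 2) * (s * cos (a * x) - a * sin (a * x))) *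
  expR (- (s * x)).
transitivity ((0 - F 0)%:E); last first.
- rewrite /F !mulr0 cos0 sin0 oppr0 expR0; congr EFin; field => //.
apply: (@ge0_FTC2y _ F).
- move=> x x0; apply: mulr_ge0; first by rewrite subr_ge0 cos_le1.
  by rewrite mulr_ge0 ?expR_ge0// ltW.
- move=> x; apply: differentiable_continuous; apply/derivable1_diffP; exact: ex_derive.
- move=> x; rewrite /F; apply: is_derive_eq.
  rewrite /GRing.scale /=; field => //.
- apply: (@cvgy0_le_inv _ ((1 + s / (s ^+ 2 + a ^+ 2) * (s + `|a|)) / s)) => x x1.
  have x0 : 0 < x by lra.
  rewrite /F normrM (ger0_norm (expR_ge0 _)) -[leRHS]mulrA -invfM.
  apply: ler_pM; rewrite ?expR_ge0 ?normr_ge0//; last by rewrite expRN_le_inv// mulr_gt0.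
  rewrite (le_trans (ler_normD _ _))// normrN1 lerD2l normrM ger0_norm; last first.
    by rewrite divr_ge0// ltW.
  apply: ler_wpM2l; first by rewrite divr_ge0// ltW.
  rewrite (le_trans (ler_normB _ _))// !normrM (ger0_norm (ltW s0)) lerD//.
    by rewrite ler_piMr ?(ltW s0)// ler_norml cos_geN1 cos_le1.
  by rewrite ler_piMr// ler_norml sin_geN1 sin_le1.
Qed.

Lemma continuous_lorentz (a : R) : 0 < a ->
  continuous (fun s : R => a ^+ 2 / (s ^+ 2 + a ^+ 2)).
Proof.
move=> a0 s; apply: cvgM; first exact: cvg_cst.
apply: cvgV; first by rewrite gt_eqF// ltr_wpDl ?sqr_ge0// exprn_gt0.
by apply: cvgD; [exact: exprn_continuous|exact: cvg_cst].
Qed.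

Lemma integral_lorentz (a : R) : 0 < a ->
  (\int[leb]_(s in `[0%R, +oo[) (a ^+ 2 / (s ^+ 2 + a ^+ 2))%:E = (a * (pi / 2))%:E)%E.
Proof.
move=> a0; have an : a != 0 by rewrite gt_eqF.
have dn (s : R) : s ^+ 2 + a ^+ 2 != 0.
  by rewrite gt_eqF// ltr_wpDl ?sqr_ge0// exprn_gt0.
transitivity ((a * (pi / 2) - a * atan (0 / a))%:E); last first.
- by rewrite mul0r atan0 mulr0 subr0.
apply: (@ge0_FTC2y _ (fun s => a * atan (s / a))).
- by move=> s _; rewrite divr_ge0 ?addr_ge0 ?sqr_ge0.
- exact: continuous_lorentz.
- move=> s; apply: is_derive_eq.
  by rewrite /GRing.scale /=; field; rewrite dn.
- apply: cvgM; first exact: cvg_cst.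
  have h : (fun s : R => s / a) @ +oo --> +oo.
    by apply: gt0_cvgMly; [rewrite invr_gt0|exact: cvg_id].
  by apply: (cvg_comp (fun s : R => s / a) atan h); exact: cvgy_atan.
Qed.

End half_line_integrals.

Section measure_preserving.
Context d1 d2 (T1 : measurableType d1) (T2 : measurableType d2) (R : realType).
Variables (m1 : {measure set T1 -> \bar R}) (m2 : {measure set T2 -> \bar R}).
Variable phi : T1 -> T2.
Hypothesis mphi : measurable_fun setT phi.
Hypothesis phiE : forall A, measurable A -> m1 (phi @^-1` A) = m2 A.

Lemma ge0_integral_preserving (f : T2 -> \bar R) : measurable_fun setT f ->
  (forall x, (0 <= f x)%E) -> (\int[m1]_x f (phi x) = \int[m2]_x f x)%E.
Proof.
move=> mf f0; have := @ge0_integral_pushforward _ _ T1 T2 R phi mphi m1 setT f measurableT mf.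
rewrite preimage_setT => <-//; apply: eq_measure_integral => A mA _.
exact: phiE.
Qed.

Lemma Rintegral_preserving (f : T2 -> R) : measurable_fun setT f ->
  \int[m1]_x f (phi x) = \int[m2]_x f x.
Proof.
move=> mf; have mf' : measurable_fun setT (EFin \o f) by exact/measurable_EFinP.
rewrite /Rintegral; congr fine; rewrite integralE [RHS]integralE; congr (_ - _)%E.
  rewrite -(ge0_integral_preserving (f := (EFin \o f)^\+)%E).
  - by apply: eq_integral => x _; rewrite !funeposE.
  - exact: measurable_funepos.
  - exact: funepos_ge0.
rewrite -(ge0_integral_preserving (f := (EFin \o f)^\-)%E).
- by apply: eq_integral => x _; rewrite !funenegE.
- exact: measurable_funeneg.
- exact: funeneg_ge0.
Qed.

Lemma integralC_preserving (f : T2 -> R[i]) : measurable_funC f ->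
  integralC m1 (fun x => f (phi x)) = integralC m2 f.
Proof.
move=> [mf1 mf2]; apply: complex_eq.
  exact: (Rintegral_preserving (f := fun x => Re (f x))).
exact: (Rintegral_preserving (f := fun x => Im (f x))).
Qed.

Lemma integrableC_preserving (f : T2 -> R[i]) : integrableC m2 f ->
  integrableC m1 (fun x => f (phi x)).
Proof.
move=> cf; have mf := integrableC_mfunC cf.
apply: integrableCP; first exact: (mfunC_comp mphi mf).
rewrite (ge0_integral_preserving (f := fun x => (normc (f x))%:E)).
- exact: integrableC_lty.
- by apply/measurable_EFinP; exact: mfunC_normc.
- by move=> x; rewrite lee_fin normc_ge0.
Qed.

Lemma ae_preserving (P : T2 -> Prop) : {ae m2, forall x, P x} -> {ae m1, forall x, P (phi x)}.
Proof.
move=> [A [mA A0 PA]]; exists (phi @^-1` A); split.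
- by rewrite -[X in measurable X]setTI; exact: mphi.
- by rewrite phiE.
- by move=> x /= Px; exact: PA.
Qed.

End measure_preserving.

Section sinc_square.
Context {R : realType}.
Local Notation leb := (@lebesgue_measure R).

(** Substitute [int_0^oo s e^(-s|x|) ds] for [x ^- 2]. The integrand is nonnegative, so Tonelli
    allows integrating in [x] first; what remains is [2 int_0^oo a^2 / (s^2 + a^2) ds], given by the
    arctangent. *)
Lemma integral_one_sub_cos (a : R) : 0 < a ->
  (\int[leb]_x ((1 - cos (a * x)) / x ^+ 2)%:E = (pi * a)%:E)%E.
Proof.
move=> a0.
pose D : set R := `]0%R, +oo[%classic.
have mD : measurable D by exact: measurable_itv.
(* The indicator restricts [s] to the open half-line, which keeps [g] nonnegative on the whole
   plane. *)
pose g (p : measurableTypeR R * measurableTypeR R) : R :=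
  (1 - cos (a * p.1)) * (p.2 * expR (- (p.2 * `|p.1|))) * \1_D p.2.
have mg : measurable_fun setT g.
  apply: measurable_funM; last first.
    apply: (@measurableT_comp _ _ _ _ _ _ (\1_D : R -> R) _ snd) => //.
  apply: measurable_funM.
    apply: measurable_funB => //.
    apply: (@measurableT_comp _ _ _ _ _ _ (fun x : R => cos (a * x)) _ fst) => //.
    apply: (@measurableT_comp _ _ _ _ _ _ (@cos R)) => //.
    by apply: continuous_measurable_fun; exact: continuous_cos.
  apply: measurable_funM => //.
  apply: measurableT_comp => //; apply: measurable_funN.
  by apply: measurable_funM => //; exact: measurableT_comp.
have g0 p : (0 <= (g p)%:E)%E.
  rewrite lee_fin /g indicE; have [/set_mem|] := boolP (p.2 \in D); last by rewrite mulr0.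
  rewrite /D /= in_itv /= andbT => p0; rewrite mulr1 mulr_ge0 ?subr_ge0 ?cos_le1//.
  by rewrite mulr_ge0 ?expR_ge0 ?(ltW p0).
transitivity (\int[leb]_x \int[leb]_s (g (x, s))%:E)%E.
  apply: eq_integral => x _; rewrite /g /=.
  have -> : (fun s => ((1 - cos (a * x)) * (s * expR (- (s * `|x|))) * \1_D s)%:E) =
     (fun s => ((1 - cos (a * x)) * (s * expR (- (s * `|x|))))%:E) \_ D.
    apply/funext => s; rewrite patchE indicE.
    by case: ifPn => _; rewrite ?mulr1 ?mulr0.
  rewrite -integral_mkcond /D.
  (* At 0 the Laplace formula fails, but the numerator vanishes and both sides are 0. *)
  have [->|x0] := eqVneq x 0.
    rewrite mulr0 cos0 subrr mul0r; under eq_integral do rewrite mul0r.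
    by rewrite integral0.
  rewrite integral_itv_obnd_cbnd; last first.
    apply/measurable_EFinP; apply: measurable_funM => //; apply: measurable_funM => //.
    by apply: measurableT_comp => //; apply: measurable_funN; exact: measurable_funM.
  under eq_integral do rewrite EFinM.
  rewrite ge0_integralZl_EFin//.
  - rewrite integral_mul_expRN ?normr_gt0// -EFinM.
    by rewrite -[in RHS]normrX ger0_norm ?sqr_ge0// -normrX (ger0_norm (sqr_ge0 _)).
  - move=> s; rewrite /= in_itv/= andbT => s0.
    by rewrite lee_fin mulr_ge0 ?expR_ge0.
  - apply/measurable_EFinP; apply: measurable_funM => //.
    by apply: measurableT_comp => //; apply: measurable_funN; exact: measurable_funM.
have mg' : measurable_fun setT (EFin \o g) by exact/measurable_EFinP.
rewrite (@fubini_tonelli _ _ _ _ _ _ _ (EFin \o g))//.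
have ml (c : R) (E : set R) : measurable_fun E (fun s : R => (c * (a ^+ 2 / (s ^+ 2 + a ^+ 2)))%:E).
  apply/measurable_EFinP; apply: measurable_funTS; apply: measurable_funM => //.
  by apply: continuous_measurable_fun; exact: continuous_lorentz.
transitivity (\int[leb]_(s in `[0%R, +oo[) (2 * (a ^+ 2 / (s ^+ 2 + a ^+ 2)))%:E)%E.
  rewrite -integral_itv_obnd_cbnd; last exact: ml.
  rewrite [RHS]integral_mkcond; apply: eq_integral => s _; rewrite patchE /fubini_G /g /=.
  rewrite indicE; case: ifPn => [/set_mem|_]; last first.
    by under eq_integral do rewrite mulr0; rewrite integral0.
  rewrite /D /= in_itv/= andbT => s0.
  under eq_integral do rewrite mulr1.
  rewrite (@ge0_symfun_integralT _ (fun x => (1 - cos (a * x)) * (s * expR (- (s * `|x|))))).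
  - rewrite -set_itvcy.
    rewrite (eq_integral (fun x : measurableTypeR R => ((1 - cos (a * x)) * (s * expR (- (s * x))))%:E)).
      by rewrite integral_damped_cos// -EFinM.
    by move=> x; rewrite inE /= in_itv/= andbT => x0; rewrite ger0_norm.
  - move=> x; rewrite mulr_ge0 ?subr_ge0 ?cos_le1//.
    by rewrite mulr_ge0 ?expR_ge0// ltW.
  - have cM (c : R) : continuous (fun x : R => c * x).
      by move=> x; apply: cvgM; [exact: cvg_cst|exact: cvg_id].
    move=> x; apply: cvgM.
      apply: cvgB; first exact: cvg_cst.
      by apply: (continuous_comp (g := @cos R)); [exact: cM|exact: continuous_cos].
    apply: cvgM; first exact: cvg_cst.
    have cu : - (s * `|y|) @[y --> x] --> - (s * `|x|).
      by apply: cvgN; apply: cvgM; [exact: cvg_cst|exact: norm_continuous].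
    exact: (cvg_comp (fun y => - (s * `|y|)) (@expR R) cu (@continuous_expR R _)).
  - by move=> x /=; rewrite mulrN cosN normrN.
under eq_integral do rewrite EFinM.
rewrite ge0_integralZl_EFin//.
- by rewrite integral_lorentz// -EFinM; congr EFin; field.
- by move=> s _; rewrite lee_fin divr_ge0 ?addr_ge0 ?sqr_ge0.
- apply/measurable_EFinP; apply: measurable_funTS.
  by apply: continuous_measurable_fun; exact: continuous_lorentz.
Qed.

End sinc_square.

Section cis.
Context {R : realType}.

Definition cis (s : R) : R[i] := cos s +i* sin s.

Lemma cisD s t : cis (s + t) = cis s * cis t.
Proof. by apply: complex_eq; rewrite !RIE /= ?cosD ?sinD//; ring. Qed.

Lemma cis0 : cis 0 = 1.
Proof. by rewrite /cis cos0 sin0. Qed.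

Lemma normc_cis s : normc (cis s) = 1.
Proof. by rewrite /= cos2Dsin2 sqrtr1. Qed.

Lemma conj_cis s : conjc (cis s) = cis (- s).
Proof. by apply: complex_eq; rewrite !RIE /= ?cosN ?sinN. Qed.

Lemma mfunC_cis d (T : measurableType d) (f : T -> R) : measurable_fun setT f ->
  measurable_funC (fun x => cis (f x)).
Proof.
move=> mf; apply: mfunCP => /=.
  apply: (measurableT_comp (f := @cos R)) => //.
  by apply: continuous_measurable_fun; exact: continuous_cos.
apply: (measurableT_comp (f := @sin R)) => //.
by apply: continuous_measurable_fun; exact: continuous_sin.
Qed.

Lemma norm_sin_le (x : R) : `|sin x| <= `|x|.
Proof.
wlog x0 : x / 0 < x => [hw|].
  have [x0|x0|->] := ltgtP x 0; last 2 first.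
  - exact: hw.
  - by rewrite sin0 normr0.
  by have := hw (- x); rewrite oppr_gt0 sinN !normrN => ->.
have ds (y : R) : y \in `]0, x[%R -> is_derive y (1 : R) (@sin R) (cos y).
  by move=> _; exact: is_derive_sin.
have cs : {within `[0, x], continuous (@sin R)}.
  by apply: continuous_subspaceT => y; exact: continuous_sin.
have [c _] := MVT x0 ds cs; rewrite sin0 !subr0 => ->.
rewrite normrM ler_piMl// ler_norml cos_geN1 cos_le1//.
Qed.

Lemma cvg_sin_div (u : nat -> R) : (forall n, u n != 0) -> u @ \oo --> (0 : R) ->
  (fun n => sin (u n) / u n) @ \oo --> (1 : R).
Proof.
move=> u0 ul.
have ds := is_derive_sin (0 : R).
have [dsin dE] := ds; move: dE; rewrite cos0 /derive => dE.
have h : (h^-1 *: (sin (h *: 1 + 0) - sin 0) : R) @[h --> (0 : R)^'] --> (1 : R).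
  move: dsin => /cvg_ex[l hl]; have l1 : l = 1.
    by rewrite -[RHS]dE; apply/esym/cvg_lim.
  by rewrite l1 in hl.
have := cvg_comp u (fun h : R => h^-1 *: (sin (h *: 1 + 0) - sin 0) : R) _ h.
have hu : u @ \oo --> (0 : R)^'.
  move=> A /= A0; have H : \forall n \near \oo, u n != 0 -> A (u n) by exact: (ul _ A0).
  by apply: (filterS _ H) => n /(_ (u0 n)).
move=> /(_ _ hu); apply: cvg_trans; apply: near_eq_cvg; apply: nearW => n /=.
by rewrite sin0 subr0 addr0 /GRing.scale /= mulr1 mulrC.
Qed.

End cis.

Lemma Rintegral_lin3 d (T : measurableType d) (R : realType)
    (mu : {measure set T -> \bar R}) (c k : R) (f g h : T -> R) :
  mu.-integrable setT (EFin \o f) -> mu.-integrable setT (EFin \o g) ->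
  mu.-integrable setT (EFin \o h) ->
  \int[mu]_x (c * (f x + g x + k * h x)) =
  c * (\int[mu]_x f x + \int[mu]_x g x + k * \int[mu]_x h x).
Proof.
move=> fi gi hi; have fgi : mu.-integrable setT (EFin \o (fun x => f x + g x)).
  exact: (integrableD measurableT fi gi).
have khi : mu.-integrable setT (EFin \o (fun x => k * h x)).
  exact: (integrableZl measurableT k hi).
rewrite RintegralZl//; last exact: (integrableD measurableT fgi khi).
by rewrite RintegralD// RintegralD// RintegralZl.
Qed.

(** * The Fejer kernel and its Fourier transform *)

Section fejer.
Context {R : realType}.
Local Notation leb := (@lebesgue_measure R).

Lemma measurable_invr : measurable_fun setT (@GRing.inv R).
Proof.
rewrite -(setUv [set (0 : R)]); apply/measurable_funU => //; first exact: measurableC.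
split; first exact: measurable_fun_set1.
apply: open_continuous_measurable_fun; first by apply: closed_openC; exact: closed_eq.
by move=> x /[!inE] /= /eqP x0; exact: inv_continuous.
Qed.

(** Its integral over the line is [pi * |a|] for every real [a]. Integrals of cosine waves against
    the Fejer kernel reduce to three of this kind. *)
Definition osc (a x : R) : R := (1 - cos (a * x)) / x ^+ 2.

Lemma osc_ge0 a x : 0 <= osc a x.
Proof. by rewrite divr_ge0 ?sqr_ge0// subr_ge0 cos_le1. Qed.

Lemma measurable_osc a : measurable_fun setT (osc a).
Proof.
apply: measurable_funM.
  apply: measurable_funB => //.
  apply: (measurableT_comp (f := @cos R)) => //.
  by apply: continuous_measurable_fun; exact: continuous_cos.
rewrite (_ : (fun _ => _) = (fun x : R => (x^-1) ^+ 2)); last first.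
  by apply/funext => x; rewrite exprVn.
by apply: measurable_funX; exact: measurable_invr.
Qed.

Lemma integral_osc a : (\int[leb]_x (osc a x)%:E = (pi * `|a|)%:E)%E.
Proof.
have [a0|a0|->] := ltgtP a 0.
- rewrite ltr0_norm// -(@integral_one_sub_cos _ (- a)) ?oppr_gt0//.
  by apply: eq_integral => x _; rewrite /osc mulNr cosN.
- by rewrite gtr0_norm// -integral_one_sub_cos.
- rewrite normr0 mulr0; under eq_integral do rewrite /osc mul0r cos0 subrr mul0r.
  by rewrite integral0.
Qed.

Lemma integrable_osc a : leb.-integrable setT (EFin \o osc a).
Proof.
apply/integrableP; split; first by apply/measurable_EFinP; exact: measurable_osc.
under eq_integral do rewrite /= ger0_norm ?osc_ge0//.
by rewrite integral_osc ltry.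
Qed.

(* [fejer b w = (sin (pi b w) / (pi w)) ^ 2], except for the junk value [0] at [w = 0]. *)
Definition fejer (b w : R) : R := (2 * pi ^+ 2)^-1 * osc (2 * pi * b) w.

(** For [b >= 0] this is the tent [max(b - |u|, 0)], written as a second difference of the absolute
    value because [integral_osc] produces absolute values. *)
Definition triangle (b u : R) : R := 2^-1 * (`|u + b| + `|u - b| - 2 * `|u|).

Let pi0 : (pi : R) != 0. Proof. by rewrite gt_eqF// pi_gt0. Qed.
Let pi2 : 0 <= (2 * pi ^+ 2 : R)^-1.
Proof. by rewrite invr_ge0 mulr_ge0// sqr_ge0. Qed.

Lemma fejer_ge0 b w : 0 <= fejer b w.
Proof. by rewrite mulr_ge0 ?osc_ge0. Qed.

Lemma measurable_fejer b : measurable_fun setT (fejer b).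
Proof. by apply: measurable_funM => //; exact: measurable_osc. Qed.

Lemma fejerE b w : b != 0 -> w != 0 -> fejer b w = b ^+ 2 * (sin (pi * b * w) / (pi * b * w)) ^+ 2.
Proof.
move=> b0 w0; rewrite /fejer /osc.
have -> : 2 * pi * b * w = (pi * b * w) *+ 2 by rewrite -mulr_natl; ring.
rewrite cos_mulr2n cos2sin2; move: (pi : R) pi0 => p p0; field.
by rewrite w0 b0 p0.
Qed.

Lemma fejer_le b w : b != 0 -> fejer b w <= b ^+ 2.
Proof.
move=> b0; have [->|w0] := eqVneq w 0.
  by rewrite /fejer /osc expr0n invr0 !mulr0 sqr_ge0.
rewrite fejerE// ler_piMr ?sqr_ge0// -real_normK ?num_real//.
by rewrite expr_le1// normrM normfV ler_pdivrMr ?normr_gt0 ?mulf_neq0// mul1r norm_sin_le.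
Qed.

Lemma integral_fejer b : 0 < b -> (\int[leb]_w (fejer b w)%:E = b%:E)%E.
Proof.
move=> b0; under eq_integral do rewrite /fejer EFinM.
rewrite ge0_integralZl_EFin//.
- rewrite integral_osc -EFinM; congr EFin.
  rewrite ger0_norm ?mulr_ge0 ?pi_ge0 ?(ltW b0)//.
  by move: (pi : R) pi0 => p p0; field.
- by move=> w _; rewrite lee_fin osc_ge0.
- by apply/measurable_EFinP; exact: measurable_osc.
Qed.

Lemma integrable_fejer b : 0 < b -> leb.-integrable setT (EFin \o fejer b).
Proof.
move=> b0; apply/integrableP; split; first by apply/measurable_EFinP; exact: measurable_fejer.
under eq_integral do rewrite /= ger0_norm ?fejer_ge0//.
by rewrite integral_fejer// ltry.
Qed.

Lemma integrable_fejer_cis b u : 0 < b ->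
  integrableC leb (fun w => (fejer b w)%:C * cis (- (2 * pi * (w * u)))).
Proof.
move=> b0; apply: (@integrableC_le _ (measurableTypeR R) R leb _ (fejer b)).
- apply: mfunCM; first by apply: mfunC_real; exact: measurable_fejer.
  by apply: mfunC_cis; apply: measurable_funN; apply: measurable_funM => //; exact: measurable_funM.
- exact: integrable_fejer.
- by move=> w; rewrite Normc.normcM normc_cis mulr1 normcR ger0_norm ?fejer_ge0.
Qed.

(** Real part: the product formula turns [(1 - cos B) cos U] into a second difference of [osc] at
    the frequencies [u + b], [u - b] and [u]. Imaginary part: the integrand is odd. *)
Lemma fourier_fejer b u : 0 < b ->
  integralC leb (fun w => (fejer b w)%:C * cis (- (2 * pi * (w * u)))) = (triangle b u)%:C.
Proof.
move=> b0; have [iR iI] := integrable_fejer_cis u b0; apply: complex_eq => /=.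
  have -> : (fun w => Re ((fejer b w)%:C * cis (- (2 * pi * (w * u))))) =
      (fun w => (4 * pi ^+ 2)^-1 * (osc (2 * pi * (u + b)) w +
         osc (2 * pi * (u - b)) w + (- 2) * osc (2 * pi * u) w)).
    apply/funext => w; rewrite !RIE /= mul0r subr0 cosN /fejer /osc.
    have -> : 2 * pi * (w * u) = 2 * pi * u * w by ring.
    have -> : 2 * pi * (u + b) * w = 2 * pi * u * w + 2 * pi * b * w by ring.
    have -> : 2 * pi * (u - b) * w = 2 * pi * u * w - 2 * pi * b * w by ring.
    rewrite !cosD cosN sinN invfM [(4 * _)^-1]invfM; move: (w ^- 2) (pi ^- 2) => W P.
    by field.
  have Ro a : \int[leb]_x osc a x = pi * `|a| by rewrite /Rintegral integral_osc.
  apply: etrans; first exact: (Rintegral_lin3 _ _ (integrable_osc _) (integrable_osc _) (integrable_osc _)).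
  rewrite !Ro /triangle !normrM (ger0_norm (pi_ge0 R)) (@ger0_norm _ 2)//.
  by move: (pi : R) pi0 => p p0; field.
have mI := integrableC_mfunC (integrable_fejer_cis u b0).
have N1 (A : set R) : measurable A -> leb ((-%R : _ -> measurableTypeR R) @^-1` A) = leb A.
  exact: lebesgue_measureN.
have mN : measurable_fun setT (-%R : measurableTypeR R -> measurableTypeR R).
  exact: oppr_measurable.
pose f w := Im ((fejer b w)%:C * cis (- (2 * pi * (w * u)))).
have : \int[leb]_w f (- w) = \int[leb]_w f w  by
  exact: (@Rintegral_preserving _ _ (measurableTypeR R) (measurableTypeR R) R leb leb -%R mN N1 f mI.2).
have -> : \int[leb]_w f (- w) = \int[leb]_w (- 1 * f w).
  apply: eq_Rintegral => w _; rewrite /f !RIE /= !mulNr !mulrN opprK sinN.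
  by rewrite /fejer /osc mulrN !cosN sqrrN; ring.
rewrite RintegralZl//; rewrite /f; lra.
Qed.

End fejer.

(** * Plancherel's theorem on the line *)

Section plancherel1.
Context {R : realType}.
Local Notation leb := (@lebesgue_measure R).
Local Notation RR := (measurableTypeR R).

Definition fourier1 (h : R -> R[i]) (w : R) : R[i] :=
  integralC leb (fun t => cis (- (2 * pi * (w * t))) * h t).

(** The square root makes [fejer (2 * r)] the squared modulus of the kernel, so that the Gram kernel
    is the Fourier transform of the Fejer kernel. *)
Definition wave_kernel (r : R) (p : RR * RR) : R[i] :=
  (Num.sqrt (fejer (2 * r) p.1))%:C * cis (- (2 * pi * (p.1 * p.2))).

Definition near_diag (r : R) : set (RR * RR) := [set p | `|p.1 - p.2| < r].

Definition box_kernel (r : R) (p : RR * RR) : R[i] := (\1_(near_diag r) p)%:C.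

Lemma measurable_near_diag r : measurable (near_diag r).
Proof.
rewrite (_ : near_diag r = (fun p : RR * RR => `|p.1 - p.2|) @^-1` `]-oo, r[%classic); last first.
  by apply/seteqP; split => p /=; rewrite in_itv.
rewrite -[X in measurable X]setTI.
have m : measurable_fun setT (fun p : RR * RR => `|p.1 - p.2|).
  by apply: measurableT_comp => //; exact: measurable_funB.
by apply: m => //; exact: measurable_itv.
Qed.

Lemma mfunC_wave_kernel r : measurable_funC (wave_kernel r).
Proof.
apply: mfunCM.
  apply: mfunC_real; apply: (measurableT_comp (f := @Num.sqrt R)).
    by apply: continuous_measurable_fun; exact: sqrt_continuous.
  apply: (@measurableT_comp _ _ _ _ _ _ (fejer (2 * r)) _ fst) => //.
  exact: measurable_fejer.
apply: mfunC_cis; apply: measurable_funN; apply: measurable_funM => //.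
exact: measurable_funM.
Qed.

Lemma mfunC_box_kernel r : measurable_funC (box_kernel r).
Proof. by apply: mfunC_real; apply: measurable_indic; exact: measurable_near_diag. Qed.

Lemma normc_wave_kernel r p : normc (wave_kernel r p) = Num.sqrt (fejer (2 * r) p.1).
Proof. by rewrite Normc.normcM normc_cis mulr1 normcR ger0_norm ?sqrtr_ge0. Qed.

Lemma gram_wave r t s : 0 < r -> gram_kernel leb (wave_kernel r) t s = (triangle (2 * r) (t - s))%:C.
Proof.
move=> r0; rewrite -fourier_fejer ?mulr_gt0//; apply: eq_integralC => w.
rewrite /wave_kernel /= -[in RHS](sqr_sqrtr (fejer_ge0 (2 * r) w)).
rewrite (_ : - (2 * pi * (w * (t - s))) = - (2 * pi * (w * t)) + 2 * pi * (w * s)); last by ring.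
rewrite cisD; have -> : cis (2 * pi * (w * s)) = conjc (cis (- (2 * pi * (w * s)))).
  by rewrite conj_cis opprK.
by apply: complex_eq; rewrite !RIE /=; ring.
Qed.

Lemma triangleN (b u : R) : triangle b (- u) = triangle b u.
Proof.
rewrite /triangle (_ : - u + b = - (u - b)); last by ring.
by rewrite (_ : - u - b = - (u + b)) ?normrN; ring.
Qed.

(** Two intervals of length [2 * r] centred at [t] and [s] overlap in length
    [max(2 r - |t - s|, 0)]. This is the triangle of [fourier_fejer] again, now as the Gram kernel
    of windows. *)
Lemma ball_inter_measure r t s : 0 < r ->
  leb ([set y : RR | `|y - t| < r] `&` [set y : RR | `|y - s| < r]) = (triangle (2 * r) (t - s))%:E.
Proof.
wlog st : t s / s <= t => [hw r0|r0].
  have [|/ltW ts] := leP s t; first by move=> /hw; exact.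
  by rewrite setIC hw// -triangleN opprB.
rewrite (_ : _ `&` _ = `]t - r, s + r[%classic); last first.
  apply/seteqP; split => y /=; rewrite in_itv /= !ltr_norml.
    by move=> [/andP[a1 a2] /andP[a3 a4]]; apply/andP; split; lra.
  by move=> /andP[a1 a2]; split; apply/andP; split; lra.
rewrite lebesgue_measure_itv /= lte_fin /triangle (ger0_norm (_ : 0 <= t - s)) ?subr_ge0//.
rewrite (@ger0_norm _ (t - s + _)); last lra.
case: ltP => h.
  by rewrite ler0_norm -?EFinB; [congr EFin; lra|lra].
by rewrite ger0_norm; [congr EFin; lra|lra].
Qed.

Lemma box_kernelE r y t : box_kernel r (y, t) = (\1_[set z | `|z - t| < r] y : R)%:C.
Proof. by rewrite /box_kernel /near_diag !indicE; congr (_%:C); congr (_%:R); congr nat_of_bool; apply/idP/idP => /set_mem h; apply/mem_set. Qed.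

Lemma measurable_dist_ball (t r : R) : measurable ([set z : RR | `|z - t| < r]).
Proof.
rewrite (_ : [set _ | _] = ball t r); first exact: measurable_ball.
by apply/seteqP; split => z; rewrite /ball /= distrC.
Qed.

Lemma gram_box r t s : 0 < r -> gram_kernel leb (box_kernel r) t s = (triangle (2 * r) (t - s))%:C.
Proof.
move=> r0; rewrite /gram_kernel.
under eq_integralC do rewrite !box_kernelE.
pose A := [set y : RR | `|y - t| < r]; pose B := [set y : RR | `|y - s| < r].
transitivity (integralC leb (fun y => (\1_(A `&` B) y)%:C)).
  apply: eq_integralC => y; rewrite indicI /=.
  by apply: complex_eq; rewrite !RIE /=; ring.
rewrite integralC_real /Rintegral integral_indic ?setIT//; last first.
  by apply: measurableI; exact: measurable_dist_ball.
by congr (_%:C); exact: (congr1 fine (ball_inter_measure t s r0)).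
Qed.

(** By [gram_wave] and [gram_box] the two kernels have the same Gram kernel, so [gram_identity]
    equates the Fejer-weighted energy of the Fourier transform with the energy of the window
    integrals of [h]. *)
Lemma smoothing_identity (h : R -> R[i]) r : 0 < r -> integrableC leb h ->
  (\int[leb]_w (fejer (2 * r) w * normc (fourier1 h w) ^+ 2)%:E =
   \int[leb]_y (normc (integralC leb (fun t => h t * box_kernel r (y, t))) ^+ 2)%:E)%E.
Proof.
move=> r0 ch; have r20 : 0 < 2 * r by rewrite mulr_gt0.
transitivity (\int[leb]_w (normc (integralC leb (fun t => h t * wave_kernel r (w, t))) ^+ 2)%:E)%E.
  apply: eq_integral => w _; congr EFin.
  have -> : integralC leb (fun t => h t * wave_kernel r (w, t)) =
      (Num.sqrt (fejer (2 * r) w))%:C * fourier1 h w.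
    rewrite /fourier1 -integralCZ.
      by apply: eq_integralC => t; rewrite /wave_kernel /=; apply: complex_eq; rewrite !RIE /=; ring.
    apply: (@integrableC_le _ RR R leb _ (fun t => normc (h t))).
    - apply: mfunCM; last exact: integrableC_mfunC ch.
      by apply: mfunC_cis; apply: measurable_funN; apply: measurable_funM => //; exact: measurable_funM.
    - exact: integrableC_normc.
    - by move=> t; rewrite Normc.normcM normc_cis mul1r.
  by rewrite Normc.normcM exprMn normcR real_normK ?num_real// (sqr_sqrtr (fejer_ge0 (2 * r) w)).
have w2 t : (\int[leb]_w (normc (wave_kernel r (w, t)) ^+ 2)%:E <= (2 * r)%:E)%E.
  under eq_integral do rewrite normc_wave_kernel sqr_sqrtr ?fejer_ge0//.
  by rewrite integral_fejer.
have wD p : normc (wave_kernel r p) <= 2 * r.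
  rewrite normc_wave_kernel -[leRHS](ger0_norm (ltW r20)) -sqrtr_sqr.
  by rewrite ler_wsqrtr// fejer_le// gt_eqF.
have b2 t : (\int[leb]_y (normc (box_kernel r (y, t)) ^+ 2)%:E <= (2 * r)%:E)%E.
  rewrite (_ : (fun y => _) = (fun y => (\1_[set z : RR | `|z - t| < r] y)%:E)).
    have bE : leb [set z : RR | `|z - t| < r] = (2 * r)%:E.
      have := ball_inter_measure t t r0.
      rewrite setIid /triangle subrr add0r sub0r normrN normr0 (ger0_norm (ltW r20)) => ->.
      by congr EFin; lra.
    rewrite integral_indic ?setIT//; last exact: measurable_dist_ball.
    by apply: (le_trans (y := (2 * r)%:E)) => //; rewrite -bE.
  apply/funext => y; rewrite box_kernelE normcR indicE; congr EFin.
  by case: (_ \in _); rewrite ?normr1 ?expr1n// normr0 expr0n.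
have bD p : normc (box_kernel r p) <= 1.
  by rewrite /box_kernel normcR indicE ger0_norm//; case: (_ \in _).
have G1 := gram_identity (mfunC_wave_kernel r) ch w2 wD (ltW r20).
have G2 := gram_identity (mfunC_box_kernel r) ch b2 bD (ltW r20).
have E : gram_kernel leb (wave_kernel r) = gram_kernel leb (box_kernel r).
  by apply/funext => t; apply/funext => s; rewrite gram_wave// gram_box.
by rewrite E in G1; exact: (etrans G1 (esym G2)).
Qed.

End plancherel1.

Section plancherel_line.
Context {R : realType}.
Local Notation leb := (@lebesgue_measure R).
Local Notation RR := (measurableTypeR R).

Let rad (n : nat) : R := n.+1%:R^-1.
Let rad_gt0 n : 0 < rad n. Proof. by rewrite invr_gt0. Qed.

(** Lebesgue differentiation along the balls of radius [rad n], in terms of real integrals over the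
    whole line. *)
Lemma ae_cvg_average (f : R -> R) : leb.-integrable setT (EFin \o f) ->
  {ae leb, forall x, (fun n => (2 * rad n)^-1 *
     \int[leb]_y (f y * \1_[set z : RR | `|x - z| < rad n] y)) @ \oo --> f x}.
Proof.
move=> fi; have locf : locally_integrable setT f.
  have := integrable_locally measurableT fi; congr locally_integrable.
  by apply/funext => x; rewrite patchE in_setT.
pose E (x : R) n : set R := ball x (rad n).
have hE x : nicely_shrinking x (E x).
  split=> [n|]; first exact: measurable_ball.
  exists (1, fun n => PosNum (rad_gt0 n)); split => //=.
  - exact: cvg_harmonic.
  - by move=> n y.
  - by move=> n; rewrite mul1e.
have H := lebesgue_differentiation locf.
apply: (@filterS _ _ (ae_filter_ringOfSetsType leb) _ _ _ H) => x fx.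
have h := nice_lebesgue_differentiation hE locf fx.
have fineM2 (a b : R) : fine (a%:E * b%:E)%E = a * b by [].
have fin (n : nat) : leb.-integrable (E x n) (EFin \o f).
  by apply: integrableS fi => //; exact: measurable_ball.
have -> : (fun n => (2 * rad n)^-1 *
     \int[leb]_y (f y * \1_[set z : RR | `|x - z| < rad n] y)) =
   fine \o (fun n => ((leb (E x n))^-1 * \int[leb]_(y in E x n) (f y)%:E)%E).
  apply/funext => n /=; rewrite lebesgue_measure_ball ?ltW//.
  rewrite (_ : rad n *+ 2 = 2 * rad n); last by rewrite mulr_natl.
  rewrite -(@fineK _ (\int[leb]_(y in E x n) (f y)%:E)%E); last first.
    by apply: integrable_fin_num => //; exact: measurable_ball.
  rewrite inver gt_eqF ?mulr_gt0//; apply: etrans (esym (fineM2 _ _)); congr (_ * _).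
  rewrite /Rintegral [in RHS]integral_mkcond; congr fine.
  apply: eq_integral => y _; rewrite patchE indicE.
  rewrite /E /ball /= mulr_natr.
  have -> : (y \in [set z : RR | `|x - z| < rad n]) = (y \in [set y | `|x - y| < rad n]) by [].
  by case: (_ \in _); rewrite ?mulr1n ?mulr0n.
by apply: fine_cvg; exact: h.
Qed.

Lemma near_diag_indicE r (y t : RR) :
  \1_(near_diag r) (y, t) = \1_[set z : RR | `|y - z| < r] t :> R.
Proof.
by rewrite !indicE; congr (_%:R); congr nat_of_bool.
Qed.

Lemma near_diag_sym r (y t : RR) : \1_(near_diag r) (y, t) = \1_(near_diag r) (t, y) :> R.
Proof.
rewrite !indicE; congr (_%:R); congr nat_of_bool.
by apply/idP/idP => /set_mem; rewrite /near_diag /= distrC => h; apply/mem_set.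
Qed.

Lemma integral_near_diag r (t : RR) : 0 < r ->
  (\int[leb]_y (\1_(near_diag r) (y, t) : R)%:E = (2 * r)%:E)%E.
Proof.
move=> r0; have r20 : 0 <= 2 * r by rewrite mulr_ge0// ltW.
have E : (fun y : RR => (\1_(near_diag r) (y, t) : R)%:E) =
    (fun y => (\1_[set z : RR | `|z - t| < r] y)%:E).
  by apply/funext => y; rewrite !indicE.
rewrite E integral_indic ?setIT//; last exact: measurable_dist_ball.
have := ball_inter_measure t t r0.
rewrite setIid /triangle subrr add0r sub0r normrN normr0 (ger0_norm r20) => h.
by apply: (etrans h); congr EFin; lra.
Qed.

Lemma measurable_near_diag_indic r (y : RR) :
  measurable_fun setT (fun t : RR => \1_(near_diag r) (y, t) : R).
Proof.
apply: (measurableT_comp (f := \1_(near_diag r) : RR * RR -> R)).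
  by apply: measurable_indic; exact: measurable_near_diag.
exact: measurable_pair1.
Qed.

(** Cauchy-Schwarz on a window of length [2 * r]. Since [h] is only integrable the right-hand side
    may be infinite, so the bound is obtained by integrating [2 c |h| <= |h|^2 + c^2] over the
    window rather than from the inner product of L2. *)
Lemma box_average_sqr_le (h : R -> R[i]) (r y : R) : 0 < r -> integrableC leb h ->
  ((normc (integralC leb (fun t => h t * box_kernel r (y, t))) ^+ 2)%:E <=
   (2 * r)%:E * \int[leb]_t ((normc (h t) ^+ 2) * \1_(near_diag r) ((y, t) : RR * RR))%:E)%E.
Proof.
move=> r0 ch; have mh := integrableC_mfunC ch.
have r20 : 0 < 2 * r by rewrite mulr_gt0.
have m1 := measurable_near_diag_indic r y.
pose ind (t : RR) : R := \1_(near_diag r) (y, t).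
have ind01 t : ind t = 0 \/ ind t = 1.
  by rewrite /ind indicE; case: (_ \in _); [right|left].
have ind0 t : 0 <= ind t by case: (ind01 t) => ->.
have nb t : normc (h t * box_kernel r (y, t)) = normc (h t) * ind t.
  by rewrite Normc.normcM normcR ger0_norm ?ind0.
have hb : integrableC leb (fun t => h t * box_kernel r (y, t)).
  apply: (@integrableC_le _ RR R leb _ (fun t => normc (h t))).
  - by apply: mfunCM => //; exact: mfunC_real.
  - exact: integrableC_normc.
  - by move=> t; rewrite nb; case: (ind01 t) => ->; rewrite ?mulr1 ?mulr0 ?normc_ge0.
pose A := \int[leb]_t (normc (h t) * ind t).
have hA : normc (integralC leb (fun t => h t * box_kernel r (y, t))) <= A.
  by apply: le_trans (normc_integralC hb) _; under eq_Rintegral do rewrite nb.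
have iA : (\int[leb]_t (normc (h t) * ind t)%:E = A%:E)%E.
  rewrite /A /Rintegral fineK//; apply: integrable_fin_num => //.
  by have := integrableC_normc hb; under [X in EFin \o X]eq_fun do rewrite nb.
have A0 : 0 <= A by apply: le_trans hA; exact: normc_ge0.
have mhi : measurable_fun setT (fun t : RR => normc (h t) * ind t).
  by apply: measurable_funM => //; exact: mfunC_normc.
have mh2i : measurable_fun setT (fun t : RR => normc (h t) ^+ 2 * ind t).
  by apply: measurable_funM => //; exact: measurable_sqr_normc.
set I := (\int[leb]_t _)%E.
have I0 : (0 <= I)%E by apply: integral_ge0 => t _; rewrite lee_fin mulr_ge0 ?sqr_ge0 ?ind0.
(* The mean of [|h|] over the window: the value of [c] that makes the integrated inequality
   sharpest. *)
pose c := A / (2 * r).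
have cE : A = c * (2 * r) by rewrite /c mulfVK// gt_eqF.
have c0 : 0 <= c by rewrite divr_ge0// ltW.
have c20 : 0 <= 2 * c by rewrite mulr_ge0.
have cc0 : 0 <= c ^+ 2 by rewrite sqr_ge0.
have key : ((2 * c)%:E * A%:E <= I + (c ^+ 2)%:E * (2 * r)%:E)%E.
  have mind : measurable_fun setT (fun t : RR => (ind t)%:E) by exact/measurable_EFinP.
  have e0 : (\int[leb]_t (ind t)%:E = (2 * r)%:E)%E.
    rewrite -(integral_near_diag y r0); apply: eq_integral => t _.
    by rewrite near_diag_sym.
  have e1 : (\int[leb]_t ((2 * c)%:E * (normc (h t) * ind t)%:E) = (2 * c)%:E * A%:E)%E.
    rewrite ge0_integralZl_EFin ?iA//; last exact/measurable_EFinP.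
    by move=> t _; rewrite lee_fin mulr_ge0 ?normc_ge0 ?ind0.
  have e2 : (\int[leb]_t ((c ^+ 2)%:E * (ind t)%:E) = (c ^+ 2)%:E * (2 * r)%:E)%E.
    by rewrite ge0_integralZl_EFin ?e0// => t _; rewrite lee_fin ind0.
  rewrite -e1 -e2.
  have n1 t : (0 <= (normc (h t) ^+ 2 * ind t)%:E)%E.
    by rewrite lee_fin mulr_ge0 ?sqr_ge0 ?ind0.
  have n2 t : (0 <= (c ^+ 2)%:E * (ind t)%:E)%E by rewrite -EFinM lee_fin mulr_ge0 ?ind0.
  have m2 : measurable_fun setT (fun t : RR => (c ^+ 2)%:E * (ind t)%:E)%E.
    exact: measurable_funeM.
  rewrite /I -ge0_integralD//; last exact/measurable_EFinP.
  apply: ge0_le_integral => //.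
  - by move=> t _; rewrite -EFinM lee_fin mulr_ge0// mulr_ge0 ?normc_ge0 ?ind0.
  - by apply: measurable_funeM; exact/measurable_EFinP.
  - by apply: emeasurable_funD => //; exact/measurable_EFinP.
  - move=> t _; rewrite -!EFinM -EFinD lee_fin -/(ind t).
    case: (ind01 t) => ->; rewrite ?mulr0 ?addr0// !mulr1.
    by have := sqr_ge0 (normc (h t) - c); rewrite sqrrB; lra.
apply: (@le_trans _ _ (A ^+ 2)%:E).
  by rewrite lee_fin ler_sqr ?nnegrE ?normc_ge0.
move: key I0; case: I => [x| |] //.
- rewrite -!EFinM -EFinD !lee_fin => key x0.
  move: key; rewrite cE => key.
  have -> : (c * (2 * r)) ^+ 2 = (2 * r) * (2 * c * (c * (2 * r)) - c ^+ 2 * (2 * r)) by ring.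
  by rewrite ler_pM2l//; lra.
- by move=> _ _; rewrite mulry gtr0_sg// mul1e leey.
Qed.

(** Each [t] lies in the windows of a set of centres [y] of measure [2 * r]. After division by
    [(2 * r) ^+ 2] the statement says that averaging is a contraction of L2. *)
Lemma integral_box_average_le (h : R -> R[i]) (r : R) : 0 < r -> integrableC leb h ->
  (\int[leb]_y (normc (integralC leb (fun t => h t * box_kernel r (y, t))) ^+ 2)%:E <=
   ((2 * r) ^+ 2)%:E * \int[leb]_t (normc (h t) ^+ 2)%:E)%E.
Proof.
move=> r0 ch; have mh := integrableC_mfunC ch.
have r20 : 0 <= 2 * r by rewrite mulr_ge0// ltW.
pose g (p : RR * RR) : R := normc (h p.2) ^+ 2 * \1_(near_diag r) p.
have g0 p : (0 <= (g p)%:E)%E by rewrite lee_fin mulr_ge0 ?sqr_ge0// indicE.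
have mh2 : measurable_fun setT (fun t : RR => normc (h t) ^+ 2) by exact: measurable_sqr_normc.
have mg : measurable_fun setT (EFin \o g).
  apply/measurable_EFinP; apply: measurable_funM.
    exact: (measurableT_comp (f := fun t : RR => normc (h t) ^+ 2) (g := snd)).
  by apply: measurable_indic; exact: measurable_near_diag.
have mG : measurable_fun setT (fun y : RR => \int[leb]_t (g (y, t))%:E)%E.
  exact: (measurable_fun_fubini_tonelli_F (m2 := leb) _ mg g0).
apply: (@le_trans _ _ (\int[leb]_y ((2 * r)%:E * \int[leb]_t (g (y, t))%:E))%E).
  apply: ge0_le_integral => //.
  - by move=> y _; rewrite lee_fin sqr_ge0.
  - apply/measurable_EFinP; apply: measurable_sqr_normc.
    apply: (mfunC_integralC_param leb (f := fun p : RR * RR =>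
      h p.2 * box_kernel r p)).
    by apply: mfunCM; [exact: (mfunC_comp measurable_snd mh)|exact: mfunC_box_kernel].
  - exact: measurable_funeM.
  - by move=> y _; exact: box_average_sqr_le.
rewrite ge0_integralZl_EFin//; last by move=> y _; exact: integral_ge0.
have -> : (((2 * r) ^+ 2)%:E = (2 * r)%:E * (2 * r)%:E)%E by rewrite -EFinM expr2.
rewrite -muleA; apply: lee_wpmul2l; first by rewrite lee_fin.
rewrite (@fubini_tonelli _ _ _ _ _ leb leb (EFin \o g))//.
rewrite -ge0_integralZl_EFin//; last 2 first.
- by move=> t _; rewrite lee_fin sqr_ge0.
- exact/measurable_EFinP.
rewrite le_eqVlt; apply/orP; left; apply/eqP; apply: eq_integral => t _.
rewrite /fubini_G /g /=; under eq_integral do rewrite EFinM.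
rewrite ge0_integralZl_EFin ?sqr_ge0//.
- by rewrite (integral_near_diag t r0) muleC.
- apply/measurable_EFinP; have := measurable_near_diag_indic r t.
  by under eq_fun do rewrite near_diag_sym.
Qed.

(** Normalising [smoothing_identity] gives [S], with weights [K n] on the frequencies and averages
    [B n] of [h]. Since [K n] tends to 1 and averaging contracts, Fatou gives one inequality; since
    [B n] tends to [h] almost everywhere and [K n <= 1], Fatou gives the other. *)
Lemma plancherel1 (h : R -> R[i]) : integrableC leb h ->
  (\int[leb]_w (normc (fourier1 h w) ^+ 2)%:E = \int[leb]_t (normc (h t) ^+ 2)%:E)%E.
Proof.
move=> ch; have mh := integrableC_mfunC ch.
have r2 n : 0 < 2 * rad n by rewrite mulr_gt0.
pose K n w := ((2 * rad n) ^+ 2)^-1 * fejer (2 * rad n) w.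
pose B n y := ((2 * rad n)^-1)%:C * integralC leb (fun t => h t * box_kernel (rad n) (y, t)).
have mF : measurable_funC (fourier1 h : RR -> _).
  apply: (mfunC_integralC_param leb (f := fun p : RR * RR =>
    cis (- (2 * pi * (p.1 * p.2))) * h p.2)).
  apply: mfunCM; last exact: (mfunC_comp measurable_snd mh).
  by apply: mfunC_cis; apply: measurable_funN; apply: measurable_funM => //; exact: measurable_funM.
have mB n : measurable_funC (B n : RR -> _).
  apply: mfunCZ; apply: (mfunC_integralC_param leb (f := fun p : RR * RR =>
    h p.2 * box_kernel (rad n) p)).
  by apply: mfunCM; [exact: (mfunC_comp measurable_snd mh)|exact: mfunC_box_kernel].
have mF2 : measurable_fun setT (fun w : RR => normc (fourier1 h w) ^+ 2).
  exact: measurable_sqr_normc.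
have K0 n w : 0 <= K n w by rewrite mulr_ge0 ?fejer_ge0// invr_ge0 sqr_ge0.
have mK n : measurable_fun setT (K n : RR -> R).
  by apply: measurable_funM => //; exact: measurable_fejer.
have S n : (\int[leb]_w (K n w * normc (fourier1 h w) ^+ 2)%:E =
            \int[leb]_y (normc (B n y) ^+ 2)%:E)%E.
  have c0 : 0 <= ((2 * rad n) ^+ 2)^-1 by rewrite invr_ge0 sqr_ge0.
  transitivity (((2 * rad n) ^+ 2)^-1%:E *
      \int[leb]_w (fejer (2 * rad n) w * normc (fourier1 h w) ^+ 2)%:E)%E.
    rewrite -ge0_integralZl_EFin//.
    - by apply: eq_integral => w _; rewrite /K -mulrA EFinM.
    - by move=> w _; rewrite lee_fin mulr_ge0 ?fejer_ge0 ?sqr_ge0.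
    - by apply/measurable_EFinP; apply: measurable_funM => //; exact: measurable_fejer.
  rewrite smoothing_identity// -ge0_integralZl_EFin//.
  - apply: eq_integral => y _; rewrite -EFinM /B Normc.normcM [in RHS]exprMn normcR.
    by rewrite real_normK ?num_real// exprVn.
  - by move=> w _; rewrite lee_fin sqr_ge0.
  - apply/measurable_EFinP; apply: measurable_sqr_normc.
    apply: (mfunC_integralC_param leb (f := fun p : RR * RR =>
      h p.2 * box_kernel (rad n) p)).
    by apply: mfunCM; [exact: (mfunC_comp measurable_snd mh)|exact: mfunC_box_kernel].
apply/eqP; rewrite eq_le; apply/andP; split.
- apply: (@fatou_cst _ RR R leb (fun n w => K n w * normc (fourier1 h w) ^+ 2)).
  + by move=> n; exact: measurable_funM.
  + exact: mF2.
  + by move=> n w; rewrite mulr_ge0 ?sqr_ge0.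
  (* At [w = 0] the weight is the default value 0 of [fejer] and does not tend to 1; one point is a
     null set. *)
  + exists [set 0]; split => //; first exact: lebesgue_measure_set1.
    move=> w /= wK; apply: contrapT => /eqP w0; apply: wK.
    rewrite -[X in _ --> X]mul1r; apply: cvgM; last exact: cvg_cst.
    have pi0 : (pi : R) != 0 by rewrite gt_eqF// pi_gt0.
    have -> : K ^~ w = (fun n => (sin (pi * (2 * rad n) * w) / (pi * (2 * rad n) * w)) ^+ 2).
      apply/funext => n; rewrite /K fejerE ?(gt_eqF (r2 n))//.
      by rewrite mulKf// expf_neq0// (gt_eqF (r2 n)).
    have hs := @cvg_sin_div _ (fun n => pi * (2 * rad n) * w).
    have {}hs : (fun n => sin (pi * (2 * rad n) * w) / (pi * (2 * rad n) * w)) @ \oo --> (1 : R).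
      apply: hs => [m|]; first by rewrite mulf_neq0// mulf_neq0// (gt_eqF (r2 m)).
      rewrite -(mul0r w) -(mulr0 pi) -{1}(mulr0 2).
      apply: cvgM; last exact: cvg_cst.
      apply: cvgM; first exact: cvg_cst.
      by apply: cvgM; [exact: cvg_cst|exact: cvg_harmonic].
    have h1 : (fun n => (sin (pi * (2 * rad n) * w) / (pi * (2 * rad n) * w)) ^+ 2) @ \oo -->
      (1 * 1 : R) by exact: (cvgM hs hs).
    by move: h1; rewrite mulr1.
  + move=> n; rewrite S.
    have c0 : 0 <= ((2 * rad n) ^+ 2)^-1 by rewrite invr_ge0 sqr_ge0.
    have mb : measurable_funC (fun y : RR => integralC leb (fun t => h t * box_kernel (rad n) (y, t))).
      apply: (mfunC_integralC_param leb (f := fun p : RR * RR => h p.2 * box_kernel (rad n) p)).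
      by apply: mfunCM; [exact: (mfunC_comp measurable_snd mh)|exact: mfunC_box_kernel].
    apply: (@le_trans _ _ (((2 * rad n) ^+ 2)^-1%:E * (((2 * rad n) ^+ 2)%:E *
        \int[leb]_t (normc (h t) ^+ 2)%:E))%E); last first.
      by rewrite muleA -EFinM mulVf ?mul1e// expf_neq0// (gt_eqF (r2 n)).
    apply: le_trans (lee_wpmul2l _ (integral_box_average_le (rad_gt0 n) ch)); last by rewrite lee_fin.
    rewrite -ge0_integralZl_EFin//.
    - rewrite le_eqVlt; apply/orP; left; apply/eqP; apply: eq_integral => y _.
      rewrite -EFinM /B Normc.normcM [in LHS]exprMn normcR.
      by rewrite real_normK ?num_real// exprVn.
    - by move=> w _; rewrite lee_fin sqr_ge0.
    - by apply/measurable_EFinP; exact: measurable_sqr_normc.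
- apply: (@fatou_cst _ RR R leb (fun n y => normc (B n y) ^+ 2)).
  + by move=> n; apply: measurable_sqr_normc.
  + exact: measurable_sqr_normc.
  + by move=> n y; rewrite sqr_ge0.
  + have [hR hI] := ch.
    apply: (@filterS2 _ _ (ae_filter_ringOfSetsType leb) _ _ _ _
      (ae_cvg_average hR) (ae_cvg_average hI)) => x cR cI.
    have -> : (fun n => normc (B n x) ^+ 2) = (fun n =>
      ((2 * rad n)^-1 * \int[leb]_y (Re (h y) * \1_[set z : RR | `|x - z| < rad n] y)) ^+ 2 +
      ((2 * rad n)^-1 * \int[leb]_y (Im (h y) * \1_[set z : RR | `|x - z| < rad n] y)) ^+ 2).
      apply/funext => n; rewrite sqr_normcE /B !RIE /= !mul0r subr0 addr0.
      by congr ((_ * _) ^+ 2 + (_ * _) ^+ 2); apply: eq_Rintegral => y _;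
        rewrite !RIE /= mulr0 ?subr0 ?add0r near_diag_indicE.
    rewrite sqr_normcE; apply: cvgD.
      exact: (cvgM cR cR).
    exact: (cvgM cI cI).
  + move=> n; rewrite -S; apply: ge0_le_integral => //.
    * by move=> w _; rewrite lee_fin mulr_ge0 ?sqr_ge0.
    * by apply/measurable_EFinP; exact: measurable_funM.
    * exact/measurable_EFinP.
    * move=> w _; rewrite lee_fin ler_piMl ?sqr_ge0// /K.
      by rewrite ler_pdivrMl ?exprn_gt0// mulr1 fejer_le// gt_eqF.
Qed.

End plancherel_line.

(** * Plancherel on R^d *)

Section plancherel.
Context {R : realType}.
Local Notation leb := (@lebesgue_measure R).
Local Notation RR := (measurableTypeR R).
Local Notation lebV := (@lebesgue_rV R).

Definition dotV n (u v : 'rV[R]_n) : R := \sum_i u ord0 i * v ord0 i.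

Lemma measurable_dotV n d (T : measurableType d) (f g : T -> 'rV[R]_n) :
  measurable_fun setT f -> measurable_fun setT g ->
  measurable_fun setT (fun x => dotV (f x) (g x)).
Proof.
move=> mf mg; apply: measurable_sum => i.
by apply: measurable_funM; exact: (measurableT_comp (measurable_coord_rV i)).
Qed.

Definition fourier n (h : 'rV[R]_n -> R[i]) (w : 'rV[R]_n) : R[i] :=
  integralC (lebV n) (fun t => cis (- (2 * pi * dotV w t)) * h t).

Definition prodV n : {sigma_finite_measure set (RR * 'rV[R]_n)%type -> \bar R} :=
  sigma_finite_prod leb (lebV n).

Lemma lebV_cons n (A : set 'rV[R]_n.+1) : measurable A ->
  prodV n (@rV_cons R n @^-1` A) = lebV n.+1 A.
Proof. by []. Qed.

Lemma rV_cons_head n (p : RR * 'rV[R]_n) : (rV_cons p : 'rV[R]_n.+1) ord0 ord0 = p.1.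
Proof.
transitivity ((rV_cons p) ord0 (lshift n (ord0 : 'I_1))).
  by congr (fun_of_matrix _ _ _); exact: val_inj.
by rewrite /rV_cons row_mxEl mxE eqxx mulr1n.
Qed.

Lemma rV_cons_tail n (p : RR * 'rV[R]_n) i :
  (rV_cons p : 'rV[R]_n.+1) ord0 (lift ord0 i) = p.2 ord0 i.
Proof.
transitivity ((rV_cons p) ord0 (rshift 1 i)).
  by congr (fun_of_matrix _ _ _); exact: val_inj.
by rewrite /rV_cons row_mxEr.
Qed.

Lemma dotV_cons n (p q : RR * 'rV[R]_n) :
  dotV (rV_cons p : 'rV[R]_n.+1) (rV_cons q : 'rV[R]_n.+1) = p.1 * q.1 + dotV p.2 q.2.
Proof.
rewrite /dotV big_ord_recl !rV_cons_head; congr (_ + _).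
by apply: eq_bigr => i _; rewrite !rV_cons_tail.
Qed.

Lemma mfunC_wave d (T : measurableType d) n (f g : T -> 'rV[R]_n) :
  measurable_fun setT f -> measurable_fun setT g ->
  measurable_funC (fun x => cis (- (2 * pi * dotV (f x) (g x)))).
Proof.
move=> mf mg; apply: mfunC_cis; apply: measurable_funN; apply: measurable_funM => //.
exact: measurable_dotV.
Qed.

Lemma mfunC_fourier n (h : 'rV[R]_n -> R[i]) : measurable_funC h ->
  measurable_funC (fourier h).
Proof.
move=> mh; apply: (mfunC_integralC_param (lebV n) (f := fun p : 'rV[R]_n * 'rV[R]_n =>
  cis (- (2 * pi * dotV p.1 p.2)) * h p.2)).
by apply: mfunCM; [exact: mfunC_wave|exact: (mfunC_comp measurable_snd mh)].
Qed.

Section step.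
Variable n : nat.
Hypothesis IH : forall h : 'rV[R]_n -> R[i], integrableC (lebV n) h ->
  (\int[lebV n]_w (normc (fourier h w) ^+ 2)%:E = \int[lebV n]_t (normc (h t) ^+ 2)%:E)%E.
Variable H : RR * 'rV[R]_n -> R[i].
Hypothesis cH : integrableC (prodV n) H.

Let mH : measurable_funC H := integrableC_mfunC cH.

Definition partial_fourier (p : RR * 'rV[R]_n) : R[i] :=
  fourier (fun t => H (p.1, t)) p.2.

Let mG : measurable_funC partial_fourier.
Proof.
apply: (mfunC_integralC_param (lebV n) (f := fun q : (RR * 'rV[R]_n) * 'rV[R]_n =>
  cis (- (2 * pi * dotV q.1.2 q.2)) * H (q.1.1, q.2))).
apply: mfunCM.
  by apply: mfunC_wave => //; exact: measurableT_comp.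
apply: (mfunC_comp (phi := fun q : (RR * 'rV[R]_n) * 'rV[R]_n => (q.1.1, q.2)) _ mH).
by apply: measurable_fun_pair => //; exact: measurableT_comp.
Qed.

Let cHw w : integrableC (prodV n) (fun p => cis (- (2 * pi * dotV w p.2)) * H p).
Proof.
apply: (@integrableC_le _ _ _ _ _ (fun t => normc (H t))).
- by apply: mfunCM => //; exact: mfunC_wave.
- exact: integrableC_normc.
- by move=> t; rewrite Normc.normcM normc_cis mul1r.
Qed.

Let cG w : integrableC leb (fun t => partial_fourier (t, w)).
Proof. exact: (integrableC_prod1 (cHw w)). Qed.

(** The induction hypothesis handles the last [n] coordinates for almost every head [t], and
    [plancherel1] handles the head for every [w]; Tonelli exchanges the two integrations. *)
Lemma plancherel_prod :
  (\int[prodV n]_p (normc (fourier1 (fun t => partial_fourier (t, p.2)) p.1) ^+ 2)%:E =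
   \int[prodV n]_p (normc (H p) ^+ 2)%:E)%E.
Proof.
have sq0 (z : R[i]) : (0 <= (normc z ^+ 2)%:E)%E by rewrite lee_fin sqr_ge0.
have mF : measurable_funC (fun p : RR * 'rV[R]_n =>
    fourier1 (fun t => partial_fourier (t, p.2)) p.1).
  apply: (mfunC_integralC_param leb (f := fun q : (RR * 'rV[R]_n) * RR =>
    cis (- (2 * pi * (q.1.1 * q.2))) * partial_fourier (q.2, q.1.2))).
  apply: mfunCM.
    apply: mfunC_cis; apply: measurable_funN; apply: measurable_funM => //.
    by apply: measurable_funM => //; exact: measurableT_comp.
  apply: (mfunC_comp (phi := fun q : (RR * 'rV[R]_n) * RR => (q.2, q.1.2)) _ mG).
  by apply: measurable_fun_pair => //; exact: measurableT_comp.
have mFE : measurable_fun setT (fun p : RR * 'rV[R]_n =>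
    (normc (fourier1 (fun t => partial_fourier (t, p.2)) p.1) ^+ 2)%:E).
  by apply/measurable_EFinP; exact: measurable_sqr_normc.
have mGE : measurable_fun setT (fun p => (normc (partial_fourier p) ^+ 2)%:E).
  by apply/measurable_EFinP; exact: measurable_sqr_normc.
have mHE : measurable_fun setT (fun p => (normc (H p) ^+ 2)%:E).
  by apply/measurable_EFinP; exact: measurable_sqr_normc.
apply: (etrans (@fubini_tonelli2 _ _ _ _ _ leb (lebV n) _ mFE (fun=> sq0 _))).
apply: (@etrans _ _ (\int[lebV n]_w \int[leb]_t (normc (partial_fourier (t, w)) ^+ 2)%:E)%E).
  by apply: eq_integral => w _; exact: (plancherel1 (cG w)).
apply: (etrans (esym (@fubini_tonelli _ _ _ _ _ leb (lebV n) _ mGE (fun=> sq0 _)))).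
apply: (etrans _ (esym (@fubini_tonelli1 _ _ _ _ _ leb (lebV n) _ mHE (fun=> sq0 _)))).
apply: ae_eq_integral => //.
- exact: (measurable_fun_fubini_tonelli_F (m2 := lebV n) _ mGE (fun=> sq0 _)).
- exact: (measurable_fun_fubini_tonelli_F (m2 := lebV n) _ mHE (fun=> sq0 _)).
- apply: (@filterS _ _ (ae_filter_ringOfSetsType leb) _ _ _ (ae_integrableC_prod1 cH)).
  by move=> t ct _; exact: (IH ct).
Qed.

(** Fubini and the factorisation of the wave. The head factor leaves the inner integral only where
    the slice of [H] is integrable, hence the comparison almost everywhere. *)
Lemma fourier_prod p :
  integralC (prodV n) (fun q => cis (- (2 * pi * (p.1 * q.1 + dotV p.2 q.2))) * H q) =
  fourier1 (fun t => partial_fourier (t, p.2)) p.1.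
Proof.
have cE (q : RR * 'rV[R]_n) : cis (- (2 * pi * (p.1 * q.1 + dotV p.2 q.2))) * H q =
    cis (- (2 * pi * (p.1 * q.1))) * (cis (- (2 * pi * dotV p.2 q.2)) * H q).
  by rewrite mulrDr opprD cisD [RHS]mulrA.
have cK : integrableC (prodV n)
    (fun q => cis (- (2 * pi * (p.1 * q.1 + dotV p.2 q.2))) * H q).
  apply: (@integrableC_le _ _ _ _ _ (fun t => normc (H t))).
  - apply: mfunCM => //; apply: mfunC_cis; apply: measurable_funN.
    apply: measurable_funM => //; apply: measurable_funD.
      exact: measurable_funM.
    by apply: measurable_dotV.
  - exact: integrableC_normc.
  - by move=> t; rewrite Normc.normcM normc_cis mul1r.
apply: (etrans (esym (integralC_prod1 cK))).
apply: ae_eq_integralC.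
- exact: integrableC_mfunC (integrableC_prod1 cK).
- apply: mfunCM; last exact: integrableC_mfunC (cG _).
  by apply: mfunC_cis; apply: measurable_funN; apply: measurable_funM.
- apply: (@filterS _ _ (ae_filter_ringOfSetsType leb) _ _ _ (ae_integrableC_prod1 (cHw p.2))).
  move=> t ct; rewrite /partial_fourier /fourier -integralCZ//.
  by apply: eq_integralC => t'; rewrite cE.
Qed.

End step.

Lemma integralC_dirac d (T : measurableType d) (a : T) (f : T -> R[i]) :
  measurable_funC f -> integralC (dirac a : {measure set T -> \bar R}) f = f a.
Proof.
move=> [fR fI]; apply: complex_eq; rewrite /= /Rintegral integral_dirac ?diracT ?mul1e//;
  exact/measurable_EFinP.
Qed.

Lemma plancherel n (h : 'rV[R]_n -> R[i]) : integrableC (lebV n) h ->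
  (\int[lebV n]_w (normc (fourier h w) ^+ 2)%:E = \int[lebV n]_t (normc (h t) ^+ 2)%:E)%E.
Proof.
elim: n => [|n IH] in h * => ch; have mh := integrableC_mfunC ch.
  (* In dimension 0 the measure is a unit mass at the only point, and the phase is an empty sum. *)
  have mF := mfunC_fourier mh.
  rewrite !integral_dirac//; try by apply/measurable_EFinP; exact: measurable_sqr_normc.
  congr (_ * (normc _ ^+ 2)%:E)%E.
  rewrite /fourier integralC_dirac; first by rewrite /dotV big_ord0 mulr0 oppr0 cis0 mul1r.
  by apply: mfunCM => //; exact: mfunC_wave.
pose H (p : RR * 'rV[R]_n) := h (rV_cons p).
have cH : integrableC (prodV n) H.
  exact: (integrableC_preserving (@measurable_rV_cons R n) (@lebV_cons n) ch).
have sq0 (z : R[i]) : (0 <= (normc z ^+ 2)%:E)%E by rewrite lee_fin sqr_ge0.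
apply: (etrans (esym (ge0_integral_preserving (@measurable_rV_cons R n) (@lebV_cons n)
  (f := fun w => (normc (fourier h w) ^+ 2)%:E) _ (fun=> sq0 _)))).
  by apply/measurable_EFinP; apply: measurable_sqr_normc; exact: mfunC_fourier.
apply: (etrans _ (ge0_integral_preserving (@measurable_rV_cons R n) (@lebV_cons n)
  (f := fun t => (normc (h t) ^+ 2)%:E) _ (fun=> sq0 _))); last first.
  by apply/measurable_EFinP; exact: measurable_sqr_normc.
rewrite -(plancherel_prod IH cH); apply: eq_integral => p _; congr (normc _ ^+ 2)%:E.
rewrite -fourier_prod// /fourier.
rewrite -(integralC_preserving (@measurable_rV_cons R n) (@lebV_cons n)); last first.
  by apply: mfunCM => //; exact: mfunC_wave.
by apply: eq_integralC => q; rewrite dotV_cons.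
Qed.

End plancherel.

(** * Translation invariance of Lebesgue measure *)

Section preserving_prod.
Context d1 d2 (T1 : measurableType d1) (T2 : measurableType d2) (R : realType).
Variable m1 : {sigma_finite_measure set T1 -> \bar R}.
Variable m2 : {sigma_finite_measure set T2 -> \bar R}.
Variables (f1 : T1 -> T1) (f2 : T2 -> T2).
Hypotheses (mf1 : measurable_fun setT f1)
  (f1E : forall A, measurable A -> m1 (f1 @^-1` A) = m1 A)
  (f2E : forall A, measurable A -> m2 (f2 @^-1` A) = m2 A).

(** The product measure integrates the measures of the sections: [f2] preserves the measure of each
    section, and [f1] preserves the integral over the first coordinate. *)
Lemma preserving_prod (A : set (T1 * T2)) : measurable A ->
  (m1 \x m2)%E ((fun p => (f1 p.1, f2 p.2)) @^-1` A) = (m1 \x m2)%E A.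
Proof.
move=> mA; rewrite /product_measure1.
rewrite -(ge0_integral_preserving mf1 f1E (f := m2 \o xsection A)) //.
- apply: eq_integral => x _ /=.
  rewrite -[RHS]f2E; last exact: measurable_xsection.
  by congr (m2 _); apply/seteqP; split => y; rewrite /xsection /= !inE.
- exact: measurable_fun_xsection.
Qed.

End preserving_prod.

Section translation.
Context {R : realType}.
Local Notation leb := (@lebesgue_measure R).
Local Notation RR := (measurableTypeR R).
Local Notation lebV := (@lebesgue_rV R).

Lemma measurable_translation1 (a : R) : measurable_fun setT (fun t : RR => t - a : RR).
Proof. exact: measurable_funB. Qed.

(** The pushforward agrees with Lebesgue measure on half-open intervals, which determine it. *)
Lemma lebesgue_measure_translation (a : R) (A : set RR) : measurable A ->
  leb ((fun t : RR => t - a : RR) @^-1` A) = leb A.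
Proof.
move=> mA; pose nu : {measure set RR -> \bar R} :=
  measure_function_pushforward__canonical__measure_function_Measure leb
    (measurable_translation1 a).
apply/esym; apply: (@lebesgue_measure_unique R nu) => // _ [[b c] _ <-].
rewrite /nu /= /pushforward.
rewrite (_ : (fun t : RR => t - a) @^-1` `]b, c]%classic = `]b + a, c + a]%classic); last first.
  by apply/seteqP; split => t /=; rewrite !in_itv /= ltrBrDr lerBlDr.
rewrite !lebesgue_measure_itv /= !lte_fin ltrD2r.
by case: ifP => // _; congr EFin; ring.
Qed.

Lemma rV_unconsK n : cancel (@rV_uncons R n) (@rV_cons R n).
Proof.
move=> v; rewrite /rV_cons /rV_uncons /= -[RHS](@hsubmxK _ 1 1 n); congr row_mx.
by apply/matrixP => i j; rewrite !ord1 !mxE eqxx mulr1n.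
Qed.

Lemma measurable_translation n (a : 'rV[R]_n) : measurable_fun setT (fun t : 'rV[R]_n => t - a).
Proof.
apply: measurable_fun_rV => i; under eq_fun do rewrite !mxE.
by apply: measurable_funB => //; exact: measurable_coord_rV.
Qed.

Lemma lebV_translation n (a : 'rV[R]_n) (A : set 'rV[R]_n) : measurable A ->
  lebV n ((fun t => t - a) @^-1` A) = lebV n A.
Proof.
elim: n => [|n IH] in a A *.
  (* In dimension 0 there is a single row vector, so every translation is the identity. *)
  move=> _; congr (lebV 0 _); apply/seteqP; split => t /=;
    by rewrite (_ : t - a = t)//; apply/matrixP => i [].
move=> mA; have mA' : measurable (@rV_cons R n @^-1` A).
  by rewrite -[X in measurable X]setTI; exact: measurable_rV_cons.
rewrite -[LHS]/(prodV n (@rV_cons R n @^-1` ((fun t => t - a) @^-1` A))).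
rewrite -[RHS]/(prodV n (@rV_cons R n @^-1` A)).
have [b ->] : exists b, a = rV_cons b by exists (rV_uncons (a : 'rV[R]_(1 + n))); rewrite rV_unconsK.
have E (p : RR * 'rV[R]_n) :
    rV_cons ((p.1 - b.1 : RR), p.2 - b.2) = rV_cons p - rV_cons b.
  have subE (u v : 'rV[R]_(1 + n)) i j : (u - v) i j = u i j - v i j by rewrite !mxE.
  apply/matrixP => i j; rewrite !ord1 subE /rV_cons; case: (split_ordP j) => k ->.
    by rewrite !row_mxEl !mxE !ord1 !eqxx !mulr1n.
  by rewrite !row_mxEr !mxE.
rewrite (_ : @rV_cons R n @^-1` ((fun t => t - rV_cons b) @^-1` A) =
  (fun p : RR * 'rV[R]_n => ((p.1 - b.1 : RR), p.2 - b.2)) @^-1` (@rV_cons R n @^-1` A)).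
  exact: (preserving_prod (m1 := leb) (m2 := lebV n)
    (measurable_translation1 b.1) (lebesgue_measure_translation b.1) (IH b.2) mA').
by apply/seteqP; split => p /=; rewrite E.
Qed.

Lemma phase_translation d (z : phase R d) (A : set (phase R d)) : measurable A ->
  phase_measure R d ((fun w => w - z) @^-1` A) = phase_measure R d A.
Proof.
move=> mA; exact: (preserving_prod (m1 := lebV d) (m2 := lebV d)
  (measurable_translation z.1) (@lebV_translation d z.1) (@lebV_translation d z.2) mA).
Qed.

Lemma measurable_phase_translation d (z : phase R d) :
  measurable_fun setT (fun w : phase R d => w - z).
Proof.
apply: measurable_fun_pair.
  exact: (measurableT_comp (measurable_translation z.1)).
exact: (measurableT_comp (measurable_translation z.2)).
Qed.

End translation.

(** * Time-frequency shifts and the Moyal identity *)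

(** [linear] is used as a bare predicate about [a *: u + v]. Taking the scalar [a - 1] and [v = u]
    gives homogeneity without a detour through [A 0 = 0]. *)
Lemma linear_scale (K : pzRingType) (U V : lmodType K) (A : U -> V) : linear A ->
  forall a u, A (a *: u) = a *: A u.
Proof.
move=> lA a u; have := lA (a - 1) u u; rewrite -[X in _ + X]scale1r -scalerDl subrK => ->.
by rewrite -[X in _ + X]scale1r -scalerDl subrK.
Qed.

Section shifts.
Context {R : realType} (d : nat).
Local Notation lebV := (@lebesgue_rV R).
Local Notation H := (L2 (lebV d)).
Local Notation dot := (@dotL2 _ _ R (lebV d)).
Local Notation phase := (phase R d).
Implicit Types (u v psi phi g : H) (z w : phase).

Let dS : sesquilinear dot := (dotL2_pos (lebV d)).1.

Definition tfs_fun z (f : 'rV[R]_d -> R[i]) t : R[i] :=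
  cis (2 * pi * dotV z.2 t) * f (t - z.1).

Lemma dotVN n (x y : 'rV[R]_n) : dotV (- x) y = - dotV x y.
Proof. by rewrite /dotV -sumrN; apply: eq_bigr => i _; rewrite mxE mulNr. Qed.

Lemma dotVDl n (x y t : 'rV[R]_n) : dotV (x + y) t = dotV x t + dotV y t.
Proof. by rewrite /dotV -big_split; apply: eq_bigr => i _; rewrite mxE mulrDl. Qed.

Lemma dotVBr n (x y t : 'rV[R]_n) : dotV x (y - t) = dotV x y - dotV x t.
Proof. by rewrite /dotV -sumrB; apply: eq_bigr => i _; rewrite !mxE mulrBr. Qed.

Lemma dotV0 n (t : 'rV[R]_n) : dotV 0 t = 0.
Proof. by rewrite /dotV big1// => i _; rewrite mxE mul0r. Qed.

Lemma mfunC_tfs_fun z f : measurable_funC f -> measurable_funC (tfs_fun z f).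
Proof.
move=> mf; apply: mfunCM.
  by apply: mfunC_cis; apply: measurable_funM => //; exact: measurable_dotV.
exact: (mfunC_comp (measurable_translation z.1) mf).
Qed.

Lemma normc_tfs_fun z f t : normc (tfs_fun z f t) = normc (f (t - z.1)).
Proof. by rewrite Normc.normcM normc_cis mul1r. Qed.

Lemma tfs_fun_sqint z f : f \in sqint (lebV d) -> tfs_fun z f \in sqint (lebV d).
Proof.
move=> /sqintP[mf fy]; apply/sqintP; split; first exact: mfunC_tfs_fun.
under eq_integral do rewrite normc_tfs_fun.
rewrite (ge0_integral_preserving (measurable_translation z.1)
  (@lebV_translation _ d z.1) (f := fun t => (normc (f t) ^+ 2)%:E))//.
- by apply/measurable_EFinP; exact: measurable_sqr_normc.
- by move=> t; rewrite lee_fin sqr_ge0.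
Qed.

Lemma tfsE z psi : {ae lebV d, forall t,
  L2_repr (time_frequency_shift z psi) t = tfs_fun z (L2_repr psi) t}.
Proof.
have := L2_classE (tfs_fun_sqint z (L2_repr_sqint psi)).
exact.
Qed.

Lemma ae_translation (x : 'rV[R]_d) (P : 'rV[R]_d -> Prop) :
  {ae lebV d, forall t, P t} -> {ae lebV d, forall t, P (t - x)}.
Proof. exact: (ae_preserving (measurable_translation x) (@lebV_translation _ d x)). Qed.

Lemma tfs_linear z : linear (time_frequency_shift z : H -> H).
Proof.
move=> a u v; apply: L2_repr_inj.
have h1 := ae_translation z.1 (L2_repr_lin a u v).
have h2 := L2_repr_lin a (time_frequency_shift z u) (time_frequency_shift z v).
apply: filterS2 (tfsE z (a *: u + v)) (filterI (filterI h1 h2) (filterI (tfsE z u) (tfsE z v))).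
move=> t -> [[e1 ->] [-> ->]]; rewrite /tfs_fun e1; ring.
Qed.

(** The phase appears because the outer shift translates the argument of the inner wave: the pairing
    of [w.2] with [t - z.1] splits into its pairing with [t] and a constant. *)
Lemma tfs_comp z w psi : time_frequency_shift z (time_frequency_shift w psi) =
  cis (- (2 * pi * dotV w.2 z.1)) *: time_frequency_shift (z + w) psi.
Proof.
apply: L2_repr_inj.
have h1 := ae_translation z.1 (tfsE w psi).
have h2 := L2_repr_lin (cis (- (2 * pi * dotV w.2 z.1))) (time_frequency_shift (z + w) psi) 0.
rewrite addr0 in h2.
apply: filterS2 (tfsE z (time_frequency_shift w psi))
  (filterI (filterI h1 h2) (filterI (tfsE (z + w) psi) (L2_repr0 (lebV d)))).
move=> t -> [[e1 ->] [-> ->]]; rewrite /tfs_fun e1 addr0 /tfs_fun !mulrA -!cisD.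
congr (cis _ * L2_repr psi _); last by rewrite opprD addrA.
by rewrite dotVBr dotVDl; ring.
Qed.

Lemma tfs0 psi : time_frequency_shift 0 psi = psi.
Proof.
apply: L2_repr_inj; apply: filterS (tfsE 0 psi) => t ->.
by rewrite /tfs_fun /= dotV0 mulr0 cis0 mul1r subr0.
Qed.

Lemma dot_tfs z u v : dot (time_frequency_shift z u) (time_frequency_shift z v) = dot u v.
Proof.
rewrite (dotL2_ae _ _ (tfsE z u) (tfsE z v)); try by apply: mfunC_tfs_fun.
rewrite /dotL2 -[RHS](integralC_preserving (measurable_translation z.1)
  (@lebV_translation _ d z.1)); last first.
  by apply: mfunCM => //; apply: mfunC_conj.
apply: eq_integralC => t; rewrite /tfs_fun.
have : cis (2 * pi * dotV z.2 t) * conjc (cis (2 * pi * dotV z.2 t)) = 1 :> R[i].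
  by rewrite conj_cis -cisD subrr cis0.
move: (cis _) (L2_repr u _) (L2_repr v _) => c x y cc.
transitivity ((c * conjc c) * (x * conjc y)); last by rewrite cc mul1r.
by apply: complex_eq; rewrite !RIE; ring.
Qed.

(** The factor cancels the phase that [tfs_comp] produces for [z] and [- z]. This is [pi(z)^*], by
    [adjoint_tfs]. *)
Definition tfs_inv z psi : H :=
  cis (- (2 * pi * dotV z.2 z.1)) *: time_frequency_shift (- z) psi.

Lemma tfs_invK z psi : time_frequency_shift z (tfs_inv z psi) = psi.
Proof.
rewrite /tfs_inv.
rewrite (linear_scale (tfs_linear z)).
rewrite tfs_comp subrr tfs0 scalerA -cisD /= dotVN.
by rewrite (_ : _ + _ = 0) ?cis0 ?scale1r//; ring.
Qed.

(** [adjoint] is obtained by choice; nondegeneracy of the inner product identifies it with any known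
    adjoint. *)
Lemma adjoint_unique (A B : H -> H) : is_adjoint A B -> adjoint A = B.
Proof.
move=> AB; have AA : is_adjoint A (adjoint A).
  by apply: xgetPex; exists B.
apply/funext => v; apply: dotL2_eq => u.
by rewrite (dotL2_conj u) (dotL2_conj u (B v)) -AA AB.
Qed.

Lemma adjoint_tfs z : adjoint (time_frequency_shift z) = tfs_inv z.
Proof.
by apply: adjoint_unique => u v; rewrite -{1}(tfs_invK z v) dot_tfs.
Qed.

Lemma dot_shift_operator z (A : H -> H) psi phi :
  dot (shift_operator z A psi) phi = dot (A (tfs_inv z psi)) (tfs_inv z phi).
Proof. by rewrite /shift_operator /= adjoint_tfs -{1}(tfs_invK z phi) dot_tfs. Qed.

Lemma tfs_inv_linear z : linear (tfs_inv z).
Proof.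
move=> a u v; rewrite /tfs_inv (tfs_linear (- z) a u v) scalerDr !scalerA.
by rewrite mulrC.
Qed.

Lemma dot_tfs_inv z psi g : dot (tfs_inv z psi) g = dot psi (time_frequency_shift z g).
Proof. by rewrite -{2}(tfs_invK z psi) dot_tfs. Qed.

(** The value of [c] is left unspecified because only its modulus matters: it meets its conjugate in
    [shifted_form_tfs_inv]. *)
Lemma tfs_inv_comp z w : exists2 c : R[i], normc c = 1 &
  forall psi, tfs_inv w (tfs_inv z psi) = c *: tfs_inv (z + w) psi.
Proof.
pose a := cis (2 * pi * dotV (z + w).2 (z + w).1) : R[i].
pose b := cis (- (2 * pi * dotV (- z).2 (- w).1)) : R[i].
pose c1 := cis (- (2 * pi * dotV z.2 z.1)) : R[i].
pose c2 := cis (- (2 * pi * dotV w.2 w.1)) : R[i].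
exists (c2 * c1 * b * a).
  by rewrite !Normc.normcM !normc_cis !mulr1.
move=> psi; rewrite /tfs_inv -/c1 -/c2.
rewrite (linear_scale (tfs_linear (- w))) tfs_comp -/b !scalerA.
have -> : c2 * c1 * b * a * cis (- (2 * pi * dotV (z + w).2 (z + w).1)) = c2 * (c1 * b).
  by rewrite -[LHS]mulrA /a -cisD subrr cis0 mulr1 mulrA.
have -> : - w - z = - (z + w) :> phase by rewrite opprD addrC.
by rewrite mulrA.
Qed.

End shifts.

Section moyal.
Context {R : realType} (d : nat).
Local Notation lebV := (@lebesgue_rV R).
Local Notation H := (L2 (lebV d)).
Local Notation dot := (@dotL2 _ _ R (lebV d)).
Local Notation phase := (phase R d).
Local Notation muP := (phase_measure R d).
Implicit Types (u v psi phi g : H) (z w : phase).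

Let dS : sesquilinear dot := (dotL2_pos (lebV d)).1.

Definition correlation psi g (x t : 'rV[R]_d) : R[i] :=
  L2_repr psi t * conjc (L2_repr g (t - x)).

Lemma dot_tfsE psi g z :
  dot psi (time_frequency_shift z g) = fourier (correlation psi g z.1) z.2.
Proof.
have ae0 : {ae lebV d, forall t, L2_repr psi t = L2_repr psi t} by apply: aeW.
rewrite (dotL2_ae _ _ ae0 (tfsE z g)) => //; last by apply: mfunC_tfs_fun.
apply: eq_integralC => t; rewrite /correlation /tfs_fun -conj_cis.
by apply: complex_eq; rewrite !RIE; ring.
Qed.

Lemma integrableC_correlation psi g x : integrableC (lebV d) (correlation psi g x).
Proof.
have : tfs_fun (x, 0) (L2_repr g) \in sqint (lebV d).
  by apply: tfs_fun_sqint; exact: L2_repr_sqint.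
rewrite (_ : tfs_fun _ _ = (fun t => L2_repr g (t - x))); last first.
  by apply/funext => t; rewrite /tfs_fun /= dotV0 mulr0 cis0 mul1r.
by apply: sqint_mulr_conj; exact: L2_repr_sqint.
Qed.

Lemma measurable_rVB d' (T : measurableType d') (f g : T -> 'rV[R]_d) :
  measurable_fun setT f -> measurable_fun setT g ->
  measurable_fun setT (fun x => f x - g x).
Proof.
move=> mf mg; apply: measurable_fun_rV => i; under eq_fun do rewrite !mxE.
by apply: measurable_funB; exact: (measurableT_comp (measurable_coord_rV i)).
Qed.

Lemma measurable_rVN d' (T : measurableType d') (f : T -> 'rV[R]_d) :
  measurable_fun setT f -> measurable_fun setT (fun x => - f x).
Proof.
move=> mf; apply: measurable_fun_rV => i; under eq_fun do rewrite !mxE.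
by apply: measurable_funN; exact: (measurableT_comp (measurable_coord_rV i)).
Qed.

Lemma mfunC_tfs psi g : measurable_funC (fun z : phase => dot psi (time_frequency_shift z g)).
Proof.
under [X in measurable_funC X]eq_fun do rewrite dot_tfsE.
apply: (mfunC_integralC_param (lebV d) (f := fun q : ('rV[R]_d * 'rV[R]_d) * 'rV[R]_d =>
  cis (- (2 * pi * dotV q.1.2 q.2)) * (L2_repr psi q.2 * conjc (L2_repr g (q.2 - q.1.1))))).
apply: mfunCM; first by apply: mfunC_wave => //; exact: measurableT_comp.
apply: mfunCM; first exact: (mfunC_comp measurable_snd (L2_repr_mfun psi)).
apply: mfunC_conj; apply: (mfunC_comp (phi := fun q : ('rV[R]_d * 'rV[R]_d) * 'rV[R]_d =>
  q.2 - q.1.1) _ (L2_repr_mfun g)).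
by apply: measurable_rVB => //; exact: measurableT_comp.
Qed.

Lemma moyal psi g :
  (\int[muP]_z (normc (dot psi (time_frequency_shift z g)) ^+ 2)%:E = (sqn psi * sqn g)%:E)%E.
Proof.
pose a t := normc (L2_repr psi t) ^+ 2; pose b t := normc (L2_repr g t) ^+ 2.
have a0 t : 0 <= a t by rewrite sqr_ge0.
have b0 t : 0 <= b t by rewrite sqr_ge0.
have ma : measurable_fun setT a by exact: measurable_sqr_normc.
have mb : measurable_fun setT b by exact: measurable_sqr_normc.
have mV : measurable_fun setT (fun z : 'rV[R]_d * 'rV[R]_d =>
    (normc (dot psi (time_frequency_shift z g)) ^+ 2)%:E).
  by apply/measurable_EFinP; apply: measurable_sqr_normc; exact: mfunC_tfs.
have mD : measurable_fun setT (fun p : 'rV[R]_d * 'rV[R]_d => p.2 - (- p.1)).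
  by apply: measurable_rVB => //; exact: measurable_rVN.
have mab : measurable_fun setT (fun p : 'rV[R]_d * 'rV[R]_d => (a (p.2 - (- p.1)) * b p.2)%:E).
  apply/measurable_EFinP; apply: measurable_funM; first exact: (measurableT_comp ma mD).
  exact: (measurableT_comp mb).
have ab0 (p : 'rV[R]_d * 'rV[R]_d) : (0 <= (a (p.2 - (- p.1)) * b p.2)%:E)%E.
  by rewrite lee_fin mulr_ge0.
apply: (etrans (@fubini_tonelli1 _ _ _ _ _ (lebV d) (lebV d) _ mV _)).
  by move=> z; rewrite lee_fin sqr_ge0.
(* Translating [t] by [x] moves [x] from [b] to [a]. After Tonelli, the integral in [x] for fixed
   [t] is then a translate of the integral of [a], and no reflection is involved. *)
apply: (@etrans _ _ (\int[lebV d]_x \int[lebV d]_t (a (t - (- x)) * b t)%:E)%E).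
  apply: eq_integral => x _; rewrite /fubini_F.
  under eq_integral do rewrite dot_tfsE /=.
  rewrite plancherel; last exact: integrableC_correlation.
  rewrite -[RHS](ge0_integral_preserving (measurable_translation x) (@lebV_translation _ d x)
    (f := fun t => (a (t - (- x)) * b t)%:E)).
  - apply: eq_integral => t _; rewrite /correlation Normc.normcM normc_conj exprMn.
    by rewrite opprK subrK.
  - apply/measurable_EFinP; apply: measurable_funM => //.
    exact: (measurableT_comp ma (measurable_translation (- x))).
  - by move=> t; rewrite lee_fin mulr_ge0.
apply: (etrans (@fubini_tonelli _ _ _ _ _ (lebV d) (lebV d) _ mab ab0)).
rewrite /fubini_G /=.
have bE : (\int[lebV d]_t (b t)%:E = (sqn g)%:E)%E by exact: integral_sqn.
have aE : (\int[lebV d]_t (a t)%:E = (sqn psi)%:E)%E by exact: integral_sqn.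
rewrite EFinM -bE -ge0_integralZl_EFin ?sqn_ge0//; last 2 first.
- by move=> t _; rewrite lee_fin.
- exact/measurable_EFinP.
apply: eq_integral => t _; under eq_integral do rewrite mulrC EFinM.
rewrite ge0_integralZl_EFin//; last 2 first.
- by move=> x _; rewrite lee_fin.
- apply/measurable_EFinP.
  by apply: (measurableT_comp ma); apply: measurable_rVB => //; apply: measurable_rVN.
rewrite muleC; congr (_ * _)%E; rewrite -aE.
rewrite -[RHS](ge0_integral_preserving (measurable_translation (- t)) (@lebV_translation _ d (- t))
    (f := fun x => (a x)%:E)).
- by apply: eq_integral => x _; rewrite !opprK addrC.
- exact/measurable_EFinP.
- by move=> x; rewrite lee_fin.
Qed.

Lemma tfs_sqint psi g : (fun z : phase => dot psi (time_frequency_shift z g)) \in sqint muP.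
Proof. by apply/sqintP; split; [exact: mfunC_tfs|rewrite moyal ltry]. Qed.

Lemma integrableC_tfs psi u v : integrableC muP
  (fun z => dot (tfs_inv z psi) u * conjc (dot (tfs_inv z psi) v)).
Proof.
rewrite (_ : (fun _ => _) = (fun z => dot psi (time_frequency_shift z u) *
  conjc (dot psi (time_frequency_shift z v)))); last first.
  by apply/funext => z; rewrite !dot_tfs_inv.
by apply: sqint_mulr_conj; exact: tfs_sqint.
Qed.

(** Both sides are sesquilinear in [(v, u)] and agree on the diagonal by [moyal], so polarisation
    applies. For [u] and [v] in an orthonormal basis this is an orthogonality relation. *)
Lemma moyal_cross psi u v : integralC muP
  (fun z => dot (tfs_inv z psi) u * conjc (dot (tfs_inv z psi) v)) = (sqn psi)%:C * dot v u.
Proof.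
pose Q v u : R[i] := integralC muP (fun z => dot (tfs_inv z psi) u * conjc (dot (tfs_inv z psi) v)).
pose P v u : R[i] := (sqn psi)%:C * dot v u.
have sQ : sesquilinear Q.
  have I := @integrableC_tfs psi.
  split => [a x y w|a x y w]; rewrite /Q.
    apply: (@etrans _ _ (integralC muP (fun z =>
        a * (dot (tfs_inv z psi) w * conjc (dot (tfs_inv z psi) x)) +
        dot (tfs_inv z psi) w * conjc (dot (tfs_inv z psi) y)))).
      apply: eq_integralC => z; rewrite dS.2.
      move: (dot _ w) (dot _ x) (dot _ y) => A B C.
      by apply: complex_eq; rewrite !RIE; ring.
    by rewrite integralCD ?integralCZ//; exact: integrableCZ.
  apply: (@etrans _ _ (integralC muP (fun z =>
      conjc a * (dot (tfs_inv z psi) y * conjc (dot (tfs_inv z psi) x)) +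
      dot (tfs_inv z psi) w * conjc (dot (tfs_inv z psi) x)))).
    apply: eq_integralC => z; rewrite dS.2.
    by move: (dot _ w) (dot _ x) (dot _ y) => A B C; ring.
  by rewrite integralCD ?integralCZ//; exact: integrableCZ.
have sP : sesquilinear P.
  split => [a x y w|a x y w]; rewrite /P; first by rewrite dS.1; ring.
  by rewrite dS.2; ring.
have QP x : Q x x = P x x.
  rewrite /Q /P (qfE (dotL2_pos (lebV d))) -rmorphM.
  rewrite -[LHS]/(integralC muP _).
  under eq_integralC do rewrite mulr_conjc.
  rewrite integralC_real /Rintegral; congr (_%:C).
  under eq_integral do rewrite dot_tfs_inv.
  by rewrite moyal.
by rewrite -/(Q v u) (polarization sQ) !QP -(polarization sP).
Qed.

End moyal.

(** * The trace formula *)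

Section complex_convergence.
Context {R : realType}.
Implicit Types (u : nat -> R[i]) (l : R[i]).

Lemma normrCE (z : R[i]) : `|z| = (normc z)%:C. Proof. by []. Qed.

Lemma cvgC_Re u l : (u : nat -> R[i]^o) @ \oo --> (l : R[i]^o) ->
  (fun n => Re (u n)) @ \oo --> Re l.
Proof.
move=> ul; apply/cvgrPdist_lt => e e0.
have e0C : (0 : R[i]) < e%:C by rewrite ltcR.
have /cvgrPdist_lt/(_ _ e0C) := ul.
apply: filterS => n; rewrite normrCE ltcR; apply: le_lt_trans.
by rewrite -ReN -ReD; exact: normr_Re_le.
Qed.

Lemma cvgC_ReIm u l : (fun n => Re (u n)) @ \oo --> Re l ->
  (fun n => Im (u n)) @ \oo --> Im l -> (u : nat -> R[i]^o) @ \oo --> (l : R[i]^o).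
Proof.
move=> uR uI; apply/cvgrPdist_lt => e e0.
(* The scalars of [R[i]^o] are complex, and so is [e]; the order forces a positive [e] to be
   real. *)
have [r0 eE] : 0 < Re e /\ e = (Re e)%:C.
  move: e0; rewrite ltcE /= => /andP[/eqP i0 ->]; split => //.
  by apply: complex_eq.
have r20 : 0 < Re e / 2 by rewrite divr_gt0.
have /cvgrPdist_lt/(_ _ r20) h1 := uR.
have /cvgrPdist_lt/(_ _ r20) h2 := uI.
apply: filterS2 h1 h2 => n hR hI; rewrite normrCE eE ltcR.
apply: le_lt_trans (normc_le_ReIm _) _; rewrite !RIE; lra.
Qed.

End complex_convergence.

Section form_limits.
Context d (T : measurableType d) (R : realType).
Variable mu : {measure set T -> \bar R}.
Local Notation H := (L2 mu).
Variables (B : H -> H -> R[i]) (K : R).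
Hypotheses (pB : positive_form B) (K0 : 0 <= K) (BK : forall u, qf B u <= K * sqn u).

(** Cauchy-Schwarz for [B] itself bounds the cross term in the expansion of [qf B (y - (y - x n))],
    and [BK] makes both errors small. *)
Lemma qf_cvg (x : nat -> H) (y : H) :
  (forall eps : R, 0 < eps -> exists N, forall n, (N <= n)%N -> sqn (y - x n) <= eps) ->
  (fun n => qf B (x n)) @ \oo --> qf B y.
Proof.
move=> xy; pose s n := sqn (y - x n).
have s0 : s @ \oo --> (0 : R).
  apply/cvgrPdist_le => e e0; have [N NP] := xy e e0.
  exists N => // n /= Nn; rewrite sub0r normrN ger0_norm ?sqn_ge0//; exact: NP.
pose b n := 2 * Num.sqrt (qf B y * (K * s n)) + K * s n.
have b0 : b @ \oo --> (0 : R).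
  have Ks : (fun n => K * s n) @ \oo --> (0 : R).
    by rewrite -(mulr0 K); apply: cvgM => //; exact: cvg_cst.
  rewrite -(addr0 0) -{1}(mulr0 2); apply: cvgD => //; apply: cvgM; first exact: cvg_cst.
  have qs : (fun n => qf B y * (K * s n)) @ \oo --> (0 : R).
    by rewrite -(mulr0 (qf B y)); apply: cvgM => //; exact: cvg_cst.
  have := cvg_comp _ (@Num.sqrt R) qs (@sqrt_continuous R 0).
  by rewrite sqrtr0.
have h n : `|qf B y - qf B (x n)| <= b n.
  have dE : x n = y - (y - x n) by rewrite subKr.
  have sn : 0 <= K * s n by rewrite mulr_ge0// sqn_ge0.
  rewrite {1}dE qfB//.
  have q1 : qf B (y - x n) <= K * s n by exact: BK.
  have q0 : 0 <= qf B (y - x n) by exact: qf_ge0.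
  have cs : `|Re (B y (y - x n))| <= Num.sqrt (qf B y * (K * s n)).
    rewrite -(@ler_pXn2r _ 2) ?nnegrE ?sqrtr_ge0// sqr_sqrtr ?mulr_ge0 ?qf_ge0//.
    apply: (@le_trans _ _ (normc (B y (y - x n)) ^+ 2)).
      by rewrite ler_sqr ?nnegrE ?normc_ge0 ?normr_Re_le.
    apply: (le_trans (cauchy_schwarz pB _ _)).
    by apply: ler_wpM2l => //; exact: qf_ge0.
  rewrite /b; move: cs; rewrite ler_norml => /andP[c1 c2].
  by rewrite ler_norml; apply/andP; split; lra.
apply/cvgrPdist_le => e e0; have /cvgrPdist_le/(_ _ e0) := b0.
apply: filterS => n; rewrite sub0r normrN => be; apply: (le_trans (h n)).
exact: le_trans (ler_norm _) be.
Qed.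

End form_limits.

Section trace_formula.
Context {R : realType} (d : nat).
Local Notation lebV := (@lebesgue_rV R).
Local Notation H := (L2 (lebV d)).
Local Notation dot := (@dotL2 _ _ R (lebV d)).
Local Notation phase := (phase R d).
Local Notation muP := (phase_measure R d).
Variables (S : H -> H) (e : nat -> H).
Hypotheses (bS : bounded_operator S) (pS : positive_operator S) (eB : orthonormal_basis e).
Hypothesis tS : (fun n => \sum_(0 <= i < n) Re (dot (S (e i)) (e i))) @ \oo --> (1 : R).

Let dS : sesquilinear dot := (dotL2_pos (lebV d)).1.

Definition op_form (A : H -> H) u v : R[i] := dot (A u) v.

Lemma op_form_pos (A : H -> H) : linear A -> positive_operator A -> positive_form (op_form A).
Proof.
move=> lA pA; split => //; split => [a u v w|a u v w]; rewrite /op_form.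
  by rewrite lA dS.1.
by rewrite dS.2.
Qed.

Let pB : positive_form (op_form S).
Proof. by apply: op_form_pos => //; case: bS. Qed.

Let q u : R := qf (op_form S) u.

(** [C] bounds squared norms, so Cauchy-Schwarz gives [q u ^+ 2 <= C * sqn u ^+ 2]; hence the square
    root. *)
Lemma op_form_bound : exists2 K : R, 0 <= K & forall u, q u <= K * sqn u.
Proof.
have /bounded_operatorP[_ [C C0 SC]] := bS; exists (Num.sqrt C) => [|u]; first exact: sqrtr_ge0.
rewrite -(@ler_pXn2r _ 2) ?nnegrE ?mulr_ge0 ?sqrtr_ge0 ?sqn_ge0//; last exact: qf_ge0.
rewrite exprMn sqr_sqrtr//.
apply: (@le_trans _ _ (normc (dot (S u) u) ^+ 2)).
  rewrite ler_sqr ?nnegrE ?normc_ge0//; last exact: qf_ge0.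
  exact: le_trans (ler_norm _) (normr_Re_le _).
apply: (le_trans (dot_cs _ _)); rewrite expr2 mulrA.
by apply: ler_wpM2r; rewrite ?sqn_ge0.
Qed.

Section vector.
Variable psi : H.

Let a z i := dot (tfs_inv z psi) (e i).
Let s i j := dot (S (e i)) (e j).

Lemma op_form_comb z m n : op_form S (comb e (a z) m n) (comb e (a z) m n) =
  \sum_(m <= i < n) \sum_(m <= j < n) s i j * (a z i * conjc (a z j)).
Proof.
rewrite /comb (sesq_suml pB.1); apply: eq_bigr => i _.
rewrite (sesq_sumr pB.1); apply: eq_bigr => j _.
rewrite (sesqZl pB.1) (sesqZr pB.1) /op_form -/(s i j).
by move: (a z i) (a z j) (s i j) => x y t; ring.
Qed.

(** By [moyal_cross] the off-diagonal terms integrate to 0 whatever the entries [s i j]; only the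
    diagonal, that is a partial sum of the trace, survives. *)
Lemma op_form_comb_integral m n :
  integrableC muP (fun z => op_form S (comb e (a z) m n) (comb e (a z) m n)) /\
  integralC muP (fun z => op_form S (comb e (a z) m n) (comb e (a z) m n)) =
  (sqn psi)%:C * \sum_(m <= i < n) s i i.
Proof.
have iE i j : integrableC muP (fun z => s i j * (a z i * conjc (a z j))).
  by apply: integrableCZ; exact: integrableC_tfs.
have vE i j : integralC muP (fun z => s i j * (a z i * conjc (a z j))) =
    (sqn psi)%:C * (s i j * (j == i)%:R).
  rewrite integralCZ; last exact: integrableC_tfs.
  by rewrite [X in _ * X](moyal_cross psi (e i) (e j)) eB.1 mulrCA.
under [X in integrableC _ X]eq_fun do rewrite op_form_comb.
under [in X in _ /\ X]eq_integralC do rewrite op_form_comb.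
have h i := integralC_sum (index_iota m n) (iE i).
have [h1 h2] := integralC_sum (index_iota m n) (fun i => (h i).1).
split => //; rewrite h2 mulr_sumr big_nat [in RHS]big_nat; apply: eq_bigr => i imn.
rewrite (h i).2; under eq_bigr do rewrite vE.
rewrite -mulr_sumr; congr (_ * _).
rewrite (bigD1_seq i) ?mem_index_iota ?iota_uniq//= eqxx mulr1 big1 ?addr0// => j ji.
by rewrite (negbTE ji) mulr0.
Qed.

Let partial n := \sum_(0 <= i < n) Re (s i i).

Lemma diag_ge0 i : 0 <= Re (s i i).
Proof. by have := pS (e i); rewrite ge0C => /andP[]. Qed.

Lemma partial_le1 n : partial n <= 1.
Proof.
have pnd : nondecreasing_seq partial.
  apply/nondecreasing_seqP => k; rewrite /partial big_nat_recr//= lerDl.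
  exact: diag_ge0.
have tS' : partial @ \oo --> (1 : R) by exact: tS.
have cS : cvgn partial by apply/cvg_ex; exists 1.
by have := nondecreasing_cvgn_le pnd cS n; rewrite (cvg_lim _ tS').
Qed.

Lemma partial_le m n : (m <= n)%N -> \sum_(m <= i < n) Re (s i i) <= 1 - partial m.
Proof.
move=> mn; have := partial_le1 n.
by rewrite {1}/partial (@big_cat_nat _ _ _ m 0 n)//= -/(partial m) lerBrDl.
Qed.

Lemma integral_qf_comb m n :
  (\int[muP]_z (q (comb e (a z) m n))%:E = (sqn psi * \sum_(m <= i < n) Re (s i i))%:E)%E.
Proof.
have [[iR _] /(congr1 (@complex.Re R))] := op_form_comb_integral m n.
rewrite !RIE /= mul0r subr0 => h.
have -> : \sum_(m <= i < n) Re (s i i) = Re (\sum_(m <= i < n) s i i).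
  by elim/big_ind2 : _ => // x1 x2 y1 y2 -> ->; rewrite RIE.
rewrite -h /Rintegral fineK//.
exact: integrable_fin_num iR.
Qed.

Lemma measurable_qf_comb m n : measurable_fun setT (fun z : phase => q (comb e (a z) m n)).
Proof. by have [/integrableC_mfunC[]] := op_form_comb_integral m n. Qed.

Let comb_cvg z m : (fun n => q (comb e (a z) m (m + n)%N)) @ \oo -->
  q (tfs_inv z psi - comb e (a z) 0 m).
Proof.
have [K K0 qK] := op_form_bound.
apply: (qf_cvg pB K0 qK) => eps eps0.
have [N NP] := proj_cvg eB (tfs_inv z psi) eps0.
exists N => n Nn.
rewrite -(combB _ _ (leq_addr n m)) opprB addrA subrK.
by apply: NP; rewrite (leq_trans Nn)// leq_addl.
Qed.

Let comb00 z : comb e (a z) 0 0 = 0. Proof. by rewrite /comb big_geq. Qed.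

Lemma measurable_qf_tfs_inv : measurable_fun setT (fun z : phase => q (tfs_inv z psi)).
Proof.
apply: (measurable_fun_cvg (h := fun n z => q (comb e (a z) 0 n))).
  by move=> n; exact: measurable_qf_comb.
by move=> z _; have := @comb_cvg z 0; rewrite comb00 subr0.
Qed.

(** The tail is the limit of the sections from [m] to [m + n], whose integrals are bounded by the
    missing part of the trace; Fatou passes to the limit. The case [m = 0] is the upper half of the
    trace formula. *)
Lemma integral_qf_tail m :
  (\int[muP]_z (q (tfs_inv z psi - comb e (a z) 0 m))%:E <= (sqn psi * (1 - partial m))%:E)%E.
Proof.
apply: (@fatou_cst _ _ _ muP (fun n z => q (comb e (a z) m (m + n)%N))).
- by move=> n; exact: measurable_qf_comb.
- apply: (measurable_fun_cvg (h := fun n z => q (comb e (a z) m (m + n)%N))).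
    by move=> n; exact: measurable_qf_comb.
  by move=> z _; exact: comb_cvg.
- by move=> n z; exact: qf_ge0.
- by apply: aeW => z; exact: comb_cvg.
- move=> n; rewrite integral_qf_comb lee_fin; apply: ler_wpM2l; first exact: sqn_ge0.
  by apply: partial_le; exact: leq_addr.
Qed.

(** For the lower bound, a finite section is the whole vector minus its tail: [qfD_le] and
    [integral_qf_tail] bound its integral, and for fixed [eps] the tail term disappears as [m]
    grows. *)
Lemma trace_formula : (\int[muP]_z (q (tfs_inv z psi))%:E = (sqn psi)%:E)%E.
Proof.
have le1 : (\int[muP]_z (q (tfs_inv z psi))%:E <= (sqn psi)%:E)%E.
  have := integral_qf_tail 0; rewrite /partial big_geq// subr0 mulr1.
  by under eq_integral do rewrite comb00 subr0.
have ge0 : (0 <= \int[muP]_z (q (tfs_inv z psi))%:E)%E.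
  by apply: integral_ge0 => z _; rewrite lee_fin; exact: qf_ge0.
have [I IE] : exists I : R, (\int[muP]_z (q (tfs_inv z psi))%:E)%E = I%:E.
  exists (fine (\int[muP]_z (q (tfs_inv z psi))%:E)%E); rewrite fineK// ge0_fin_numE//.
  by rewrite (le_lt_trans le1)// ltry.
rewrite IE in le1 ge0 *; move: le1 ge0; rewrite !lee_fin => le1 I0.
congr EFin; apply/eqP; rewrite eq_le le1 /=.
have key eps m : 0 < eps -> sqn psi * partial m <=
    (1 + eps) * I + (1 + eps^-1) * (sqn psi * (1 - partial m)).
  move=> eps0; have e1 : 0 <= 1 + eps by rewrite addr_ge0// ltW.
  have e2 : 0 <= 1 + eps^-1 by rewrite addr_ge0// invr_ge0 ltW.
  have q0 u : (0 <= (q u)%:E)%E by rewrite lee_fin; exact: qf_ge0.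
  have mt : measurable_fun setT (fun z : phase => (q (tfs_inv z psi - comb e (a z) 0 m))%:E).
    apply/measurable_EFinP.
    apply: (measurable_fun_cvg (h := fun n z => q (comb e (a z) m (m + n)%N))).
      by move=> n; exact: measurable_qf_comb.
    by move=> z _; exact: comb_cvg.
  have mv : measurable_fun setT (fun z : phase => (q (tfs_inv z psi))%:E).
    by apply/measurable_EFinP; exact: measurable_qf_tfs_inv.
  rewrite -lee_fin -integral_qf_comb.
  apply: (@le_trans _ _ (\int[muP]_z ((1 + eps)%:E * (q (tfs_inv z psi))%:E +
      (1 + eps^-1)%:E * (q (tfs_inv z psi - comb e (a z) 0 m))%:E))%E).
    apply: ge0_le_integral => //.
    - by apply/measurable_EFinP; exact: measurable_qf_comb.
    - by apply: emeasurable_funD; exact: measurable_funeM.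
    - move=> z _; rewrite -!EFinM -EFinD lee_fin.
      have := qfD_le pB (tfs_inv z psi) (- (tfs_inv z psi - comb e (a z) 0 m)) eps0.
      by rewrite subKr (qfN pB).
  rewrite ge0_integralD//; first last.
  - exact: measurable_funeM.
  - by move=> z _; rewrite mule_ge0// lee_fin.
  - exact: measurable_funeM.
  - by move=> z _; rewrite mule_ge0// lee_fin.
  rewrite !ge0_integralZl_EFin// IE.
  have -> : ((1 + eps) * I + (1 + eps^-1) * (sqn psi * (1 - partial m)))%:E =
      ((1 + eps)%:E * I%:E + (1 + eps^-1)%:E * (sqn psi * (1 - partial m))%:E)%E.
    by rewrite -!EFinM -EFinD.
  apply: leeD2l; apply: lee_wpmul2l; first by rewrite lee_fin.
  exact: integral_qf_tail.
have lim eps : 0 < eps -> sqn psi <= (1 + eps) * I.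
  move=> eps0; pose rhs m := (1 + eps) * I + (1 + eps^-1) * (sqn psi * (1 - partial m)).
  have tS' : partial @ \oo --> (1 : R) by exact: tS.
  have l1 : (fun m => sqn psi * partial m) @ \oo --> sqn psi * 1.
    by apply: cvgM => //; exact: cvg_cst.
  have l2 : rhs @ \oo --> (1 + eps) * I + (1 + eps^-1) * (sqn psi * (1 - 1)).
    apply: cvgD; first exact: cvg_cst.
    apply: cvgM; first exact: cvg_cst.
    apply: cvgM; first exact: cvg_cst.
    by apply: cvgB => //; exact: cvg_cst.
  have := ler_cvg_to l1 l2; rewrite subrr !mulr0 addr0 mulr1; apply.
  by apply: nearW => m; exact: key.
rewrite leNgt; apply/negP => Ilt.
have [I00|Ip] := eqVneq I 0.
  by have := lim 1 ltr01; rewrite I00 mulr0 leNgt -{1}I00 Ilt.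
have {}Ip : 0 < I by rewrite lt_def Ip.
(* With this [eps], [(1 + eps) * I] is the midpoint of [I] and [sqn psi], which contradicts
   [I < sqn psi]. *)
have eps0 : 0 < (sqn psi - I) / (2 * I) by rewrite divr_gt0 ?subr_gt0// mulr_gt0.
have := lim _ eps0.
have -> : (1 + (sqn psi - I) / (2 * I)) * I = (sqn psi + I) / 2 by field; rewrite gt_eqF.
lra.
Qed.

End vector.

End trace_formula.

(** * The covariant measure *)

Section countable_additivity.
Context d (T : measurableType d) (R : realType).
Variable mu : {measure set T -> \bar R}.

Lemma cvg_sum_indic (M : nat -> set T) x : trivIset setT M ->
  (fun n => \sum_(0 <= i < n) \1_(M i) x) @ \oo --> (\1_(\bigcup_i M i) x : R).
Proof.
move=> tM; rewrite indicE; have [/set_mem[k _ Mkx]|Ux] := boolP (x \in \bigcup_i M i).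
  apply: cvg_near_cst; exists k.+1 => // n /= kn.
  rewrite (bigD1_seq k) ?mem_index_iota ?iota_uniq//= indicE mem_set// big1 ?addr0// => i ik.
  rewrite indicE; have [/set_mem Mix|//] := boolP (x \in M i).
  by move: ik; rewrite (tM i k)// ?eqxx//; exists x.
apply: cvg_near_cst; exists 0%N => // n _.
rewrite big1// => i _; rewrite indicE; have [/set_mem Mix|//] := boolP (x \in M i).
by move: Ux; rewrite notin_setE => -[]; exists i.
Qed.

(** Dominated convergence: by disjointness the partial sums of the indicators stay between 0 and 1,
    so [|f|] dominates. *)
Lemma cvg_Rintegral_indic (M : nat -> set T) (f : T -> R) :
  (forall i, measurable (M i)) -> trivIset setT M -> mu.-integrable setT (EFin \o f) ->
  (fun n => \sum_(0 <= i < n) \int[mu]_x (\1_(M i) x * f x)) @ \oo -->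
  \int[mu]_x (\1_(\bigcup_i M i) x * f x).
Proof.
move=> mM tM fi; have mf : measurable_fun setT f.
  by apply/measurable_EFinP; exact: measurable_int fi.
have ii (A : set T) : measurable A -> mu.-integrable setT (EFin \o (fun x => \1_A x * f x)).
  move=> mA; apply: (le_integrable _ _ _ fi) => //.
    by apply/measurable_EFinP; apply: measurable_funM.
  move=> x _ /=; rewrite lee_fin normrM indicE; case: (_ \in _) => /=.
    by rewrite normr1 mul1r.
  by rewrite normr0 mul0r.
pose g n x := \sum_(0 <= i < n) \1_(M i) x * f x.
have gE n x : g n x = (\sum_(0 <= i < n) \1_(M i) x) * f x by rewrite mulr_suml.
have gi n : mu.-integrable setT (EFin \o g n) /\
    \int[mu]_x g n x = \sum_(0 <= i < n) \int[mu]_x (\1_(M i) x * f x).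
  rewrite /g; elim: n => [|n [ih1 ih2]].
    under eq_fun do rewrite big_geq//; rewrite big_geq//; split; first exact: integrable0.
    by rewrite /Rintegral integral0.
  under eq_fun do rewrite big_nat_recr//=; rewrite big_nat_recr//= -ih2; split.
    exact: (integrableD measurableT ih1 (ii _ (mM n))).
  by rewrite RintegralD//; exact: ii.
have mU : measurable (\bigcup_i M i) by exact: bigcup_measurable.
have s01 n x : 0 <= (\sum_(0 <= i < n) \1_(M i) x : R) <= 1.
  have [[k [kn Mkx]]|nM] := pselect (exists k, (k < n)%N /\ M k x).
    rewrite (bigD1_seq k) ?mem_index_iota ?iota_uniq//= indicE mem_set// big1 ?addr0 ?ler01 ?lexx//.
    move=> i ik; rewrite indicE; have [/set_mem Mix|//] := boolP (x \in M i).
    by move: ik; rewrite (tM i k)// ?eqxx//; exists x.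
  rewrite big_nat big1 ?lexx ?ler01// => i /andP[_ lin]; rewrite indicE.
  by have [/set_mem Mix|//] := boolP (x \in M i); exfalso; apply: nM; exists i.
have gcvg x : (fun n => g n x) @ \oo --> \1_(\bigcup_i M i) x * f x.
  under eq_fun do rewrite gE; apply: cvgM; last exact: cvg_cst.
  exact: cvg_sum_indic.
have gle n x : (`|(EFin \o g n) x| <= `|f x|%:E)%E.
  rewrite /= lee_fin gE normrM ler_piMl//.
  by have /andP[s0 s1] := s01 n x; rewrite ger0_norm.
have fabs : mu.-integrable setT (fun x => `|f x|%:E) by exact: integrable_norm fi.
have ecvg : {ae mu, forall x, setT x -> (fun n => (EFin \o g n) x) @ \oo -->
    (EFin \o (fun x => \1_(\bigcup_i M i) x * f x)) x}.
  by apply: aeW => x _; apply: cvg_EFin; [exact: nearW|exact: gcvg].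
have ele : {ae mu, forall x n, setT x -> (`|(EFin \o g n) x| <= `|f x|%:E)%E}.
  by apply: aeW => x n _; exact: gle.
have [_ _] := dominated_convergence measurableT (fun n => measurable_int _ (gi n).1)
  (measurable_int _ (ii _ mU)) ecvg fabs ele.
rewrite /= -(fineK (integrable_fin_num measurableT (ii _ mU))) => dc.
have -> : (fun n => \sum_(0 <= i < n) \int[mu]_x (\1_(M i) x * f x)) =
  (fun n => \int[mu]_x g n x) by apply/funext => n; rewrite (gi n).2.
exact: (fine_cvg dc).
Qed.

End countable_additivity.

Lemma Re_series {R : realType} (u : nat -> R[i]) n :
  Re (series u n) = \sum_(0 <= i < n) Re (u i).
Proof. by rewrite /series /=; elim/big_ind2 : _ => // x1 x2 y1 y2 <- <-; rewrite RIE. Qed.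

Lemma Im_series {R : realType} (u : nat -> R[i]) n :
  Im (series u n) = \sum_(0 <= i < n) Im (u i).
Proof. by rewrite /series /=; elim/big_ind2 : _ => // x1 x2 y1 y2 <- <-; rewrite RIE. Qed.

Section povm.
Context {R : realType} (d : nat).
Local Notation lebV := (@lebesgue_rV R).
Local Notation H := (L2 (lebV d)).
Local Notation dot := (@dotL2 _ _ R (lebV d)).
Local Notation phase := (phase R d).
Local Notation muP := (phase_measure R d).
Variables (S : H -> H) (e : nat -> H).
Hypotheses (bS : bounded_operator S) (pS : positive_operator S) (eB : orthonormal_basis e).
Hypothesis tS : (fun n => \sum_(0 <= i < n) Re (dot (S (e i)) (e i))) @ \oo --> (1 : R).

Let dS : sesquilinear dot := (dotL2_pos (lebV d)).1.

(** This is [<alpha_z(S) psi, phi>], by [dot_shift_operator]; with the shifts on the arguments,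
    positivity is inherited from [op_form]. *)
Definition shifted_form (z : phase) psi phi : R[i] :=
  op_form S (tfs_inv z psi) (tfs_inv z phi).

Lemma shifted_form_pos z : positive_form (shifted_form z).
Proof.
have pB : positive_form (op_form S) by apply: op_form_pos => //; case: bS.
split => [|u]; last exact: pB.2.
have lin a u v : tfs_inv z (a *: u + v) = a *: tfs_inv z u + tfs_inv z v.
  exact: tfs_inv_linear.
by split => a u v w; rewrite /shifted_form lin (pB.1.1, pB.1.2).
Qed.

Lemma integrableC_shifted_diag psi : integrableC muP (fun z => shifted_form z psi psi).
Proof.
under eq_fun do rewrite (qfE (shifted_form_pos _)).
apply: integrableC_real; apply/integrableP; split.
  by apply/measurable_EFinP; exact: (measurable_qf_tfs_inv bS pS eB psi).
under eq_integral do rewrite /= ger0_norm ?(qf_ge0 (shifted_form_pos _))//.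
have -> : (\int[muP]_z (qf (shifted_form z) psi)%:E = (sqn psi)%:E)%E.
  exact: (trace_formula bS pS eB tS psi).
exact: ltry.
Qed.

(** Off the diagonal the integrand has no sign; polarisation reduces it to four diagonal terms,
    integrable by the trace formula. *)
Lemma integrableC_shifted psi phi : integrableC muP (fun z => shifted_form z psi phi).
Proof.
have D u := integrableC_shifted_diag u.
have B f g : integrableC muP f -> integrableC muP g -> integrableC muP (fun z => f z - g z).
  move=> fi gi; have := integrableCD fi (integrableCZ (-1) gi).
  by under eq_fun do rewrite mulN1r.
under eq_fun do rewrite (polarization (shifted_form_pos _).1).
apply: integrableCZ; apply: integrableCD; first exact: B.
by apply: integrableCZ; exact: B.
Qed.

Definition chi_form M psi phi : R[i] :=
  integralC muP (fun z => chi M z * shifted_form z psi phi).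

Lemma integrableC_chi (M : set phase) (f : phase -> R[i]) : measurable M ->
  integrableC muP f -> integrableC muP (fun z => chi M z * f z).
Proof.
move=> mM fi; apply: (@integrableC_le _ _ _ _ _ (fun z => normc (f z))).
- apply: mfunCM; last exact: integrableC_mfunC fi.
  by apply: mfunC_real; exact: measurable_indic.
- exact: integrableC_normc.
- move=> z; rewrite Normc.normcM /chi normcR indicE.
  by case: (_ \in _); rewrite ?normr1 ?mul1r// normr0 mul0r normc_ge0.
Qed.

Lemma chi_form_pos M : measurable M -> positive_form (chi_form M).
Proof.
move=> mM; have I u v : integrableC muP (fun z => chi M z * shifted_form z u v).
  by apply: integrableC_chi => //; exact: integrableC_shifted.
split => [|u]; last first.
  apply: ge0_integralC => z; apply: mulr_ge0; last exact: (shifted_form_pos z).2.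
  by rewrite ge0C /chi /= eqxx andbT indicE.
split => [a u v w|a u v w]; rewrite /chi_form -integralCZ// -integralCD//;
  try exact: integrableCZ; apply: eq_integralC => z.
  rewrite (shifted_form_pos z).1.1.
  by move: (chi M z) (shifted_form z u w) (shifted_form z v w) => k p q; ring.
rewrite (shifted_form_pos z).1.2.
by move: (conjc a) (chi M z) (shifted_form z u v) (shifted_form z u w) => b k p q; ring.
Qed.

Lemma chi_formT psi phi : chi_form setT psi phi = dot psi phi.
Proof.
have D u : chi_form setT u u = dot u u.
  rewrite (qfE (dotL2_pos (lebV d))) -/(sqn u) /chi_form.
  under eq_integralC do rewrite /chi indicT mul1r (qfE (shifted_form_pos _)).
  rewrite integralC_real; congr (_%:C).
  by rewrite /Rintegral [X in fine X](trace_formula bS pS eB tS u).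
by rewrite (polarization (chi_form_pos measurableT).1) !D -(polarization dS).
Qed.

Lemma chi_form_le M u : measurable M -> qf (chi_form M) u <= sqn u.
Proof.
move=> mM; rewrite /sqn /qf -chi_formT /chi_form /=.
have I A : measurable A -> integrableC muP (fun z => chi A z * shifted_form z u u).
  by move=> mA; apply: integrableC_chi => //; exact: integrableC_shifted.
apply: le_Rintegral => //; [exact: (I _ mM).1|exact: (I _ measurableT).1|].
move=> z _; suff: Re (chi M z * shifted_form z u u) <= Re (chi setT z * shifted_form z u u) by [].
rewrite /chi indicT mul1r (qfE (shifted_form_pos z)) -rmorphM /= ler_piMl//.
exact: (qf_ge0 (shifted_form_pos z)).
Qed.

(** Measurability sits under the existential so that [choice] yields a map on all sets, with
    arbitrary values at the nonmeasurable ones. The form is bounded with constant 1 by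
    Cauchy-Schwarz and [chi_form_le]. *)
Lemma chi_operator M : exists F : H -> H, measurable M ->
  bounded_operator F /\ forall u v, dot (F u) v = chi_form M u v.
Proof.
have [mM|nM] := pselect (measurable M); last by exists id.
have pM := chi_form_pos mM.
have [|A bA AE] := riesz_form eB pM.1 ler01; last by exists A.
move=> u v; rewrite mul1r; apply: (le_trans (cauchy_schwarz pM u v)).
by apply: ler_pM; rewrite ?chi_form_le//; exact: qf_ge0.
Qed.

Lemma chi_form_bigcup (M : nat -> set phase) psi phi : (forall i, measurable (M i)) ->
  trivIset setT M ->
  (series (fun i => chi_form (M i) psi phi) : nat -> R[i]^o) @ \oo -->
  (chi_form (\bigcup_i M i) psi phi : R[i]^o).
Proof.
move=> mM tM; have [iR iI] := integrableC_shifted psi phi.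
have ReE A : Re (chi_form A psi phi) = \int[muP]_z (\1_A z * Re (shifted_form z psi phi)).
  by apply: eq_Rintegral => z _; rewrite RIE /= mul0r subr0.
have ImE A : Im (chi_form A psi phi) = \int[muP]_z (\1_A z * Im (shifted_form z psi phi)).
  by apply: eq_Rintegral => z _; rewrite RIE /= mul0r addr0.
apply: cvgC_ReIm.
- have := cvg_Rintegral_indic mM tM iR; rewrite -ReE.
  rewrite (_ : (fun n => _) = (fun n => Re (series (fun i => chi_form (M i) psi phi) n)))//.
  by apply/funext => n; rewrite Re_series; apply: eq_bigr => i _; rewrite ReE.
- have := cvg_Rintegral_indic mM tM iI; rewrite -ImE.
  rewrite (_ : (fun n => _) = (fun n => Im (series (fun i => chi_form (M i) psi phi) n)))//.
  by apply/funext => n; rewrite Im_series; apply: eq_bigr => i _; rewrite ImE.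
Qed.

Lemma translateE (M : set phase) z : translate M z = (fun w => w - z) @^-1` M.
Proof.
apply/seteqP; split => [_ [m Mm <-]|w /= Mw]; first by rewrite /= addrK.
by exists (w - z) => //; rewrite subrK.
Qed.

Lemma measurable_translate (M : set phase) z : measurable M -> measurable (translate M z).
Proof.
move=> mM; rewrite translateE -[X in measurable X]setTI.
exact: measurable_phase_translation.
Qed.

Lemma shifted_form_tfs_inv w z psi phi :
  shifted_form w (tfs_inv z psi) (tfs_inv z phi) = shifted_form (w + z) psi phi.
Proof.
have pB : positive_form (op_form S) by apply: op_form_pos => //; case: bS.
have [c c1 cE] := tfs_inv_comp z w; rewrite /shifted_form !cE (addrC w z).
rewrite (sesqZl pB.1) (sesqZr pB.1); move: (op_form _ _ _) => q.
by rewrite mulrA mulr_conjc c1 expr1n mul1r.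
Qed.

Lemma chi_form_translate M z psi phi : measurable M ->
  chi_form M (tfs_inv z psi) (tfs_inv z phi) = chi_form (translate M z) psi phi.
Proof.
move=> mM; pose f w := chi M w * shifted_form (w + z) psi phi.
have mf : measurable_funC f.
  apply: mfunCM; first by apply: mfunC_real; exact: measurable_indic.
  have mt : measurable_fun setT (fun w : phase => w + z).
    have := measurable_phase_translation (- z).
    by under eq_fun do rewrite opprK.
  exact: (mfunC_comp mt (integrableC_mfunC (integrableC_shifted psi phi))).
transitivity (integralC muP f).
  by apply: eq_integralC => w; rewrite /f -shifted_form_tfs_inv.
rewrite -(integralC_preserving (measurable_phase_translation z) (phase_translation z) mf).
apply: eq_integralC => w; rewrite /f subrK; congr (_ * _).
by rewrite /chi translateE; congr (_%:C); rewrite !indicE.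
Qed.

End povm.

(** [trace] takes the default value 0 when the diagonal series have no common sum, so a nonzero
    value is a genuine trace. *)
Lemma is_trace_trace d (T : measurableType d) (R : realType)
    (mu : {measure set T -> \bar R}) (S : L2 mu -> L2 mu) :
  trace S != 0 -> is_trace S (trace S).
Proof.
have [tS _|nS] := pselect (exists t, is_trace S t); first exact: xgetPex.
by rewrite /trace xgetPN ?eqxx// => t tS; apply: nS; exists t.
Qed.

Theorem proposition9p1 (R : realType) (d : nat) (d_gt0 : (0 < d)%N)
    (S : L2 (@lebesgue_rV R d) -> L2 (@lebesgue_rV R d)) :
  positive_operator S -> trace_class S -> trace S = 1 ->
  exists F : set (phase R d) -> L2 (@lebesgue_rV R d) -> L2 (@lebesgue_rV R d),
    [/\ is_povm F, covariant F &
        forall Omega : set (phase R d), measurable Omega ->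
          is_convolution (chi Omega) S (F Omega)].
Proof.
move=> pS [bS [_ [e [_ eB _]]]] trS.
(* The value 1 is not the default value of [trace], so the diagonal series converges to 1, in
   particular along the basis supplied by [trace_class]. *)
have tS : (fun n => \sum_(0 <= i < n) Re (dotL2 (S (e i)) (e i))) @ \oo --> (1 : R).
  have := @is_trace_trace _ _ _ _ S; rewrite trS => /(_ (oner_neq0 _) e eB) /cvgC_Re.
  by under eq_fun do rewrite Re_series.
have [F FP] := choice (chi_operator bS pS eB tS).
have bF M : measurable M -> bounded_operator (F M) by move=> /FP[].
have FE M psi phi : measurable M -> dotL2 (F M psi) phi = chi_form S M psi phi.
  by move=> /FP[_].
exists F; split.
- split.
  + move=> M mM; split; first exact: bF.
    by move=> u; rewrite FE//; exact: (chi_form_pos bS pS eB tS mM).2.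
  + apply/funext => psi; apply: dotL2_eq => phi.
    by rewrite FE// (chi_formT bS pS eB tS).
  + move=> M mM tM psi phi; rewrite FE; last exact: bigcup_measurable.
    under eq_fun do rewrite FE//.
    exact: (chi_form_bigcup bS pS eB tS).
- move=> z M mM; apply/funext => psi; apply: dotL2_eq => phi.
  rewrite (FE _ psi phi (measurable_translate z mM)) -(chi_form_translate bS pS eB tS z _ _ mM).
  by rewrite (dot_shift_operator z (F M) psi phi) (FE M _ _ mM).
- move=> M mM; split; first exact: bF.
  move=> psi phi /=.
  have -> : (fun z => chi M z * dotL2 (shift_operator z S psi) phi) =
      (fun z => chi M z * shifted_form S z psi phi).
    by apply/funext => z; rewrite dot_shift_operator.
  split; last exact: FE.
  by apply: integrableC_chi => //; exact: (integrableC_shifted bS pS eB tS).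
Qed.
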